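(* Let $X$ be a rigid analytic space over $L$. Every abelian $A$-module $(E,\phi)$ of dimension $d$ on $X$ possesses a unique morphism $\exp_E:\mathrm{Lie}\,E\to E$ of rigid analytic vector bundles (as group spaces over $X$) such that $\exp_E\circ\phi_a'=\phi_a\circ\exp_E$ for all $a\in A$, and such that on every affinoid subdomain $\mathrm{Sp}\,B$ of $X$ which trivializes $E$, and for all coordinates of $E|_{\mathrm{Sp}\,B}$, the morphism $\exp_E|_{\mathrm{Sp}\,B}$ takes the form $B^d\to B^d$, $z\mapsto\sum_{j=0}^\infty e_jz^{(j)}$, with matrices $e_j\in M_d(B)$ satisfying $e_0=\mathrm{Id}$ and $\lim_{j\to\infty}q^{-j}\log|e_j|=-\infty$.
   Context: Setting. $\mathbb F_q$ is the finite field with $q$ elements, $C$ a complete, smooth, geometrically irreducible curve over $\mathbb F_q$, $\infty\in C$ a closed point, $A$ the ring of regular functions on $C\smallsetminus\{\infty\}$, $K=\mathrm{Frac}(A)$, $K_\infty$ the completion of $K$ at $\infty$, $\mathbb C_\infty$ the completion of an algebraic closure of $K_\infty$, $L$ a complete valued field with $K_\infty\subset L\subset\mathbb C_\infty$, and $\iota:A\subset K_\infty\subset L$. Abelian $A$-modules. $\mathbf{Vec}(X)$ is the category of locally free coherent $\mathcal O_X$-modules with $\mathbb F_q$-linear algebraic group homomorphisms, i.e. maps $E\to E'$ which on an admissible affinoid covering $\{\mathrm{Sp}\,B_i\}$ trivializing $E,E'$ are given by polynomials $\sum_{\nu=0}^{m_i}A_{i,\nu}\sigma^\nu$ with matrices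 $A_{i,\nu}$ over $B_i$ and $\sigma$ the componentwise $q$-power map. $\mathbb G_a$ is the object $\mathcal O_X$, $\mathrm{Lie}\,E$ is the tangent space of $E$ along the zero section, and $\alpha':\mathrm{Lie}\,E\to\mathrm{Lie}\,E'$ denotes the differential of $\alpha:E\to E'$. An abelian $A$-module of dimension $d$ and rank $r$ on $X$ is a vector bundle $E$ of rank $d$ with a ring homomorphism $\phi:A\to\mathrm{End}_{\mathbf{Vec}(X)}(E)$, $a\mapsto\phi_a$, such that: there are an admissible covering $\{X_i\}$ of $X$ and natural numbers $n_{i,a}$ with $(\iota(a)-\phi_a')^{n_{i,a}}\mathrm{Lie}\,E|_{X_i}=0$ for all $a\in A$; the sheaf $M(E):=\mathrm{Hom}_{\mathbf{Vec}(X)}(E,\mathbb G_a)$, with $a\in A$ acting by right composition with $\phi_a$, is a finitely generated $\mathcal O_X\otimes_{\mathbb F_q}A$-module; and $M(E)$ is flat over $\mathcal O_X$ with fiber at every $x\in X$ locally free of rank $r$ over $k(x)\otimes_{\mathbb F_q}A$. Coordinates on $E|_{\mathrm{Sp}\,B}$ are an isomorphism $\kappa:\Gamma(\mathrm{Sp}\,B,E)\to B^d$; it induces coordinates $\kappa':\Gamma(\mathrm{Sp}\,B,\mathrm{Lie}\,E)\to B^d$. $z^{(j)}$ denotes the componentwise $q^j$-power of $z$. $|\cdot|$ is a complete $L$-algebra norm on $B$, and $|e|$ for a matrix is the maximum of the norms of its entries ($\log0=-\infty$). *)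

(* Defs.v *)
From HB Require Import structures.
From mathcomp Require Import all_boot all_order all_algebra.
From mathcomp Require Import all_classical all_reals all_analysis.
Set Implicit Arguments.
Unset Strict Implicit.
Unset Printing Implicit Defensive.
Import Order.TTheory GRing.Theory Num.Theory.
Local Open Scope classical_set_scope.
Local Open Scope ring_scope.

(* * Curves over a finite field

   A complete smooth geometrically irreducible curve C over Fq is given by its
   function field K (Fq is perfect, so geometric irreducibility means that Fq
   is algebraically closed in K).  Its closed points are the nontrivial
   valuation rings of K containing Fq: the point is identified with its local
   ring, so that the regular functions on an open subset are the intersection
   of its points. *)
Section Curve.
Variables (Fq : finFieldType) (K : fieldType) (FqK : {rmorphism Fq -> K}).

Definition is_function_field :=
  (exists t : K, ~ algebraicOver FqK t /\
     exists (n : nat) (b : 'I_n -> K), forall x : K,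
       exists (p : 'I_n -> {poly Fq}) (s : {poly Fq}),
         s != 0 /\
         (map_poly FqK s).[t] * x = \sum_i (map_poly FqK (p i)).[t] * b i) /\
  (forall x : K, algebraicOver FqK x -> exists c, x = FqK c).

Definition is_closed_point (V : set K) :=
  [/\ forall c, V (FqK c),
      forall x y, V x -> V y -> V (x - y) /\ V (x * y),
      forall x, V x \/ V x^-1
    & exists x, ~ V x].

Definition regular_away_from (infty : set K) : set K :=
  [set f | forall V, is_closed_point V -> V <> infty -> V f].

End Curve.

(* * Complete nonarchimedean fields *)
Section ValuedField.
Variable R : realType.

Record complete_valued_field := CompleteValuedField {
  cvf_field :> fieldType;
  cvf_abs : cvf_field -> R;
  cvf_abs_ge0 : forall x, 0 <= cvf_abs x;
  cvf_abs_eq0 : forall x, cvf_abs x = 0 <-> x = 0;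
  cvf_absM : forall x y, cvf_abs (x * y) = cvf_abs x * cvf_abs y;
  cvf_absD : forall x y, cvf_abs (x + y) <= Num.max (cvf_abs x) (cvf_abs y);
  cvf_complete : forall u : nat -> cvf_field,
    (forall e : R, 0 < e -> exists N, forall m n, (N <= m)%N -> (N <= n)%N ->
       cvf_abs (u m - u n) < e) ->
    exists l, forall e : R, 0 < e -> exists N, forall n, (N <= n)%N ->
       cvf_abs (u n - l) < e }.

Variable C : complete_valued_field.

Definition abs_closure (S : set C) : set C :=
  [set x | forall e : R, 0 < e -> exists2 y, S y & cvf_abs (x - y) < e].

(* [C] is the completion of an algebraic closure of its subfield [F]. *)
Definition is_completed_alg_closure (F : set C) :=
  (forall p : {poly C}, p != 0 -> (forall i, F p`_i) ->
     exists (c : C) (s : seq C), p = c *: \prod_(a <- s) ('X - a%:P)) /\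
  abs_closure [set x | exists p : {poly C},
     [/\ p != 0, forall i, F p`_i & root p x]] = setT.

End ValuedField.

(* * The arithmetic data: Fq, C, infty, A, K, Coo, L and iota *)
Record base_data (R : realType) := BaseData {
  bd_Fq : finFieldType;
  bd_K : fieldType;
  bd_FqK : {rmorphism bd_Fq -> bd_K};
  bd_function_field : is_function_field bd_FqK;
  bd_infty : set bd_K;
  bd_infty_point : is_closed_point bd_FqK bd_infty;
  bd_A : comNzRingType;
  bd_FqA : {rmorphism bd_Fq -> bd_A};
  bd_AK : {rmorphism bd_A -> bd_K};
  bd_AK_inj : injective bd_AK;
  bd_AK_Fq : forall c, bd_AK (bd_FqA c) = bd_FqK c;
  bd_AK_range : range bd_AK = regular_away_from bd_FqK bd_infty;
  bd_Coo : complete_valued_field R;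
  bd_KC : {rmorphism bd_K -> bd_Coo};
  (* the absolute value of [bd_Coo] induces the place [bd_infty] on [bd_K],
     so that the closure of [bd_K] in [bd_Coo] is its completion at infty *)
  bd_KC_abs : forall f, bd_infty f <-> cvf_abs (bd_KC f) <= 1;
  bd_Coo_completion : is_completed_alg_closure (abs_closure (range bd_KC));
  bd_L : complete_valued_field R;
  bd_LC : {rmorphism bd_L -> bd_Coo};
  bd_LC_abs : forall x, cvf_abs (bd_LC x) = cvf_abs x;
  bd_Koo_sub_L : abs_closure (range bd_KC) `<=` range bd_LC;
  bd_iota : {rmorphism bd_A -> bd_L};
  bd_iotaE : forall a, bd_LC (bd_iota a) = bd_KC (bd_AK a) }.

(* * Affinoid algebras and affinoid spaces *)
Section Affinoid.
Variables (R : realType) (L : complete_valued_field R).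

(* Commutative L-algebras; unlike [comAlgType L] this allows the zero ring. *)
Record lalg := LAlg {
  la_ring :> comPzRingType;
  la_str : {rmorphism L -> la_ring} }.

Definition is_lhom (B B' : lalg) (f : {rmorphism B -> B'}) :=
  forall c : L, f (la_str B c) = la_str B' c.

Definition mideg n (m : {ffun 'I_n -> nat}) : nat := \sum_i m i.

(* Elements of the Tate algebra L<T_1, ..., T_n>, by their coefficients. *)
Definition tate_series n (f : {ffun 'I_n -> nat} -> L) :=
  forall e : R, 0 < e ->
    exists N, forall m, (N <= mideg m)%N -> cvf_abs (f m) < e.

Definition tate_const n (c : L) (m : {ffun 'I_n -> nat}) : L :=
  if m == [ffun=> 0%N] then c else 0.

Definition tate_mul n (f g : {ffun 'I_n -> nat} -> L)
    (m : {ffun 'I_n -> nat}) : L :=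
  \sum_(k : {ffun 'I_n -> 'I_(mideg m).+1} | [forall i, (k i <= m i)%N])
    f [ffun i => k i : nat] * g [ffun i => (m i - k i)%N].

Definition is_affinoid (B : lalg) :=
  exists (n : nat) (p : ({ffun 'I_n -> nat} -> L) -> B),
    [/\ forall c, p (@tate_const n c) = la_str B c,
        forall f g, tate_series f -> tate_series g ->
          p (fun m => f m + g m) = p f + p g,
        forall f g, tate_series f -> tate_series g ->
          p (tate_mul f g) = p f * p g
      & forall b, exists2 f, tate_series f & p f = b].

Definition is_maximal_ideal (B : comPzRingType) (I : set B) :=
  [/\ I 0, forall x y, I x -> I y -> I (x + y),
      forall b x, I x -> I (b * x), ~ I 1
    & forall x, ~ I x -> exists b y, I y /\ b * x + y = 1].

Definition Sp (B : lalg) : set (set B) := [set I | is_maximal_ideal I].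
Arguments Sp : clear implicits.

(* The morphism [f : B -> B'] represents the morphisms of affinoid spaces to
   [Sp B] with image in [U], i.e. makes [U] an affinoid subdomain. *)
Definition represents (B B' : lalg) (f : {rmorphism B -> B'})
    (U : set (set B)) :=
  [/\ is_affinoid B', is_lhom f, U `<=` Sp B,
      forall I, Sp B' I -> U (f @^-1` I)
    & forall (B'' : lalg) (g : {rmorphism B -> B''}),
        is_affinoid B'' -> is_lhom g ->
        (forall I, Sp B'' I -> U (g @^-1` I)) ->
        exists h : {rmorphism B' -> B''},
          [/\ is_lhom h, forall b, h (f b) = g b
            & forall h' : {rmorphism B' -> B''},
                is_lhom h' -> (forall b, h' (f b) = g b) -> h' =1 h]].

Definition is_affinoid_subdomain (B : lalg) (U : set (set B)) :=
  exists (B' : lalg) (f : {rmorphism B -> B'}), represents f U.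

(* For every affinoid morphism to [Sp B] with image in [U], the pullback of
   the family [F] has a finite refinement by affinoid subdomains. *)
Definition finitely_refines (B : lalg) (U : set (set B))
    (F : set (set (set B))) :=
  forall (B' : lalg) (f : {rmorphism B -> B'}),
    is_affinoid B' -> is_lhom f -> (forall I, Sp B' I -> U (f @^-1` I)) ->
    exists (n : nat) (W : 'I_n -> set (set B')),
      [/\ forall i, is_affinoid_subdomain (W i),
          forall I, Sp B' I -> exists i, W i I
        & forall i, exists2 V, F V & forall I, W i I -> V (f @^-1` I)].

(* The strong G-topology of [Sp B]. *)
Definition sp_adm (B : lalg) (U : set (set B)) :=
  U `<=` Sp B /\
  exists F : set (set (set B)),
    [/\ forall V, F V -> is_affinoid_subdomain V, U = \bigcup_(V in F) V
      & finitely_refines U F].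

Definition sp_cov (B : lalg) (U : set (set B)) (F : set (set (set B))) :=
  [/\ sp_adm U, forall V, F V -> sp_adm V, U = \bigcup_(V in F) V
    & finitely_refines U F].

(* Complete L-algebra norms on B. *)
Definition complete_norm (B : lalg) (nu : B -> R) :=
  [/\ forall x, 0 <= nu x /\ (nu x = 0 <-> x = 0),
      forall x y, nu (x - y) <= Num.max (nu x) (nu y),
      nu 1 <= 1 /\ forall x y, nu (x * y) <= nu x * nu y,
      forall c x, nu (la_str B c * x) = cvf_abs c * nu x
    & forall u : nat -> B,
        (forall e : R, 0 < e -> exists N, forall m n,
           (N <= m)%N -> (N <= n)%N -> nu (u m - u n) < e) ->
        exists l, forall e : R, 0 < e -> exists N, forall n, (N <= n)%N ->
           nu (u n - l) < e].

(* Convergence in B^d for the Banach topology of the affinoid algebra B. *)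
Definition converges (B : lalg) d (u : nat -> 'cV[B]_d) (l : 'cV[B]_d) :=
  forall nu, complete_norm nu -> forall e : R, 0 < e ->
    exists N, forall n, (N <= n)%N -> forall i, nu ((u n - l) i 0) < e.

Definition mxnorm (B : lalg) (nu : B -> R) m n (M : 'M[B]_(m, n)) : R :=
  \big[Num.max/0]_i \big[Num.max/0]_j nu (M i j).

End Affinoid.

Arguments Sp {R L} B _.

(* * Rigid analytic spaces *)

(* G-topological spaces satisfying the completeness conditions (G0)-(G2). *)
Record gspace := GSpace {
  gs_pt :> Type;
  adm : set (set gs_pt);
  cov : set gs_pt -> set (set (set gs_pt));
  cov_adm : forall U F, cov U F ->
    [/\ adm U, forall V, F V -> adm V & U = \bigcup_(V in F) V];
  admI : forall U V, adm U -> adm V -> adm (U `&` V);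
  cov_id : forall U, adm U -> cov U [set U];
  cov_comp : forall U F (G : set gs_pt -> set (set gs_pt)), cov U F ->
    (forall V, F V -> cov V (G V)) -> cov U (\bigcup_(V in F) G V);
  cov_pull : forall U F V, cov U F -> adm V -> V `<=` U ->
    cov V [set W `&` V | W in F];
  adm0 : adm set0;
  admT : adm setT;
  adm_local : forall U F V, cov U F -> V `<=` U ->
    (forall W, F W -> adm (V `&` W)) -> adm V;
  cov_refined : forall U F G, adm U -> (forall V, F V -> adm V) ->
    U = \bigcup_(V in F) V -> cov U G ->
    (forall W, G W -> exists2 V, F V & W `<=` V) -> cov U F }.

Record aopen (X : gspace) := AOpen {
  open_set :> set X;
  open_adm : adm open_set }.

Definition whole (X : gspace) : aopen X := AOpen (@admT X).

Definition is_sheaf (X : gspace) (S : aopen X -> Type)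
    (res : forall U V : aopen X, V `<=` U -> S U -> S V) :=
  forall (U : aopen X) (F : set (set X)), cov U F ->
  forall s : forall V : aopen X, S V,
    (forall (V W T : aopen X) (hV : T `<=` V) (hW : T `<=` W),
       F V -> F W -> res V T hV (s V) = res W T hW (s W)) ->
    exists! t : S U, forall (V : aopen X) (h : V `<=` U), F V -> res U V h t = s V.

Section Rigid.
Variables (R : realType) (L : complete_valued_field R).

Record ringed_gspace := RingedGSpace {
  rg_space :> gspace;
  OX : aopen rg_space -> lalg L;
  res : forall U V : aopen rg_space, V `<=` U -> {rmorphism OX U -> OX V};
  res_lhom : forall (U V : aopen rg_space) (h : V `<=` U), is_lhom (res h);
  res_id : forall (U : aopen rg_space) (h : U `<=` U) s, res h s = s;
  res_comp : forall (U V W : aopen rg_space) (h : V `<=` U) (h' : W `<=` V) (h'' : W `<=` U) s,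
    res h' (res h s) = res h'' s;
  OX_sheaf : is_sheaf (fun (U V : aopen rg_space) (h : V `<=` U) => res h : OX U -> OX V) }.

(* [(U, O|_U)] is isomorphic to [Sp (OX U)] with its strong G-topology and its
   structure sheaf, via the point map [p]; the structure sheaf is pinned down
   by its values on affinoid subdomains. *)
Definition is_affinoid_open (X : ringed_gspace) (U : aopen X) :=
  is_affinoid (OX U) /\
  exists p : X -> set (OX U),
    [/\ set_bij U (Sp (OX U)) p,
        forall V : set X, V `<=` U -> adm V <-> sp_adm (p @` V),
        forall (V : set X) (F : set (set X)), V `<=` U ->
          (forall W, F W -> W `<=` V) ->
          cov V F <-> sp_cov (p @` V) [set p @` W | W in F]
      & forall (V : aopen X) (h : V `<=` U),
          is_affinoid_subdomain (p @` V) -> represents (res h) (p @` V)].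

Record rigid_space := RigidSpace {
  rs_space :> ringed_gspace;
  rs_affinoid_cover : exists F : set (set rs_space), cov setT F /\
    forall U : aopen rs_space, F U -> is_affinoid_open U }.

(* * Vector bundles *)
Section Bundle.
Variable X : rigid_space.

Record mod_sheaf := ModSheaf {
  sec :> forall U : aopen X, lmodType (OX U);
  mres : forall U V : aopen X, V `<=` U -> sec U -> sec V;
  mres_add : forall (U V : aopen X) (h : V `<=` U) x y,
    mres h (x + y) = mres h x + mres h y;
  mres_scale : forall (U V : aopen X) (h : V `<=` U) (b : OX U) x,
    mres h (b *: x) = res h b *: mres h x;
  mres_id : forall (U : aopen X) (h : U `<=` U) x, mres h x = x;
  mres_comp : forall (U V W : aopen X) (h : V `<=` U) (h' : W `<=` V) (h'' : W `<=` U) x,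
    mres h' (mres h x) = mres h'' x;
  mod_is_sheaf : is_sheaf mres }.

(* Maps of total spaces are represented by their effect on local sections. *)
Definition smap (E E' : mod_sheaf) := forall U : aopen X, E U -> E' U.

Definition res_compatible (E E' : mod_sheaf) (U : aopen X) (f : smap E E') :=
  forall (V W : aopen X) (h : W `<=` V), V `<=` U ->
    forall x, f W (mres h x) = mres h (f V x).

(* The structure sheaf as a module over itself. *)
Program Definition Ga : mod_sheaf :=
  @ModSheaf (fun U => (OX U)^o) (fun U V h => res h) _ _ _ _ _.
Next Obligation. by move=> U V h x y; exact: (rmorphD (res h)). Qed.
Next Obligation. by move=> U V h b x; exact: (rmorphM (res h)). Qed.
Next Obligation. exact: res_id. Qed.
Next Obligation. exact: res_comp. Qed.
Next Obligation. exact: OX_sheaf. Qed.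

(* Coordinates on [E|_U]: an isomorphism of sheaves of modules between [E|_U]
   and [O_U^d] (the components over opens not contained in [U] are junk). *)
Definition coords (E : mod_sheaf) d := forall V : aopen X, E V -> 'cV[OX V]_d.

Definition is_coords (E : mod_sheaf) d (U : aopen X) (k : coords E d) :=
  (forall V : aopen X, V `<=` U ->
     bijective (k V) /\ forall (b : OX V) x y, k V (b *: x + y) = b *: k V x + k V y) /\
  (forall (V W : aopen X) (h : W `<=` V), V `<=` U ->
     forall x, k W (mres h x) = map_mx (res h) (k V x)).

Definition is_vector_bundle (E : mod_sheaf) d :=
  exists F : set (set X), cov setT F /\
    forall U : aopen X, F U -> exists k : coords E d, is_coords U k.

(* For a vector bundle [E], the tangent space of the total space of [E] along
   its zero section is [E] itself (the vector eps v over the dual numbers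
   corresponding to v), and coordinates k on E induce k' = k on Lie E. *)
Definition Lie (E : mod_sheaf) : mod_sheaf := E.
Definition lie_coords (E : mod_sheaf) d (k : coords E d) : coords (Lie E) d := k.

Section Vec.
Variable q : nat.

(* z^(j) *)
Definition frob (B : comPzRingType) d (j : nat) (z : 'cV[B]_d) : 'cV[B]_d :=
  map_mx (fun x => x ^+ (q ^ j)) z.

(* Over [U], [f] is given in coordinates by sum_(j <= n) A_j sigma^j. *)
Definition is_poly_on (E E' : mod_sheaf) d d' (U : aopen X) (k : coords E d)
    (k' : coords E' d') (f : smap E E') n (A : nat -> 'M[OX U]_(d', d)) :=
  forall (V : aopen X) (h : V `<=` U) x,
    k' V (f V x) = \sum_(j < n.+1) map_mx (res h) (A j) *m frob j (k V x).

(* Morphisms E|_U -> E'|_U in Vec(U), for E of rank d and E' of rank d'. *)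
Definition is_vec_hom (E E' : mod_sheaf) (d d' : nat) (U : aopen X)
    (f : smap E E') :=
  res_compatible U f /\
  exists F : set (set X), cov U F /\ forall V : aopen X, F V ->
    is_affinoid_open V /\
    exists (k : coords E d) (k' : coords E' d') n (A : nat -> 'M[OX V]_(d', d)),
      [/\ is_coords V k, is_coords V k' & is_poly_on k k' f n A].

(* [f'] is the differential of [f] along the zero section: the linear part. *)
Definition is_differential (E E' : mod_sheaf) (d d' : nat)
    (f : smap E E') (f' : smap (Lie E) (Lie E')) :=
  res_compatible (whole X) f' /\
  forall (U : aopen X) (k : coords E d) (k' : coords E' d') n
      (A : nat -> 'M[OX U]_(d', d)),
    is_affinoid_open U -> is_coords U k -> is_coords U k' ->
    is_poly_on k k' f n A ->
    forall (V : aopen X) (h : V `<=` U) v,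
      lie_coords k' (f' V v) = map_mx (res h) (A 0%N) *m lie_coords k v.

End Vec.

(* Morphisms E -> E' of analytic group spaces over X: homomorphisms of the
   sheaves of sections which are given locally, in coordinates, by power
   series in d variables over B converging on all of affine d-space.  Such a
   series is determined by its values on L^d, hence by its effect on sections,
   and it is additive as soon as it is so on sections. *)
Definition is_analytic_hom (E E' : mod_sheaf) (d d' : nat) (f : smap E E') :=
  [/\ res_compatible (whole X) f,
      forall (U : aopen X) x y, f U (x + y) = f U x + f U y
    & exists F : set (set X), cov setT F /\ forall U : aopen X, F U ->
      is_affinoid_open U /\
      exists (k : coords E d) (k' : coords E' d')
             (c : {ffun 'I_d -> nat} -> 'cV[OX U]_d'),
        [/\ is_coords U k, is_coords U k',
            forall nu, complete_norm nu -> forall rho e : R,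
              0 < rho -> 0 < e -> exists N, forall m, (N <= mideg m)%N ->
                mxnorm nu (c m) * rho ^+ mideg m < e
          & forall (V : aopen X) (h : V `<=` U), is_affinoid_open V ->
            forall x, converges
              (fun n => \sum_(m : {ffun 'I_d -> 'I_n} | (\sum_i m i < n)%N)
                 (\prod_i k V x i 0 ^+ m i) *:
                 map_mx (res h) (c [ffun i => m i : nat]))
              (k' V (f V x))]].

End Bundle.

(* * Stalks and flatness *)

(* A model of the local ring of X at x. *)
Record stalk (X : rigid_space) (x : X) := Stalk {
  st_ring :> comPzRingType;
  germ : forall U : aopen X, open_set U x -> {rmorphism OX U -> st_ring};
  germ_res : forall (U V : aopen X) (h : V `<=` U) (hU : open_set U x)
      (hV : open_set V x) s, germ hV (res h s) = germ hU s;
  germ_surj : forall a : st_ring,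
    exists (U : aopen X) (hU : open_set U x) s, germ hU s = a;
  germ_eq0 : forall (U : aopen X) (hU : open_set U x) s, germ hU s = 0 ->
    exists (V : aopen X) (h : V `<=` U), open_set V x /\ res h s = 0 }.

(* The residue field k(x): O_x is local, so any surjection from it to a field
   is its residue map. *)
Record residue (S : comPzRingType) := Residue {
  rf_field :> fieldType;
  rf_ev : {rmorphism S -> rf_field};
  rf_surj : forall a, exists s, rf_ev s = a }.

End Rigid.

Section Commutative.

(* sum_i x_i (x) m_i = 0 in the tensor product of N and M over S. *)
Definition tensor_zero (S : comPzRingType) (N M : lmodType S) n
    (x : 'I_n -> N) (m : 'I_n -> M) :=
  forall (Q : lmodType S) (beta : N -> M -> Q),
    (forall s y y' z, beta (s *: y + y') z = s *: beta y z + beta y' z) ->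
    (forall s y z z', beta y (s *: z + z') = s *: beta y z + beta y z') ->
    \sum_i beta (x i) (m i) = 0.

(* Tensoring with M preserves injectivity. *)
Definition is_flat (S : comPzRingType) (M : lmodType S) :=
  forall (N N' : lmodType S) (f : {linear N -> N'}), injective f ->
  forall n (x : 'I_n -> N) (m : 'I_n -> M),
    tensor_zero (fun i => f (x i)) m -> tensor_zero x m.

(* A model of the tensor product of the F-algebras B and C. *)
Record tensor_alg (F B C : comPzRingType) (u : F -> B) (v : F -> C) :=
  TensorAlg {
  ta_ring :> comPzRingType;
  ta_l : {rmorphism B -> ta_ring};
  ta_r : {rmorphism C -> ta_ring};
  ta_comm : forall c, ta_l (u c) = ta_r (v c);
  ta_univ : forall (T : comPzRingType) (f : {rmorphism B -> T})
      (g : {rmorphism C -> T}), (forall c, f (u c) = g (v c)) ->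
    exists h : {rmorphism ta_ring -> T},
      [/\ forall b, h (ta_l b) = f b, forall c, h (ta_r c) = g c
        & forall h' : {rmorphism ta_ring -> T},
            (forall b, h' (ta_l b) = f b) -> (forall c, h' (ta_r c) = g c) ->
            h' =1 h] }.

(* There are f_i generating the unit ideal such that each localization P[1/f_i]
   is free of rank r over T[1/f_i] (a basis may be chosen in the image of P). *)
Definition is_locally_free_of_rank (T : comPzRingType) (P : lmodType T) r :=
  exists (n : nat) (f : 'I_n -> T),
    (exists c : 'I_n -> T, \sum_i c i * f i = 1) /\
    forall i, exists b : 'I_r -> P,
      (forall p, exists (N : nat) (c : 'I_r -> T),
         f i ^+ N *: p = \sum_j c j *: b j) /\
      (forall c : 'I_r -> T, \sum_j c j *: b j = 0 ->
         forall j, exists N : nat, f i ^+ N * c j = 0).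

End Commutative.

(* * Abelian A-modules *)
Section AbelianModule.
Variables (R : realType) (D : base_data R) (X : rigid_space (bd_L D)).

Definition bd_q : nat := #|bd_Fq D|.

Section Fiber.
Variables (d : nat) (E : mod_sheaf X) (phi : bd_A D -> smap E E).

(* Sections over [U] of M(E). *)
Definition is_dual (U : aopen X) (f : smap E (Ga X)) :=
  is_vec_hom bd_q d 1 U f.

Definition dual_act (a : bd_A D) (f : smap E (Ga X)) : smap E (Ga X) :=
  fun V e => f V (phi a e).

(* M(E) is a finitely generated O_X (x) A-module. *)
Definition dual_finitely_generated :=
  exists F : set (set X), cov setT F /\ forall U : aopen X, F U ->
    exists (n : nat) (g : 'I_n -> smap E (Ga X)),
      (forall i, is_dual U (g i)) /\
      forall (V : aopen X) (f : smap E (Ga X)), V `<=` U -> is_dual V f ->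
        exists G : set (set X), cov V G /\ forall W : aopen X, G W ->
          exists (l : nat) (b : 'I_n -> 'I_l -> OX W) (a : 'I_n -> 'I_l -> bd_A D),
            forall (T : aopen X) (h : T `<=` W) (e : E T),
              f T e = \sum_i \sum_j res h (b i j) * dual_act (a i j) (g i) e.

(* A model of the stalk of M(E) at x. *)
Record dual_stalk (x : X) (S : stalk x) := DualStalk {
  ds_mod :> lmodType S;
  dgerm : aopen X -> smap E (Ga X) -> ds_mod;
  dgerm_eq : forall (U V : aopen X) f g, open_set U x -> open_set V x ->
    is_dual U f -> is_dual V g ->
    dgerm U f = dgerm V g <->
    exists W : aopen X, [/\ W `<=` U, W `<=` V, open_set W x
      & forall (T : aopen X) (e : E T), T `<=` W -> f T e = g T e];
  dgerm_surj : forall m, exists (U : aopen X) f,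
    [/\ open_set U x, is_dual U f & dgerm U f = m];
  dgerm_add : forall (U : aopen X) f g, open_set U x ->
    is_dual U f -> is_dual U g ->
    dgerm U (fun V e => f V e + g V e) = dgerm U f + dgerm U g;
  dgerm_scale : forall (U : aopen X) (hU : open_set U x) (b : OX U) f g,
    is_dual U f -> is_dual U g ->
    (forall (V : aopen X) (h : V `<=` U) (e : E V), g V e = res h b * f V e) ->
    dgerm U g = germ S hU b *: dgerm U f }.

Definition Fq_residue (x : X) (S : stalk x) (k : residue S) (c : bd_Fq D) : k :=
  rf_ev k (germ S (U := whole X) I (la_str (OX (whole X)) (bd_iota D (bd_FqA D c)))).

(* A model of the fiber of M(E) at x, i.e. of M(E)_x / m_x M(E)_x, as a module
   over k(x) (x) A. *)
Record dual_fiber (x : X) (S : stalk x) (M : dual_stalk S) (k : residue S)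
    (T : tensor_alg (@Fq_residue x S k) (bd_FqA D)) := DualFiber {
  df_mod :> lmodType T;
  df_proj : M -> df_mod;
  df_add : forall m m', df_proj (m + m') = df_proj m + df_proj m';
  df_scale : forall s m, df_proj (s *: m) = ta_l T (rf_ev k s) *: df_proj m;
  df_act : forall (U : aopen X) f a, open_set U x -> is_dual U f ->
    df_proj (dgerm M U (dual_act a f)) = ta_r T a *: df_proj (dgerm M U f);
  df_surj : forall p, exists m, df_proj m = p;
  df_ker : forall m, df_proj m = 0 <->
    exists (n : nat) (s : 'I_n -> S) (m' : 'I_n -> M),
      (forall i, rf_ev k (s i) = 0) /\ m = \sum_i s i *: m' i }.

Definition dual_flat_locally_free r :=
  forall x : X, exists (S : stalk x) (M : dual_stalk S),
    is_flat M /\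
    exists (k : residue S) (T : tensor_alg (@Fq_residue x S k) (bd_FqA D))
      (P : dual_fiber M T), is_locally_free_of_rank P r.

End Fiber.

Record abelian_module (d r : nat) := AbelianModule {
  am_bundle :> mod_sheaf X;
  am_vector_bundle : is_vector_bundle am_bundle d;
  am_phi : bd_A D -> smap am_bundle am_bundle;
  am_phi_hom : forall a, is_vec_hom bd_q d d (whole X) (am_phi a);
  am_phi1 : forall (U : aopen X) (e : am_bundle U), am_phi 1 e = e;
  am_phiD : forall a b (U : aopen X) (e : am_bundle U),
    am_phi (a + b) e = am_phi a e + am_phi b e;
  am_phiM : forall a b (U : aopen X) (e : am_bundle U),
    am_phi (a * b) e = am_phi a (am_phi b e);
  am_dphi : bd_A D -> smap (Lie am_bundle) (Lie am_bundle);
  am_dphi_diff : forall a, is_differential bd_q d d (am_phi a) (am_dphi a);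
  am_nilpotent : exists F : set (set X), cov setT F /\
    forall U : aopen X, F U -> exists n : bd_A D -> nat,
    forall a (V : aopen X) (v : Lie am_bundle V), V `<=` U ->
      iter (n a) (fun w => la_str (OX V) (bd_iota D a) *: w - am_dphi a w) v = 0;
  am_fingen : dual_finitely_generated d am_phi;
  am_flat_rank : dual_flat_locally_free d am_phi r }.
Arguments am_phi [d r] E a [U] e : rename.
Arguments am_dphi [d r] E a [U] v : rename.

(* On [U], in the coordinates [k], psi is z |-> sum_j e_j z^(j). *)
Definition is_exp_series (E : mod_sheaf X) d (psi : smap (Lie E) E)
    (U : aopen X) (k : coords E d) (e : nat -> 'M[OX U]_d) :=
  [/\ e 0%N = 1%:M,
      forall nu : OX U -> R, complete_norm nu ->
        ((bd_q%:R ^- j)%:E * lne (mxnorm nu (e j))%:E)%E @[j --> \oo] --> -oo%E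
    & forall (V : aopen X) (h : V `<=` U), is_affinoid_open V ->
      forall v : Lie E V, converges
        (fun n => \sum_(j < n)
           map_mx (res h) (e j) *m frob bd_q j (lie_coords k v))
        (k V (psi V v))].

Definition is_exponential d r (E : abelian_module d r)
    (psi : smap (Lie E) E) :=
  [/\ is_analytic_hom d d psi,
      forall a (U : aopen X) (v : Lie E U),
        psi U (am_dphi E a v) = am_phi E a (psi U v)
    & forall (U : aopen X) (k : coords E d), is_affinoid_open U -> is_coords U k ->
        exists e : nat -> 'M[OX U]_d, is_exp_series psi k e].

End AbelianModule.

(* Main.v *)
(* In coordinates, phi_a is a twisted polynomial P_a = sum_j P_(a,j) sigma^j,
   and replacing a by a power a^(p^s) makes P_(a,0) the scalar iota(a). If
   |iota(a)| > 1, the equation e P_(a,0) = P_a e with e_0 = 1 amounts to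
     (iota(a)^(q^n) - iota(a)) e_n = sum_(i > 0) P_(a,i) sigma^i(e_(n-i)),
   which has a unique solution; |e_n| decays doubly exponentially, and e
   intertwines every phi_b since phi_b commutes with phi_a. Uniqueness makes
   the coefficients compatible with restriction and change of coordinates, so
   the values sum_j e_j z^(j) glue. Conversely, the coefficients of an
   exponential are determined by its values at the vectors c z, c in L.

   Convergence must not depend on the norm and must commute with restriction:
   morphisms of affinoid algebras have closed graph. This is reduced to finite
   dimension by showing that a submodule of T_n^r maximal among those avoiding
   a given vector has finite codimension. The same fact shows that finitely
   many members of a cover of an affinoid space detect the zero function.

   If |iota(a)| <= 1 for all a, then A lies in every valuation ring of K over
   Fq, hence A = Fq. As M(E) is finitely generated over O_X (x) Fq, the degrees
   in sigma of its elements are then locally bounded, which forces E = 0. *)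
Require Import Defs.
From HB Require Import structures.
From mathcomp Require Import all_boot all_order all_algebra.
From mathcomp Require finfield.
From mathcomp Require Import all_classical all_reals all_analysis.
From mathcomp Require Import ring lra zify.
Set Implicit Arguments.
Unset Strict Implicit.
Unset Printing Implicit Defensive.
Import Order.TTheory GRing.Theory Num.Theory numFieldNormedType.Exports.
Local Open Scope classical_set_scope.
Local Open Scope ring_scope.

(** * Complete norms *)

(** The case split on |iota(a)| stands in for the existence of a nonconstant function in A. When
    |iota(a)| > 1, the factor iota(a)^(q^n) - iota(a) is both nonzero and large, so a single
    recursion yields existence, uniqueness and decay. A power of p makes the constant term scalar
    because phi_a' - iota(a) is nilpotent and commutes with the scalar iota(a). The statement ranges
    over every complete norm on every affinoid algebra, so no norm is preferred. The device for this
    is a finitely generated submodule of finite codimension: the open mapping theorem bounds its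
    functionals for all complete norms alike. Zorn's lemma supplies submodules maximal among those
    avoiding a vector. Their quotients are torsion, so Noether normalization makes them finite over
    one variable fewer, which drives the induction. Closed graph is the right form of continuity
    here: the decay of the coefficients gives convergence over both algebras, and the closed graph
    identifies the two limits. *)

Lemma geometric_small (R : realType) (q C e : R) : 0 <= q < 1 -> 0 <= C -> 0 < e ->
  exists K, forall k, (K <= k)%N -> q ^+ k * C < e.
Proof.
move=> /andP[q0 q1] C0 e0; have C1 : 0 < C + 1 by rewrite ltr_wpDl.
have : (q ^+ k @[k --> \oo] --> (0 : R)) by apply: cvg_expr; rewrite ger0_norm.
move/cvgrPdist_lt => /(_ _ (divr_gt0 e0 C1)) [K _ hK]; exists K => k /hK /=.
rewrite sub0r normrN ger0_norm ?exprn_ge0 // => h.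
apply: (@le_lt_trans _ _ (q ^+ k * (C + 1))); last by rewrite -ltr_pdivlMr.
by rewrite ler_wpM2l ?exprn_ge0 // lerDl.
Qed.

(** The change of indices behind associativity of Cauchy products, both the commutative one and the
    one twisted by Frobenius. *)
Lemma triangle_sum (V : nmodType) (F : nat -> nat -> V) n :
  \sum_(i < n.+1) \sum_(j < i.+1) F j (i - j)%N
  = \sum_(j < n.+1) \sum_(k < (n - j).+1) F j k.
Proof.
elim: n => [|n IH]; first by rewrite !big_ord1.
rewrite big_ord_recr /= IH [in RHS]big_ord_recr /= subnn big_ord1.
rewrite [X in _ + X]big_ord_recr /= subnn addrA; congr (_ + _).
rewrite -big_split /=; apply: eq_bigr => j _.
have jn : (j <= n)%N by rewrite -ltnS.
by rewrite (subSn jn) [in RHS]big_ord_recr.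
Qed.

Section NormTheory.
Variables (R : realType) (L : complete_valued_field R).

Definition nu_lim (B : lalg L) (nu : B -> R) (u : nat -> B) (l : B) :=
  forall e : R, 0 < e -> exists N, forall n, (N <= n)%N -> nu (u n - l) < e.

Section OneNorm.
Variables (B : lalg L) (nu : B -> R) (H : complete_norm nu).

Lemma nu_ge0 x : 0 <= nu x. Proof. by case: H => h *; case: (h x). Qed.
Lemma nu_eq0 x : nu x = 0 <-> x = 0. Proof. by case: H => h *; case: (h x). Qed.
Lemma nu0 : nu 0 = 0. Proof. exact/nu_eq0. Qed.

Lemma nuB_le x y e : nu x <= e -> nu y <= e -> nu (x - y) <= e.
Proof.
case: H => _ h _ _ _ hx hy; apply: le_trans (h x y) _.
by rewrite ge_max hx hy.
Qed.

Lemma nuN x : nu (- x) = nu x.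
Proof.
have le y : nu (- y) <= nu y.
  by rewrite -[- y]add0r; apply: nuB_le; rewrite ?nu0 ?nu_ge0.
by apply/eqP; rewrite eq_le le /= -{1}[x]opprK le.
Qed.

Lemma nuD_le x y e : nu x <= e -> nu y <= e -> nu (x + y) <= e.
Proof. by move=> hx hy; rewrite -[y]opprK; apply: nuB_le; rewrite ?nuN. Qed.

Lemma nuB_lt x y e : nu x < e -> nu y < e -> nu (x - y) < e.
Proof.
move=> hx hy; apply: (@le_lt_trans _ _ (Num.max (nu x) (nu y))).
  by apply: nuB_le; rewrite le_max lexx ?orbT.
by rewrite gt_max hx hy.
Qed.

Lemma nuD_lt x y e : nu x < e -> nu y < e -> nu (x + y) < e.
Proof. by move=> hx hy; rewrite -[y]opprK; apply: nuB_lt; rewrite ?nuN. Qed.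

Lemma nu_sum_le (I : Type) (r : seq I) (P : pred I) (F : I -> B) e :
  0 <= e -> (forall i, P i -> nu (F i) <= e) -> nu (\sum_(i <- r | P i) F i) <= e.
Proof.
move=> e0 h; elim/big_ind: _ => //; first by rewrite nu0.
by move=> x y; apply: nuD_le.
Qed.

Lemma nu_sum_lt (I : Type) (r : seq I) (P : pred I) (F : I -> B) e :
  0 < e -> (forall i, P i -> nu (F i) < e) -> nu (\sum_(i <- r | P i) F i) < e.
Proof.
move=> e0 h; elim/big_ind: _ => //; first by rewrite nu0.
by move=> x y; apply: nuD_lt.
Qed.

Lemma nuM_le x y : nu (x * y) <= nu x * nu y.
Proof. by case: H => _ _ []. Qed.

Lemma nu1_le : nu 1 <= 1. Proof. by case: H => _ _ []. Qed.

Lemma nuX_le x n : nu (x ^+ n) <= nu x ^+ n.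
Proof.
elim: n => [|n IH]; first by rewrite !expr0 nu1_le.
rewrite !exprS; apply: le_trans (nuM_le _ _) _.
by apply: ler_wpM2l => //; apply: nu_ge0.
Qed.

Lemma nuZ c x : nu (la_str B c * x) = cvf_abs c * nu x.
Proof. by case: H. Qed.

Lemma nu_distC x y : nu (x - y) = nu (y - x).
Proof. by rewrite -nuN opprB. Qed.

Lemma nu_lim_cst x : nu_lim nu (fun=> x) x.
Proof. by move=> e e0; exists 0%N => n _; rewrite subrr nu0. Qed.

Lemma nu_lim_ext u v l : (forall n, u n = v n) -> nu_lim nu u l -> nu_lim nu v l.
Proof. by move=> uv h e /h [N hN]; exists N => n /hN; rewrite uv. Qed.

Lemma nu_limD u v l m :
  nu_lim nu u l -> nu_lim nu v m -> nu_lim nu (fun n => u n + v n) (l + m).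
Proof.
move=> hu hv e e0; have [N hN] := hu e e0; have [M hM] := hv e e0.
exists (maxn N M) => n; rewrite geq_max => /andP[/hN h1 /hM h2].
by rewrite opprD addrACA; apply: nuD_lt.
Qed.

Lemma nu_limN u l : nu_lim nu u l -> nu_lim nu (fun n => - u n) (- l).
Proof.
by move=> hu e /hu [N hN]; exists N => n /hN; rewrite -opprD nuN.
Qed.

Lemma nu_limB u v l m :
  nu_lim nu u l -> nu_lim nu v m -> nu_lim nu (fun n => u n - v n) (l - m).
Proof. by move=> hu /nu_limN; apply: nu_limD. Qed.

Lemma nu_limMl a u l : nu_lim nu u l -> nu_lim nu (fun n => a * u n) (a * l).
Proof.
move=> hu e e0; have e1 : 0 < e / (nu a + 1).
  by rewrite divr_gt0 // ltr_wpDl // nu_ge0.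
have [N hN] := hu _ e1; exists N => n /hN h.
rewrite -mulrBr; apply: le_lt_trans (nuM_le _ _) _.
apply: (@le_lt_trans _ _ ((nu a + 1) * nu (u n - l))).
  by rewrite ler_wpM2r ?nu_ge0 // lerDl.
by rewrite mulrC -ltr_pdivlMr // ltr_wpDl // nu_ge0.
Qed.

Lemma nu_lim_uniq u l m : nu_lim nu u l -> nu_lim nu u m -> l = m.
Proof.
move=> hl hm; apply/eqP; rewrite -subr_eq0; apply/eqP/nu_eq0/eqP.
rewrite eq_le nu_ge0 andbT; apply/ler_addgt0Pl => e e0; rewrite addr0.
have [N hN] := hl e e0; have [M hM] := hm e e0.
have h1 := hN (maxn N M) (leq_maxl _ _); have h2 := hM (maxn N M) (leq_maxr _ _).
have -> : l - m = (u (maxn N M) - m) - (u (maxn N M) - l).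
  by ring.
exact/ltW/nuB_lt.
Qed.

Lemma nu_lim_sum (I : Type) (r : seq I) (P : pred I) (u : I -> nat -> B) l :
  (forall i, P i -> nu_lim nu (u i) (l i)) ->
  nu_lim nu (fun n => \sum_(i <- r | P i) u i n) (\sum_(i <- r | P i) l i).
Proof.
move=> h; elim: r => [|i r IH].
  rewrite big_nil; apply: nu_lim_ext (nu_lim_cst _) => n; by rewrite big_nil.
rewrite big_cons; case: ifP => Pi.
  by apply: nu_lim_ext (nu_limD (h i Pi) IH) => n; rewrite big_cons Pi.
by apply: nu_lim_ext IH => n; rewrite big_cons Pi.
Qed.

Lemma nu_lim_le u l e :
  nu_lim nu u l -> (exists N, forall n, (N <= n)%N -> nu (u n) <= e) -> nu l <= e.
Proof.
move=> hl [N hN]; apply/ler_addgt0Pl => d d0.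
have [M hM] := hl d d0; have := hM (maxn N M) (leq_maxr _ _).
have := hN (maxn N M) (leq_maxl _ _); set x := u _ => h1 h2.
have e0 : 0 <= e by apply: le_trans h1; apply: nu_ge0.
rewrite -[l](subKr x); apply: nuB_le.
  by rewrite (le_trans h1) // lerDr ltW.
by rewrite (le_trans (ltW h2)) // lerDl.
Qed.

Lemma nu_lim_shift u l k : nu_lim nu (fun n => u (n + k)%N) l -> nu_lim nu u l.
Proof.
move=> h e /h [N hN]; exists (N + k)%N => n hn.
have kn : (k <= n)%N by apply: leq_trans hn; apply: leq_addl.
by rewrite -(subnK kn); apply: hN; rewrite -(leq_add2r k) subnK.
Qed.

(** For an ultrametric norm, consecutive differences tending to 0 already make a sequence Cauchy;
    hence a series converges once its terms tend to 0. *)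
Lemma nu_complete u :
  (forall e : R, 0 < e -> exists N, forall n, (N <= n)%N -> nu (u n.+1 - u n) < e) ->
  exists l, nu_lim nu u l.
Proof.
case: H => _ _ _ _ hc h; apply: hc => e e0; have [N hN] := h e e0; exists N.
have hd n : nu (u (N + n)%N - u N) < e.
  elim: n => [|n IH]; first by rewrite addn0 subrr nu0.
  rewrite -(subrKA (u (N + n)%N)); apply: nuD_lt => //.
  by rewrite addnS; apply: hN; apply: leq_addr.
move=> m n /subnKC <- /subnKC <-; rewrite -(subrKA (u N)).
by apply: nuD_lt; rewrite // nu_distC.
Qed.

Lemma nu_series u :
  (forall e : R, 0 < e -> exists N, forall n, (N <= n)%N -> nu (u n) < e) ->
  exists l, nu_lim nu (fun n => \sum_(i < n) u i) l.
Proof.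
move=> h; apply: nu_complete => e /h [N hN]; exists N => n /hN.
by rewrite big_ord_recr /= addrAC subrr add0r.
Qed.

Lemma nu_lim0 u l : nu_lim nu u l <-> nu_lim nu (fun n => u n - l) 0.
Proof. by split=> h e /h [N hN]; exists N => n /hN; rewrite subr0. Qed.

End OneNorm.
End NormTheory.

(** * Tate algebras in one variable over a complete algebra *)

Section Tate1.
Variables (R : realType) (L : complete_valued_field R).
Variables (B : lalg L) (nu : B -> R) (H : complete_norm nu).

(** The proof [h] is a parameter of the type because the ring operations use it: canonical
    structures then find it in the type itself. *)
Record tate1_of (h : complete_norm nu) := Tate1 {
  tcoef :> nat -> B;
  tcoefP : forall e : R, 0 < e -> exists N, forall n, (N <= n)%N -> nu (tcoef n) < e }.
Local Notation tate1 := (tate1_of H).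

Lemma tate1_inj (f g : tate1) : (forall n, f n = g n) -> f = g.
Proof.
case: f g => f hf [g hg] /= /funext fg; case: _ / fg hg => hg.
by congr Tate1; apply: Prop_irrelevance.
Qed.

HB.instance Definition _ := gen_eqMixin tate1.
HB.instance Definition _ := gen_choiceMixin tate1.

Lemma tate0_subproof (e : R) : 0 < e ->
  exists N, forall n, (N <= n)%N -> nu ((fun _ : nat => 0) n) < e.
Proof.
by move=> e0; exists 0%N => n _; rewrite (nu0 H).
Qed.

Definition tate0 : tate1 := @Tate1 H (fun n => (fun _ : nat => 0) n) (@tate0_subproof ).

Lemma tate_opp_subproof (f : tate1) (e : R) : 0 < e ->
  exists N, forall n, (N <= n)%N -> nu (- f n) < e.
Proof.
by move=> /(tcoefP f) [N hN]; exists N => n /hN; rewrite (nuN H).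
Qed.

Definition tate_opp (f : tate1) : tate1 := @Tate1 H (fun n => - f n) (@tate_opp_subproof f).

Lemma tate_add_subproof (f g : tate1) (e : R) : 0 < e ->
  exists N, forall n, (N <= n)%N -> nu (f n + g n) < e.
Proof.
move=> e0; have [N hN] := tcoefP f e0; have [M hM] := tcoefP g e0.
exists (maxn N M) => n; rewrite geq_max => /andP[/hN h1 /hM h2].
exact: (nuD_lt H).
Qed.

Definition tate_add (f g : tate1) : tate1 := @Tate1 H (fun n => f n + g n) (@tate_add_subproof f g).

Lemma tateC_subproof (b : B) (e : R) : 0 < e ->
  exists N, forall n, (N <= n)%N -> nu (if n is 0 then b else 0) < e.
Proof.
by move=> e0; exists 1%N => -[|n] // _; rewrite (nu0 H).
Qed.

Definition tateC (b : B) : tate1 := @Tate1 H (fun n => if n is 0 then b else 0) (@tateC_subproof b).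

Lemma tate_bound (f : tate1) : exists2 C : R, 0 < C & forall n, nu (f n) <= C.
Proof.
Proof.
have [N hN] := tcoefP f ltr01.
exists (1 + \sum_(i < N) nu (f i)).
  by rewrite ltr_wpDr // sumr_ge0 // => i _; apply: nu_ge0.
move=> n; case: (leqP N n) => [/hN /ltW h|nN].
  by apply: le_trans h _; rewrite lerDl sumr_ge0 // => i _; apply: nu_ge0.
rewrite (bigD1 (Ordinal nN)) //= addrCA lerDl addr_ge0 //.
by rewrite sumr_ge0 // => i _; apply: nu_ge0.
Qed.

Lemma tate_mulr_subproof (f g : tate1) (e : R) : 0 < e ->
  exists N, forall n, (N <= n)%N -> nu (\sum_(i < n.+1) f i * g (n - i)%N) < e.
Proof.
move=> e0; have [C C0 hC] := tate_bound f; have [D D0 hD] := tate_bound g.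
have [N hN] := tcoefP f (divr_gt0 e0 D0); have [M hM] := tcoefP g (divr_gt0 e0 C0).
(* In degree at least [N + M], either the first index reaches [N] or the second reaches [M]. *)
exists (N + M)%N => n hn; apply: (nu_sum_lt H) => // i _.
apply: le_lt_trans (nuM_le H _ _) _; case: (leqP N i) => hi.
  apply: (@le_lt_trans _ _ (nu (f i) * D)).
    by rewrite ler_wpM2l ?nu_ge0.
  by rewrite -ltr_pdivlMr //; apply: hN.
apply: (@le_lt_trans _ _ (C * nu (g (n - i)%N))).
  by rewrite ler_wpM2r ?nu_ge0.
rewrite mulrC -ltr_pdivlMr //; apply: hM; lia.
Qed.

Definition tate_mulr (f g : tate1) : tate1 := @Tate1 H (fun n => \sum_(i < n.+1) f i * g (n - i)%N) (@tate_mulr_subproof f g).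

Lemma tate_addA : associative tate_add.
Proof. by move=> f g h; apply: tate1_inj => n /=; rewrite addrA. Qed.
Lemma tate_addC : commutative tate_add.
Proof. by move=> f g; apply: tate1_inj => n /=; rewrite addrC. Qed.
Lemma tate_add0 : left_id tate0 tate_add.
Proof. by move=> f; apply: tate1_inj => n /=; rewrite add0r. Qed.
Lemma tate_addN : left_inverse tate0 tate_opp tate_add.
Proof. by move=> f; apply: tate1_inj => n /=; rewrite addNr. Qed.
HB.instance Definition _ :=
  GRing.isZmodule.Build tate1 tate_addA tate_addC tate_add0 tate_addN.

Lemma tate_mulA : associative tate_mulr.
Proof.
move=> f g h; apply: tate1_inj => n /=.
pose F j k := f j * g k * h (n - (j + k))%N.
transitivity (\sum_(j < n.+1) \sum_(k < (n - j).+1) F j k).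
  apply: eq_bigr => j _; rewrite mulr_sumr; apply: eq_bigr => k _.
  by rewrite /F mulrA subnDA.
rewrite -triangle_sum; apply: eq_bigr => i _; rewrite mulr_suml.
by apply: eq_bigr => j _; rewrite /F subnKC // -ltnS.
Qed.
Lemma tate_mulC : commutative tate_mulr.
Proof.
move=> f g; apply: tate1_inj => n /=; rewrite (reindex_inj rev_ord_inj) /=.
by apply: eq_bigr => i _; rewrite mulrC subSS subKn // -ltnS.
Qed.
Lemma tate_mul1 : left_id (tateC 1) tate_mulr.
Proof.
move=> f; apply: tate1_inj => n /=; rewrite big_ord_recl /= subn0 mul1r.
by rewrite big1 ?addr0 // => i _; rewrite mul0r.
Qed.
Lemma tate_mulDl : left_distributive tate_mulr tate_add.
Proof.
move=> f g h; apply: tate1_inj => n /=; rewrite -big_split /=.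
by apply: eq_bigr => i _; rewrite mulrDl.
Qed.
HB.instance Definition _ :=
  GRing.Zmodule_isComPzRing.Build tate1 tate_mulA tate_mulC tate_mul1 tate_mulDl.

Lemma tate_coef0 n : (0 : tate1) n = 0. Proof. by []. Qed.
Lemma tate_coefB (f g : tate1) n : (f - g) n = f n - g n. Proof. by []. Qed.
Lemma tate_coefM (f g : tate1) n : (f * g) n = \sum_(i < n.+1) f i * g (n - i)%N.
Proof. by []. Qed.
Lemma tate_coef1 n : (1 : tate1) n = if n is 0 then 1 else 0. Proof. by []. Qed.
Lemma tate_coef_sum (I : Type) (r : seq I) (P : pred I) (F : I -> tate1) n :
  (\sum_(i <- r | P i) F i) n = \sum_(i <- r | P i) F i n.
Proof.
by elim/big_rec2: _ => // i x y _ <-.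
Qed.

Lemma tateCM_coef b (f : tate1) n : (tateC b * f) n = b * f n.
Proof.
rewrite tate_coefM big_ord_recl /= subn0 big1 ?addr0 // => i _.
by rewrite mul0r.
Qed.

Lemma tateC_zmod : zmod_morphism tateC.
Proof. by move=> x y; apply: tate1_inj => -[|n]; rewrite tate_coefB //= subr0. Qed.
Lemma tateC_monoid : monoid_morphism tateC.
Proof.
by split=> // x y; apply: tate1_inj => n; rewrite tateCM_coef; case: n => [|n] //=; rewrite mulr0.
Qed.
HB.instance Definition _ := GRing.isZmodMorphism.Build B tate1 tateC tateC_zmod.
HB.instance Definition _ := GRing.isMonoidMorphism.Build B tate1 tateC tateC_monoid.

Definition tate_str : L -> tate1 := tateC \o la_str B.
HB.instance Definition _ := GRing.RMorphism.on tate_str.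
Definition tate_lalg : lalg L := @LAlg R L tate1 tate_str.

Lemma tateX_subproof (e : R) : 0 < e ->
  exists N, forall n, (N <= n)%N -> nu (if n == 1%N then 1 else 0) < e.
Proof.
by move=> e0; exists 2%N => -[|[|n]] // _; rewrite (nu0 H).
Qed.

Definition tateX : tate1 := @Tate1 H (fun n => if n == 1%N then 1 else 0) (@tateX_subproof ).

Lemma tateXM_coef (f : tate1) n : (tateX * f) n = if n is m.+1 then f m else 0.
Proof.
rewrite tate_coefM; case: n => [|n]; first by rewrite big_ord1 /= mul0r.
rewrite big_ord_recl big_ord_recl /= mul0r add0r mul1r subSS subn0.
by rewrite big1 ?addr0 // => i _; rewrite mul0r.
Qed.

Lemma tateXn_coef k n : (tateX ^+ k) n = if n == k then 1 else 0.
Proof.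
elim: k n => [|k IH] n; first by rewrite expr0 tate_coef1; case: n.
by rewrite exprS tateXM_coef; case: n => // n; rewrite IH eqSS.
Qed.

Lemma tate_trunc (f : tate1) N n :
  (\sum_(i < N) tateC (f i) * tateX ^+ i) n = if (n < N)%N then f n else 0.
Proof.
rewrite tate_coef_sum; case: ltnP => nN.
  rewrite (bigD1 (Ordinal nN)) // tateCM_coef tateXn_coef eqxx mulr1 -[RHS]addr0.
  congr (_ + _); apply: big1 => i /andP[_ ne]; rewrite tateCM_coef tateXn_coef.
  case: eqP => [e|_]; last by rewrite mulr0.
  by case/eqP: ne; apply: val_inj.
rewrite big1 // => i _; rewrite tateCM_coef tateXn_coef.
by case: eqP => [e|_]; rewrite ?mulr0 //; move: (ltn_ord i); rewrite -e ltnNge nN.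
Qed.

Definition gauss (f : tate1) : R := sup (range (fun n => nu (f n))).

Lemma gauss_has_sup (f : tate1) : has_sup (range (fun n => nu (f n))).
Proof.
split; first by exists (nu (f 0%N)), 0%N.
by have [C _ hC] := tate_bound f; exists C => _ [n _ <-].
Qed.

Lemma gauss_ge (f : tate1) n : nu (f n) <= gauss f.
Proof. by apply: sup_ubound; [case: (gauss_has_sup f) | exists n]. Qed.

Lemma gauss_le (f : tate1) e : (forall n, nu (f n) <= e) -> gauss f <= e.
Proof.
move=> h; apply: ge_sup; first by case: (gauss_has_sup f).
by move=> _ [n _ <-].
Qed.

Lemma gauss_ge0 f : 0 <= gauss f.
Proof. by apply: le_trans (gauss_ge f 0); apply: nu_ge0. Qed.

(** Only finitely many coefficients exceed half the supremum, which is therefore a maximum. Strict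
    bounds and membership in the value group thus pass from the coefficients to the Gauss norm. *)
Lemma gauss_attained (f : tate1) : exists n, gauss f = nu (f n).
Proof.
have := gauss_ge0 f; rewrite le_eqVlt => /orP[/eqP e0|g0].
  exists 0%N; apply/eqP; rewrite eq_le gauss_ge andbT -e0; exact: nu_ge0.
have g2 : 0 < gauss f / 2 by rewrite divr_gt0.
have [N hN] := tcoefP f g2.
apply: contrapT => hne.
have lt n : nu (f n) < gauss f.
  rewrite lt_neqAle gauss_ge andbT; apply/eqP => e; apply: hne; by exists n.
pose m := \big[Num.max/gauss f / 2]_(i < N) nu (f i).
have : gauss f <= m.
  apply: gauss_le => n; case: (leqP N n) => [/hN /ltW h|nN].
    by apply: le_trans h _; exact: bigmax_ge_id.
  exact: (le_bigmax _ (fun i : 'I_N => nu (f i)) (Ordinal nN)).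
apply/negP; rewrite -ltNge /m.
elim/big_ind: _ => [|x y hx hy|i _]; last exact: lt.
  by rewrite ltr_pdivrMr // ltr_pMr // ltr1n.
by rewrite gt_max hx hy.
Qed.

Lemma gauss_lt (f : tate1) e : (forall n, nu (f n) < e) -> gauss f < e.
Proof. by move=> h; have [n ->] := gauss_attained f. Qed.

Lemma gauss_complete_norm : @complete_norm R L tate_lalg gauss.
Proof.
split.
- move=> f; split; first exact: gauss_ge0.
  split=> [f0|->].
    apply: tate1_inj => n; apply/(nu_eq0 H)/eqP.
    by rewrite eq_le (nu_ge0 H) andbT -f0 gauss_ge.
  apply/eqP; rewrite eq_le gauss_ge0 andbT; apply: gauss_le => n.
  by rewrite (nu0 H).
- move=> f g; apply: gauss_le => n; apply: (nuB_le H).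
    by apply: le_trans (gauss_ge f n) _; rewrite le_max lexx.
  by apply: le_trans (gauss_ge g n) _; rewrite le_max lexx orbT.
- split=> [|f g].
    apply: gauss_le => -[|n]; first exact: (nu1_le H).
    by rewrite tate_coef1 (nu0 H).
  apply: gauss_le => n; apply: (nu_sum_le H).
    by rewrite mulr_ge0 ?gauss_ge0.
  move=> i _; apply: le_trans (nuM_le H _ _) _.
  by apply: ler_pM; rewrite ?(nu_ge0 H) ?gauss_ge.
- move=> c f; apply/eqP; rewrite eq_le; apply/andP; split.
    apply: gauss_le => n; change (nu ((tateC (la_str B c) * (f : tate1)) n) <= cvf_abs c * gauss f).
    by rewrite tateCM_coef (nuZ H) ler_wpM2l ?cvf_abs_ge0 ?gauss_ge.
  have [n ->] := gauss_attained f; rewrite -(nuZ H).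
  by rewrite -tateCM_coef; apply: (gauss_ge (tateC _ * (f : tate1))).
- move=> u hu.
  have /choice[l hl] n : exists l, nu_lim nu (fun k => (u k : tate1) n) l.
    apply: (nu_complete H) => e /hu [N hN]; exists N => k hk.
    apply: le_lt_trans (hN k.+1 k (leqW hk) hk).
    by rewrite -tate_coefB; apply: (gauss_ge (u k.+1 - u k)).
  (* The termwise limits are uniform in the index, since the Cauchy bound for the Gauss norm
     survives the limit over [m]. *)
  have unif e : 0 < e -> exists K, forall k, (K <= k)%N -> forall n, nu ((u k : tate1) n - l n) <= e.
    move=> /hu [K hK]; exists K => k hk n; rewrite (nu_distC H).
    have := nu_limB H (hl n) (nu_lim_cst H ((u k : tate1) n)).
    move/(nu_lim_le H); apply; exists K => m hm.
    rewrite -tate_coefB; apply: le_trans (gauss_ge (u m - u k) n) _.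
    exact/ltW/hK.
  have lP e : 0 < e -> exists N, forall n, (N <= n)%N -> nu (l n) < e.
    move=> e0; have e2 : 0 < e / 2 by rewrite divr_gt0.
    have [K hK] := unif _ e2; have [N hN] := tcoefP (u K : tate1) e0.
    exists N => n /hN h; rewrite -[l n](subKr ((u K : tate1) n)).
    apply: (nuB_lt H) => //; apply: le_lt_trans (hK K (leqnn _) n) _.
    by rewrite ltr_pdivrMr // ltr_pMr // ltr1n.
  exists (Tate1 H lP) => e e0; have e2 : 0 < e / 2 by rewrite divr_gt0.
  have [K hK] := unif _ e2; exists K => k /hK h.
  apply: (@le_lt_trans _ _ (e / 2)); first exact: gauss_le.
  by rewrite ltr_pdivrMr // ltr_pMr // ltr1n.
Qed.

Lemma gaussC b : gauss (tateC b) = nu b.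
Proof.
apply/eqP; rewrite eq_le (gauss_ge (tateC b) 0) andbT.
by apply: gauss_le => -[|n] //=; rewrite (nu0 H) (nu_ge0 H).
Qed.

Lemma gaussXn k : gauss (tateX ^+ k) <= 1.
Proof.
apply: gauss_le => n; rewrite tateXn_coef; case: ifP => _; first exact: nu1_le.
by rewrite (nu0 H).
Qed.

Lemma tate_trunc_lim (f : tate1) :
  @nu_lim R L tate_lalg gauss (fun N => \sum_(i < N) tateC (f i) * tateX ^+ i) f.
Proof.
move=> e e0; have [N hN] := tcoefP f e0; exists N => n hn.
apply: gauss_lt => k; rewrite tate_coefB tate_trunc; case: ltnP => h.
  by rewrite subrr (nu0 H).
by rewrite sub0r (nuN H); apply: hN; apply: leq_trans h.
Qed.

Lemma tateX_not_unit (f : tate1) : (1 : B) != 0 -> tateX * f <> 1.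
Proof.
move=> n0 /(congr1 (fun g : tate1 => g 0%N)); rewrite tateXM_coef tate_coef1.
by move/esym/eqP; apply/negP.
Qed.

(** The product of the lowest nonzero coefficients is the lowest coefficient of the product. *)
Lemma tate_domain : (forall x y : B, x * y = 0 -> x = 0 \/ y = 0) ->
  forall f g : tate1, f * g = 0 -> f = 0 \/ g = 0.
Proof.
move=> dom f g fg0; apply: or_asboolP; apply: contrapT => /negP.
rewrite negb_or => /andP[/asboolPn f0 /asboolPn g0].
have low (h : tate1) : h <> 0 -> exists n, h n != 0 /\ forall m, (m < n)%N -> h m = 0.
  move=> h0; have ex : exists n, h n != 0.
    apply: contrapT => /forallNP hn; apply: h0; apply: tate1_inj => n.
    by apply/eqP/negPn/negP/hn.
  case: (ex_minnP ex) => n hn hmin; exists n; split=> // m mn.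
  by apply/eqP; apply: contraTT mn => /hmin; rewrite -leqNgt.
have [n [fn fm]] := low f f0; have [m [gm gk]] := low g g0.
have : (f * g) (n + m)%N = f n * g m.
  have nlt : (n < (n + m).+1)%N by rewrite ltnS leq_addr.
  rewrite tate_coefM (bigD1 (Ordinal nlt)) //= addKn big1 ?addr0 // => i ne.
  case: (ltngtP i n) => hi.
  - by rewrite fm // mul0r.
  - by rewrite gk ?mulr0 //; have := ltn_ord i; lia.
  - by case/eqP: ne; apply: val_inj.
rewrite fg0 tate_coef0 => /esym/dom [] /eqP; first by rewrite (negPf fn).
by rewrite (negPf gm).
Qed.

End Tate1.

(** * Iterated Tate algebras *)

Section Iterated.
Variables (R : realType) (L : complete_valued_field R).

Record banach_alg := BanachAlg {
  ban_alg :> lalg L;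
  ban_nu : ban_alg -> R;
  ban_norm : complete_norm ban_nu }.

Lemma cvf_abs1 : cvf_abs (1 : L) = 1.
Proof.
have n0 : cvf_abs (1 : L) != 0 by apply/eqP => /cvf_abs_eq0/eqP; rewrite oner_eq0.
by apply: (mulfI n0); rewrite -cvf_absM !mulr1.
Qed.

Lemma cvf_abs0 : cvf_abs (0 : L) = 0.
Proof. exact/cvf_abs_eq0. Qed.

Lemma cvf_abs_gt0 (x : L) : x != 0 -> 0 < cvf_abs x.
Proof.
move=> x0; rewrite lt_neqAle cvf_abs_ge0 andbT eq_sym.
by apply: contraNN x0 => /eqP/cvf_abs_eq0 ->.
Qed.

Lemma cvf_absX (x : L) n : cvf_abs (x ^+ n) = cvf_abs x ^+ n.
Proof. by elim: n => [|n IH]; rewrite ?expr0 ?cvf_abs1 // !exprS cvf_absM IH. Qed.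

Lemma cvf_absV (x : L) : cvf_abs x^-1 = (cvf_abs x)^-1.
Proof.
have [->|x0] := eqVneq x 0; first by rewrite invr0 cvf_abs0 invr0.
have n0 : cvf_abs x != 0 by rewrite gt_eqF // cvf_abs_gt0.
by apply: (mulfI n0); rewrite -cvf_absM !divff // cvf_abs1.
Qed.

Lemma cvf_absN (x : L) : cvf_abs (- x) = cvf_abs x.
Proof.
suff h : cvf_abs (-1 : L) = 1 by rewrite -mulN1r cvf_absM h mul1r.
have := cvf_absM (-1 : L) (-1); rewrite mulN1r opprK cvf_abs1.
move/esym/eqP; rewrite -expr2 sqrf_eq1 => /orP[/eqP->//|/eqP e].
by have := cvf_abs_ge0 (-1 : L); rewrite e oppr_ge0 ler10.
Qed.

Definition base_lalg : lalg L := @LAlg R L L idfun.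

Lemma base_norm : @complete_norm R L base_lalg (@cvf_abs R L).
Proof.
split.
- by move=> x; split; [exact: cvf_abs_ge0 | exact: cvf_abs_eq0].
- by move=> x y; apply: le_trans (cvf_absD _ _) _; rewrite cvf_absN.
- by rewrite cvf_abs1; split=> // x y; rewrite cvf_absM.
- by move=> c x; rewrite -cvf_absM.
- exact: cvf_complete.
Qed.

Fixpoint tate (n : nat) : banach_alg :=
  if n is m.+1 then BanachAlg (gauss_complete_norm (ban_norm (tate m)))
  else BanachAlg base_norm.

Local Notation nuT n := (@ban_nu (tate n)).
Local Notation nT n := (ban_norm (tate n)).

Definition tC {n} : {rmorphism tate n -> tate n.+1} := tateC (nT n).
Definition tX n : tate n.+1 := tateX (nT n).

Lemma tate_nontriv n : (1 : tate n) != 0.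
Proof.
elim: n => [|n IH]; first exact: oner_neq0.
apply: contraNneq IH => /(congr1 (fun f : tate1_of (nT n) => f 0%N)) h.
by apply/eqP; exact: h.
Qed.

Lemma tate_idom n (f g : tate n) : f * g = 0 -> f = 0 \/ g = 0.
Proof.
elim: n f g => [|n IH]; last exact: tate_domain.
by move=> f g /eqP; rewrite mulf_eq0 => /orP[]/eqP; [left|right].
Qed.

Lemma tate_attained n (f : tate n) : exists c : L, cvf_abs c = nuT n f.
Proof.
elim: n f => [|n IH] f; first by exists f.
have [k hk] := gauss_attained (f : tate1_of (nT n)).
by have [c hc] := IH ((f : tate1_of (nT n)) k); exists c; rewrite hc -hk.
Qed.

Lemma tC_str n c : tC (la_str (tate n) c) = la_str (tate n.+1) c.
Proof. by []. Qed.

Section Eval.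
Variables (A C : banach_alg) (phi : {rmorphism A -> C}) (y : C).
Hypothesis phi_le : forall a, ban_nu (phi a) <= ban_nu a.
Hypothesis y_le : ban_nu y <= 1.
Let HA := ban_norm A.
Let HC := ban_norm C.
Local Notation T1 := (tate1_of HA).

Let yX_le k : ban_nu (y ^+ k) <= 1.
Proof.
apply: le_trans (nuX_le HC _ _) _.
by rewrite exprn_ile1 // (nu_ge0 HC).
Qed.

Let term_le (f : T1) i : ban_nu (phi (f i) * y ^+ i) <= ban_nu (f i).
Proof.
apply: le_trans (nuM_le HC _ _) _.
apply: (@le_trans _ _ (ban_nu (f i) * 1)); last by rewrite mulr1.
by apply: ler_pM; rewrite ?(nu_ge0 HC).
Qed.

Let part (f : T1) n := \sum_(i < n) phi (f i) * y ^+ i.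

Let ev_ex (f : T1) : exists l, nu_lim (@ban_nu C) (part f) l.
Proof.
apply: (@nu_series _ _ _ _ HC (fun i => phi (f i) * y ^+ i)) => e /(tcoefP f) [N hN].
exists N => n /hN.
exact: le_lt_trans.
Qed.

Definition tate_ev (f : T1) : C := projT1 (cid (ev_ex f)).

Lemma tate_ev_lim (f : T1) :
  nu_lim (@ban_nu C) (fun n => \sum_(i < n) phi (f i) * y ^+ i) (tate_ev f).
Proof. exact: (projT2 (cid (ev_ex f))). Qed.

Lemma tate_ev_le (f : T1) : ban_nu (tate_ev f) <= gauss f.
Proof.
apply: (nu_lim_le HC (tate_ev_lim f)); exists 0%N => n _.
apply: (nu_sum_le HC); first exact: gauss_ge0.
by move=> i _; apply: le_trans (term_le _ _) (gauss_ge _ _).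
Qed.

Lemma tate_ev_zmod : zmod_morphism tate_ev.
Proof.
move=> f g; apply: (nu_lim_uniq HC (tate_ev_lim (f - g))).
apply: nu_lim_ext (nu_limB HC (tate_ev_lim f) (tate_ev_lim g)) => n.
by rewrite -sumrB; apply: eq_bigr => i _; rewrite tate_coefB rmorphB mulrBl.
Qed.
HB.instance Definition _ := GRing.isZmodMorphism.Build T1 C tate_ev tate_ev_zmod.

Lemma tate_evCM a (f : T1) : tate_ev (tateC HA a * f) = phi a * tate_ev f.
Proof.
apply: (nu_lim_uniq HC (tate_ev_lim _)).
apply: nu_lim_ext (nu_limMl HC (phi a) (tate_ev_lim f)) => n.
by rewrite mulr_sumr; apply: eq_bigr => i _; rewrite tateCM_coef rmorphM mulrA.
Qed.

Lemma tate_evXM (f : T1) : tate_ev (tateX HA * f) = y * tate_ev f.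
Proof.
apply: (nu_lim_uniq HC (tate_ev_lim _)); apply: (@nu_lim_shift _ _ _ _ _ _ 1%N).
apply: nu_lim_ext (nu_limMl HC y (tate_ev_lim f)) => n.
rewrite addn1 big_ord_recl tateXM_coef rmorph0 mul0r add0r mulr_sumr.
by apply: eq_bigr => i _; rewrite tateXM_coef /= exprS mulrCA.
Qed.

Lemma tate_ev1 : tate_ev 1 = 1.
Proof.
apply: (nu_lim_uniq HC (tate_ev_lim _)); apply: (@nu_lim_shift _ _ _ _ _ _ 1%N).
apply: nu_lim_ext (nu_lim_cst HC 1) => n.
rewrite addn1 big_ord_recl tate_coef1 rmorph1 expr0 mulr1.
by rewrite big1 ?addr0 // => i _; rewrite tate_coef1 rmorph0 mul0r.
Qed.

Lemma tate_evXnM k (f : T1) : tate_ev (tateX HA ^+ k * f) = y ^+ k * tate_ev f.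
Proof.
elim: k => [|k IH]; first by rewrite !expr0 !mul1r.
by rewrite !exprS -!mulrA tate_evXM IH.
Qed.

(** The defect [d] of multiplicativity is additive in the first factor, bounded by a multiple of its
    Gauss norm, and zero on truncations. These approximate every series, so [d] vanishes. *)
Lemma tate_ev_monoid : monoid_morphism tate_ev.
Proof.
split=> [|f g]; first exact: tate_ev1.
pose d (h : T1) : C := tate_ev (h * g) - tate_ev h * tate_ev g.
have dB h h' : d (h - h') = d h - d h'.
  by rewrite /d mulrBl !raddfB /= mulrBl; ring.
have dle h : ban_nu (d h) <= gauss h * gauss g.
  apply: (nuB_le HC).
    by apply: le_trans (tate_ev_le _) _; apply: (nuM_le (gauss_complete_norm HA)).
  apply: le_trans (nuM_le HC _ _) _.
  by apply: ler_pM; rewrite ?(nu_ge0 HC) ?tate_ev_le.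
have d0 n : d (\sum_(i < n) tateC HA (f i) * tateX HA ^+ i) = 0.
  rewrite /d mulr_suml !raddf_sum /= mulr_suml -sumrB big1 // => i _.
  rewrite -mulrA tate_evCM tate_evXnM tate_evCM.
  by rewrite -[tateX HA ^+ i]mulr1 tate_evXnM tate_ev1 mulr1 mulrA subrr.
suff : d f = 0 by move/eqP; rewrite subr_eq0 => /eqP.
apply/(nu_eq0 HC)/eqP; rewrite eq_le (nu_ge0 HC) andbT.
apply/ler_addgt0Pl => e e0; rewrite addr0.
have g1 : 0 < gauss g + 1 by rewrite ltr_wpDl // gauss_ge0.
have [N hN] := tate_trunc_lim f (divr_gt0 e0 g1).
have := hN N (leqnn _); rewrite (nu_distC (gauss_complete_norm HA)) => h.
have := dle (f - \sum_(i < N) tateC HA (f i) * tateX HA ^+ i).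
rewrite dB d0 subr0 => /le_trans; apply.
apply: (@le_trans _ _ (e / (gauss g + 1) * (gauss g + 1))).
  by apply: ler_pM; rewrite ?gauss_ge0 ?lerDl //; apply: ltW.
by rewrite divfK // gt_eqF.
Qed.
HB.instance Definition _ := GRing.isMonoidMorphism.Build T1 C tate_ev tate_ev_monoid.

Lemma tate_evC a : tate_ev (tateC HA a) = phi a.
Proof. by rewrite -[tateC HA a]mulr1 tate_evCM tate_ev1 mulr1. Qed.

Lemma tate_evX : tate_ev (tateX HA) = y.
Proof. by rewrite -[tateX HA]mulr1 tate_evXM tate_ev1 mulr1. Qed.

End Eval.

(** Index 0 is the outermost variable; the variables of [tate n] reappear in [tate n.+1] with their
    index shifted by one. *)
Fixpoint xvar (n i : nat) : tate n :=
  match n with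
  | 0 => 0
  | m.+1 => if i is j.+1 then tC (xvar m j) else tX m
  end.

Lemma nu_tC n (b : tate n) : nuT n.+1 (tC b) = nuT n b.
Proof. exact: gaussC. Qed.

Lemma nu_tX n : nuT n.+1 (tX n) <= 1.
Proof. exact: (gaussXn (nT n) 1). Qed.

Lemma nu_str n c : nuT n (la_str (tate n) c) = cvf_abs c.
Proof. by elim: n => // n IH; rewrite -tC_str nu_tC. Qed.

Lemma xvar_le n i : nuT n (xvar n i) <= 1.
Proof.
elim: n i => [|n IH] [|i]; rewrite ?(nu0 (nT 0)) ?ler01 //=.
- exact: nu_tX.
- by apply: le_trans (IH i); rewrite -nu_tC.
Qed.

Lemma tate_hom (C : banach_alg) n (y : nat -> C) :
  (forall i, ban_nu (y i) <= 1) ->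
  exists chi : {rmorphism tate n -> C},
    [/\ is_lhom chi, forall f, ban_nu (chi f) <= ban_nu f
      & forall i, (i < n)%N -> chi (xvar n i) = y i].
Proof.
elim: n y => [|n IH] y hy.
  exists (la_str C); split=> // f.
  by rewrite -[la_str C f]mulr1 (nuZ (ban_norm C)) -[leRHS]mulr1 ler_wpM2l ?cvf_abs_ge0 // (nu1_le (ban_norm C)).
have [chi [chiL chi_le chiX]] := IH (fun i => y i.+1) (fun i => hy i.+1).
exists (tate_ev chi_le (hy 0%N)); split.
- by move=> c; rewrite -tC_str -chiL; apply: tate_evC.
- exact: tate_ev_le.
- move=> [|i] hi; first exact: tate_evX.
  by rewrite -(chiX i hi); apply: tate_evC.
Qed.

Definition mono n (a : seq nat) : tate n := \prod_(i < n) xvar n i ^+ nth 0%N a i.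

Lemma monoS n k a : mono n.+1 (k :: a) = tX n ^+ k * tC (mono n a).
Proof.
rewrite /mono big_ord_recl /= rmorph_prod; congr (_ * _).
by apply: eq_bigr => i _; rewrite rmorphXn.
Qed.

Lemma mono_le n a : nuT n (mono n a) <= 1.
Proof.
rewrite /mono; elim/big_ind: _ => [|x z hx hz|i _]; first exact: (nu1_le (nT n)).
  apply: le_trans (nuM_le (nT n) _ _) _.
  by rewrite mulr_ile1 ?(nu_ge0 (nT n)).
apply: le_trans (nuX_le (nT n) _ _) _.
by rewrite exprn_ile1 ?(nu_ge0 (nT n)) ?xvar_le.
Qed.

(** Truncate in the outermost variable, then approximate each coefficient. Distinct exponents and
    coefficients bounded by the norm of [f] are recorded because normalization compares the
    monomials one by one. *)
Lemma mono_approx n (f : tate n) (e : R) : 0 < e ->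
  exists s : seq (L * seq nat),
    [/\ uniq [seq x.2 | x <- s],
        forall x, x \in s -> size x.2 = n /\ cvf_abs x.1 <= nuT n f
      & nuT n (f - \sum_(x <- s) la_str (tate n) x.1 * mono n x.2) <= e].
Proof.
elim: n f e => [|n IH] f e e0.
  exists [:: (f : L, [::])]; split=> //.
    by move=> x; rewrite inE => /eqP ->.
  rewrite big_seq1 /mono big_ord0 mulr1 subrr (nu0 (nT 0)); exact: ltW.
pose g : tate1_of (nT n) := f.
have [N hN] := tate_trunc_lim g e0; have {hN} hN := hN N (leqnn _).
pose S K : tate n.+1 := \sum_(i < K) tC (g i) * tX n ^+ i.
suff [s [h1 h2 h3]] : exists s : seq (L * seq nat),
    [/\ uniq [seq x.2 | x <- s],
        forall x, x \in s -> [/\ size x.2 = n.+1, cvf_abs x.1 <= nuT n.+1 f & (head 0%N x.2 < N)%N]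
      & nuT n.+1 (S N - \sum_(x <- s) la_str (tate n.+1) x.1 * mono n.+1 x.2) <= e].
  exists s; split=> //; first by move=> x /h2 [].
  rewrite -(subrKA (S N)); apply: (nuD_le (nT n.+1)) => //.
  by rewrite (nu_distC (nT n.+1)); apply: ltW.
elim: N {hN} => [|N [s [h1 h2 h3]]].
  exists [::]; split=> //; rewrite big_nil /S big_ord0 subrr (nu0 (nT n.+1)).
  exact: ltW.
have [t [t1 t2 t3]] := IH (g N) e e0.
exists (s ++ [seq (x.1, N :: x.2) | x <- t]); split.
- rewrite map_cat cat_uniq h1 -map_comp /=; apply/andP; split.
    apply/hasPn => _ /mapP[x xt ->] /=; apply/negP => /mapP[z /h2 [_ _ hz]] e1.
    by rewrite -e1 /= ltnn in hz.
  rewrite (eq_map (g := cons N \o snd)) // map_comp map_inj_uniq //.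
  by move=> ? ? [].
- move=> x; rewrite mem_cat => /orP[/h2 [-> -> h]|/mapP[z /t2 [hz hz2] ->]] /=.
    by split=> //; apply: leqW.
  split=> //; first by rewrite hz.
  by apply: le_trans hz2 _; apply: (gauss_ge g).
- rewrite big_cat /= big_map /= /S big_ord_recr /= opprD addrACA.
  apply: (nuD_le (nT n.+1)) => //.
  have -> : \sum_(x <- t) la_str (tate n.+1) x.1 * mono n.+1 (N :: x.2)
      = tC (\sum_(x <- t) la_str (tate n) x.1 * mono n x.2) * tX n ^+ N.
    rewrite rmorph_sum mulr_suml; apply: eq_bigr => x _.
    by rewrite monoS rmorphM tC_str /= mulrCA mulrC.
  rewrite -mulrBl -rmorphB; apply: le_trans (nuM_le (nT n.+1) _ _) _.
  rewrite [X in X * _]nu_tC -[leRHS]mulr1; apply: ler_pM => //.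
  - exact: nu_ge0 (nT n) _.
  - exact: nu_ge0 (nT n.+1) _.
  - exact: (gaussXn (nT n)).
Qed.

End Iterated.
Arguments tC {R L n}.
Arguments tate {R} L n%_N : simpl never.

(** * Normalization *)

Lemma uniq_map_in_inj (I J : eqType) (f : I -> J) (s : seq I) :
  uniq (map f s) -> {in s &, injective f}.
Proof.
elim: s => // a s IH /= /andP[fa us] x z; rewrite !inE.
move=> /orP[/eqP ->|xs] /orP[/eqP ->|zs] // e; last exact: IH.
  by case/negP: fa; rewrite e map_f.
by case/negP: fa; rewrite -e map_f.
Qed.

Section Normalization.
Variables (R : realType) (L : complete_valued_field R) (n : nat).
Local Notation A := (tate L n).
Local Notation T := (tate L n.+1).
Local Notation nuA := (@ban_nu _ _ A).
Local Notation nuT := (@ban_nu _ _ T).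
Local Notation t := (tX L n).
Let HA := ban_norm A.
Let HT := ban_norm T.

Section Chi.
Variables (chi : {rmorphism A -> T}).
Hypotheses (chiL : is_lhom chi) (chi_le : forall a, nuT (chi a) <= nuA a).

(** Degree in [t] is measured over the unit ball of the subring [chi A], not over the constants
    [tC]; [chi] will be the substitution of Noether normalization. *)
Definition subdeg s (f : T) := exists c : nat -> A,
  (forall i, nuA (c i) <= 1) /\ f = \sum_(i < s) chi (c i) * t ^+ i.

Lemma subdeg_le s m f : (s <= m)%N -> subdeg s f -> subdeg m f.
Proof.
move=> sm [c [c1 ->]]; exists (fun i => if (i < s)%N then c i else 0); split.
  by move=> i; case: ifP => // _; rewrite (nu0 HA).
rewrite (big_ord_widen m (fun i => chi (c i) * t ^+ i)) // big_mkcond.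
by apply: eq_bigr => i _; case: ifP => // _; rewrite rmorph0 mul0r.
Qed.

Lemma subdegD s f g : subdeg s f -> subdeg s g -> subdeg s (f + g).
Proof.
move=> [c [c1 ->]] [d [d1 ->]]; exists (fun i => c i + d i); split.
  by move=> i; apply: (nuD_le HA).
by rewrite -big_split; apply: eq_bigr => i _; rewrite rmorphD mulrDl.
Qed.

Lemma subdeg0 s : subdeg s 0.
Proof.
exists (fun=> 0); split=> [i|]; first by rewrite (nu0 HA).
by rewrite big1 // => i _; rewrite rmorph0 mul0r.
Qed.

Lemma subdeg_sum (I : Type) (r : seq I) (P : pred I) (F : I -> T) s :
  (forall i, P i -> subdeg s (F i)) -> subdeg s (\sum_(i <- r | P i) F i).
Proof.
by move=> h; elim/big_ind: _ => //; [exact: subdeg0 | exact: subdegD].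
Qed.

Lemma subdeg1 c i s : nuA c <= 1 -> (i < s)%N -> subdeg s (chi c * t ^+ i).
Proof.
move=> c1 si; exists (fun j => if j == i then c else 0); split=> [j|].
  by case: ifP => // _; rewrite (nu0 HA).
rewrite (bigD1 (Ordinal si)) //= eqxx big1 ?addr0 // => j /negPf h.
by rewrite (_ : (nat_of_ord j == i) = false) ?rmorph0 ?mul0r.
Qed.

Lemma subdegM s m f g : subdeg s f -> subdeg m g -> subdeg (s + m) (f * g).
Proof.
move=> [c [c1 ->]] [d [d1 ->]]; rewrite mulr_suml; apply: subdeg_sum => i _.
rewrite mulr_sumr; apply: subdeg_sum => j _.
rewrite mulrACA -exprD -rmorphM; apply: subdeg1.
  apply: le_trans (nuM_le HA _ _) _.
  by rewrite mulr_ile1 ?(nu_ge0 HA).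
have := ltn_ord i; have := ltn_ord j; lia.
Qed.

Lemma subdegZ s c f : nuA c <= 1 -> subdeg s f -> subdeg s (chi c * f).
Proof.
move=> c1 [d [d1 ->]]; rewrite mulr_sumr; apply: subdeg_sum => i _.
rewrite mulrA -rmorphM; apply: subdeg1 => //.
apply: le_trans (nuM_le HA _ _) _.
by rewrite mulr_ile1 ?(nu_ge0 HA).
Qed.

Lemma subdegXM s k f : subdeg s f -> subdeg (s + k) (t ^+ k * f).
Proof.
move=> [d [d1 ->]]; rewrite mulr_sumr; apply: subdeg_sum => i _.
rewrite mulrCA -exprD; apply: subdeg1 => //.
have := ltn_ord i; lia.
Qed.

Lemma subdegN s f : subdeg s f -> subdeg s (- f).
Proof.
move=> h; rewrite -mulN1r -(rmorph1 chi) -rmorphN; apply: subdegZ => //.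
by rewrite (nuN HA) (nu1_le HA).
Qed.

(** Monic of degree [s] in this sense, up to a scalar of absolute value 1. *)
Definition lead s (f : T) := exists2 u : L, cvf_abs u = 1 &
  subdeg s (f - la_str T u * t ^+ s).

Lemma la_str_chi u : la_str T u = chi (la_str A u).
Proof. by rewrite chiL. Qed.

Lemma lead_subdeg s m f : (s < m)%N -> lead s f -> subdeg m f.
Proof.
move=> sm [u u1 h]; rewrite -(subrK (la_str T u * t ^+ s) f).
apply: subdegD; first by apply: subdeg_le h; apply: ltnW.
by rewrite la_str_chi; apply: subdeg1; rewrite // nu_str u1.
Qed.

Lemma leadM s m f g : lead s f -> lead m g -> lead (s + m) (f * g).
Proof.
move=> [u u1 hf] [v v1 hg]; exists (u * v); first by rewrite cvf_absM u1 v1 mulr1.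
set p := f - _ in hf; set q := g - _ in hg.
have -> : f * g - la_str T (u * v) * t ^+ (s + m)
    = la_str T u * (t ^+ s * q) + la_str T v * (t ^+ m * p) + p * q.
  by rewrite /p /q rmorphM exprD; ring.
apply: subdegD; last exact: subdegM.
apply: subdegD; rewrite la_str_chi; apply: subdegZ; rewrite ?nu_str ?u1 ?v1 //.
  by rewrite addnC; apply: subdegXM.
exact: subdegXM.
Qed.

Lemma lead1 : lead 0 1.
Proof.
by exists 1; rewrite ?cvf_abs1 // rmorph1 expr0 mulr1 subrr; apply: subdeg0.
Qed.

Lemma leadX s k f : lead s f -> lead (k * s) (f ^+ k).
Proof.
move=> h; elim: k => [|k IH]; first exact: lead1.
by rewrite exprS mulSn; apply: leadM.
Qed.

Lemma leadt : lead 1 t.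
Proof.
by exists 1; rewrite ?cvf_abs1 // rmorph1 expr1 mul1r subrr; apply: subdeg0.
Qed.

Lemma lead_prod (I : Type) (r : seq I) (F : I -> T) (w : I -> nat) :
  (forall i, lead (w i) (F i)) -> lead (\sum_(i <- r) w i) (\prod_(i <- r) F i).
Proof.
move=> h; elim: r => [|i r IH]; first by rewrite !big_nil; apply: lead1.
by rewrite !big_cons; apply: leadM.
Qed.

Lemma leadZ s u f : cvf_abs u = 1 -> lead s f -> lead s (la_str T u * f).
Proof.
move=> u1 [v v1 h]; exists (u * v); first by rewrite cvf_absM u1 v1 mulr1.
by rewrite rmorphM -mulrA -mulrBr la_str_chi; apply: subdegZ; rewrite // nu_str u1.
Qed.

Lemma leadD s f g : lead s f -> subdeg s g -> lead s (f + g).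
Proof.
by move=> [u u1 h] hg; exists u; rewrite // addrAC; apply: subdegD.
Qed.

(** Distinct degrees prevent cancellation at the top: the term of largest degree stays leading. *)
Lemma lead_sum (I : eqType) (r : seq I) (F : I -> T) (w : I -> nat) :
  uniq (map w r) -> r != [::] -> (forall i, i \in r -> lead (w i) (F i)) ->
  exists s, lead s (\sum_(i <- r) F i).
Proof.
move=> ur r0 h; suff [s [_ _ hs]] : exists s, [/\ s \in map w r,
    forall i, i \in r -> (w i <= s)%N & lead s (\sum_(i <- r) F i)] by exists s.
elim: r ur r0 h => // i r IH /= /andP[ir ur] _ h.
have [r0|r0] := eqVneq r [::].
  exists (w i); rewrite r0 big_seq1; split; rewrite ?mem_head //.
    by move=> j; rewrite inE => /eqP ->.
  by apply: h; rewrite mem_head.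
have [|s [sr sle sl]] := IH ur r0; first by move=> j jr; apply: h; rewrite inE jr orbT.
have hi := h i (mem_head _ _); rewrite big_cons.
case: (ltngtP (w i) s) => [lt|gt|e].
- exists s; split; first by rewrite inE sr orbT.
    by move=> j; rewrite inE => /orP[/eqP ->|/sle //]; apply: ltnW.
  by rewrite addrC; apply: leadD => //; apply: lead_subdeg hi.
- exists (w i); split; first by rewrite inE eqxx.
    by move=> j; rewrite inE => /orP[/eqP ->//|/sle /leq_trans]; apply; apply: ltnW.
  by apply: leadD => //; apply: lead_subdeg sl.
- by rewrite e sr in ir.
Qed.

Variables (N : nat) (N1 : (0 < N)%N).
Hypothesis chiX : forall i, (i < n)%N -> chi (xvar L n i) = tC (xvar L n i) + t ^+ (N ^ i.+1).

(** The exponents read as digits in base [N]: this is the degree in [t] that the substitution gives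
    to a monomial. *)
Definition weight (a : seq nat) := (\sum_(i < n.+1) nth 0 a i * N ^ i)%N.

(** The variable of index 0 is [t]. By [chiX] any other one is [chi x - t^(N^(i+1))] with [chi x]
    constant over [chi A], so its leading scalar is -1. *)
Lemma lead_xvar i : (i < n.+1)%N -> lead (N ^ i) (xvar L n.+1 i).
Proof.
case: i => [|i] hi; first exact: leadt.
have hi' : (i < n)%N by [].
have -> : xvar L n.+1 i.+1 = chi (xvar L n i) - t ^+ (N ^ i.+1).
  by rewrite chiX // addrK.
exists (-1); first by rewrite cvf_absN cvf_abs1.
rewrite rmorphN1 mulN1r opprK subrK -[chi _]mulr1 -(expr0 t).
by apply: subdeg1; rewrite ?xvar_le // expn_gt0 N1.
Qed.

Lemma lead_mono a : lead (weight a) (mono L n.+1 a).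
Proof.
rewrite /weight /mono; apply: lead_prod => i.
by apply: leadX; apply: lead_xvar.
Qed.

Variables (g : T) (e : R) (s : nat).
Hypothesis e0 : 0 < e.

(** Division by [g] with remainder, up to an error of norm [e]. Assumed for the single element
    [t^s], it spreads to all monomials by stability under sums and under multiplication by [t] and
    by the unit ball of [chi A]. *)
Definition divisible_mod (f : T) := exists p h r,
  [/\ subdeg s p, nuT h <= 1, nuT r <= e & f = p + h * g + r].

Hypothesis ts : divisible_mod (t ^+ s).

Lemma divmodD f1 f2 : divisible_mod f1 -> divisible_mod f2 -> divisible_mod (f1 + f2).
Proof.
move=> [p [h [r [hp hh hr ->]]]] [p' [h' [r' [hp' hh' hr' ->]]]].
exists (p + p'), (h + h'), (r + r'); split; first exact: subdegD.
- exact: (nuD_le HT).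
- exact: (nuD_le HT).
- ring.
Qed.

Lemma divmod_subdeg p : subdeg s p -> divisible_mod p.
Proof.
move=> hp; exists p, 0, 0; rewrite !(nu0 HT) ler01 (ltW e0) mul0r !addr0.
by split.
Qed.

Lemma divmod_sum (I : Type) (r : seq I) (P : pred I) (F : I -> T) :
  (forall i, P i -> divisible_mod (F i)) -> divisible_mod (\sum_(i <- r | P i) F i).
Proof.
move=> h; elim/big_ind: _ => //; last exact: divmodD.
by apply: divmod_subdeg; apply: subdeg0.
Qed.

Lemma divmodM b f : nuT b <= 1 -> (forall p, subdeg s p -> divisible_mod (b * p)) ->
  divisible_mod f -> divisible_mod (b * f).
Proof.
move=> b1 hb [p [h [r [hp hh hr ->]]]].
have -> : b * (p + h * g + r) = b * p + ((b * h) * g + b * r) by ring.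
apply: divmodD; first exact: hb.
have le c x y : nuT x <= y -> nuT c <= 1 -> nuT (c * x) <= y.
  move=> hx hc; apply: le_trans (nuM_le HT _ _) _; apply: le_trans hx.
  by rewrite -[leRHS]mul1r ler_wpM2r ?(nu_ge0 HT).
exists 0, (b * h), (b * r); split; rewrite ?add0r ?le //.
exact: subdeg0.
Qed.

Lemma divmodZ c f : nuA c <= 1 -> divisible_mod f -> divisible_mod (chi c * f).
Proof.
move=> c1; apply: divmodM; first exact: le_trans (chi_le c) c1.
by move=> p hp; apply/divmod_subdeg/subdegZ.
Qed.

Lemma divmodt f : divisible_mod f -> divisible_mod (t * f).
Proof.
apply: divmodM; first exact: nu_tX.
move=> _ [c [c1 ->]]; rewrite mulr_sumr; apply: divmod_sum => i _.
(* Multiplication by [t] pushes only the top term of a remainder out of range, to [t^s], where [ts]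
   takes over. *)
rewrite mulrCA -exprS; have := ltn_ord i; rewrite leq_eqVlt => /orP[/eqP ->|h].
  exact: divmodZ.
by apply/divmod_subdeg/subdeg1.
Qed.

Lemma divmod_tX k f : divisible_mod f -> divisible_mod (t ^+ k * f).
Proof.
move=> h; elim: k => [|k IH]; first by rewrite expr0 mul1r.
by rewrite exprS -mulrA; apply: divmodt.
Qed.

Lemma divmodN f : divisible_mod f -> divisible_mod (- f).
Proof.
move=> h; rewrite -mulN1r -(rmorph1 chi) -rmorphN; apply: divmodZ => //.
by rewrite (nuN HA) (nu1_le HA).
Qed.

Lemma divmod_xvar i f : (i < n.+1)%N -> divisible_mod f ->
  divisible_mod (xvar L n.+1 i * f).
Proof.
case: i => [|i] hi h; first exact: divmodt.
have -> : xvar L n.+1 i.+1 = chi (xvar L n i) - t ^+ (N ^ i.+1).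
  by rewrite chiX // addrK.
rewrite mulrBl; apply: divmodD; first by apply: divmodZ; rewrite ?xvar_le.
exact/divmodN/divmod_tX.
Qed.

Lemma divmod1 : divisible_mod 1.
Proof.
have [s0|sp] := posnP s; first by rewrite -(expr0 t) -s0.
apply: divmod_subdeg; rewrite -[1]mulr1 -{2}(expr0 t) -(rmorph1 chi).
by apply: subdeg1; rewrite ?(nu1_le HA).
Qed.

Lemma divmod_mono a : divisible_mod (mono L n.+1 a).
Proof.
rewrite /mono; elim/big_rec: _ => [|i x _ hx]; first exact: divmod1.
elim: (nth _ _ _) => [|k IH]; first by rewrite expr0 mul1r.
by rewrite exprS -mulrA; apply: divmod_xvar.
Qed.

Lemma divmod_unit f : nuT f <= 1 -> divisible_mod f.
Proof.
move=> f1; have [m [_ hm hf]] := mono_approx f e0.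
set S := \sum_(x <- m) _ in hf; rewrite -(subrK S f) addrC.
have [p [h [r [hp hh hr eS]]]] : divisible_mod S.
  rewrite /S big_seq; apply: divmod_sum => x /hm [_ hx].
  rewrite la_str_chi; apply: divmodZ; last exact: divmod_mono.
  by rewrite nu_str; apply: le_trans f1.
exists p, h, (r + (f - S)); split=> //; first exact: (nuD_le HT).
by rewrite {1}eS !addrA.
Qed.

(** Scaling by an element of [L] with the absolute value of [f] reduces to the unit ball, so the
    error shrinks by [e] relative to [f]. *)
Lemma divmod_step (f : T) : exists p : (nat -> A) * T * T,
  [/\ forall i, nuA (p.1.1 i) <= nuT f, nuT p.1.2 <= nuT f, nuT p.2 <= e * nuT f
    & f = \sum_(i < s) chi (p.1.1 i) * t ^+ i + p.1.2 * g + p.2].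
Proof.
have [->|f0] := eqVneq f 0.
  exists ((fun=> 0), 0, 0); rewrite (nu0 HT) mulr0 /=; split; rewrite ?(nu0 HA) ?(nu0 HT) //.
  by rewrite mul0r !addr0 big1 // => i _; rewrite rmorph0 mul0r.
have [c hc] := tate_attained f.
have nf : 0 < nuT f.
  rewrite lt_neqAle (nu_ge0 HT) andbT eq_sym; apply: contraNneq f0.
  by move/(nu_eq0 HT) => ->.
have c0 : c != 0.
  by apply/eqP => c0; move: nf; rewrite -hc c0 cvf_abs0 ltxx.
have /divmod_unit[p [h [r [[a [a1 ->]] hh hr e1]]]] : nuT (la_str T c^-1 * f) <= 1.
  by rewrite (nuZ HT) cvf_absV hc mulVf // gt_eqF.
exists ((fun i => la_str A c * a i), la_str T c * h, la_str T c * r); split; cbn [fst snd].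
- by move=> i; rewrite (nuZ HA) hc -[leRHS]mulr1 ler_wpM2l // ltW.
- by rewrite (nuZ HT) hc -[leRHS]mulr1 ler_wpM2l // ltW.
- by rewrite (nuZ HT) hc mulrC ler_wpM2r // ltW.
- have -> : f = la_str T c * (la_str T c^-1 * f).
    by rewrite mulrA -rmorphM divff // rmorph1 mul1r.
  rewrite e1 !mulrDr mulrA; congr (_ + _ + _); rewrite mulr_sumr.
  by apply: eq_bigr => i _; rewrite rmorphM la_str_chi mulrA.
Qed.

Hypothesis e1 : e < 1.

(** Iterate the step: the errors decay like powers of [e], so remainders and quotients add up to
    convergent series. *)
Lemma division f : exists (c : nat -> A) (h : T),
  f = \sum_(i < s) chi (c i) * t ^+ i + h * g.
Proof.
have [st hst] := choice divmod_step.
pose F k := iter k (fun x => (st x).2) f.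
have Fle k : nuT (F k) <= e ^+ k * nuT f.
  elim: k => [|k IH]; first by rewrite expr0 mul1r.
  have [_ _ h _] := hst (F k); apply: le_trans h _.
  by rewrite exprS -mulrA ler_wpM2l // ltW.
have F0 (d : R) : 0 < d -> exists K, forall k, (K <= k)%N -> nuT (F k) < d.
  move=> d0; have e01 : 0 <= e < 1 by rewrite ltW.
  have [K hK] := geometric_small e01 (nu_ge0 HT f) d0.
  by exists K => k /hK; apply: le_lt_trans.
have /choice[c hc] i : exists c, nu_lim nuA (fun K => \sum_(k < K) (st (F k)).1.1 i) c.
  apply: (nu_series HA (u := fun k => (st (F k)).1.1 i)) => d /F0 [K hK].
  exists K => k /hK; apply: le_lt_trans; by have [h _ _ _] := hst (F k).
have [h hh] : exists h, nu_lim nuT (fun K => \sum_(k < K) (st (F k)).1.2) h.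
  apply: (nu_series HT (u := fun k => (st (F k)).1.2)) => d /F0 [K hK].
  exists K => k /hK; apply: le_lt_trans; by have [_ h _ _] := hst (F k).
exists c, h.
have eF K : f - F K = \sum_(i < s) chi (\sum_(k < K) (st (F k)).1.1 i) * t ^+ i
    + (\sum_(k < K) (st (F k)).1.2) * g.
  elim: K => [|K IH].
    rewrite subrr big_ord0 mul0r addr0 big1 // => i _.
    by rewrite big_ord0 rmorph0 mul0r.
  rewrite big_ord_recr /= mulrDl.
  have -> : \sum_(i < s) chi (\sum_(k < K.+1) (st (F k)).1.1 i) * t ^+ i
      = \sum_(i < s) chi (\sum_(k < K) (st (F k)).1.1 i) * t ^+ i
        + \sum_(i < s) chi ((st (F K)).1.1 i) * t ^+ i.
    rewrite -big_split; apply: eq_bigr => i _.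
    by rewrite big_ord_recr /= rmorphD mulrDl.
  rewrite addrACA -IH; have [_ _ _ {2}->] := hst (F K).
  rewrite -/(F K); ring.
apply: (nu_lim_uniq HT (u := fun K => f - F K)).
  have FL : nu_lim nuT F 0 by move=> d /F0 [K hK]; exists K => k; rewrite subr0; apply: hK.
  by have := nu_limB HT (nu_lim_cst HT f) FL; rewrite subr0.
apply: nu_lim_ext (fun K => esym (eF K)) _; apply: (nu_limD HT).
  apply: (nu_lim_sum HT) => i _.
  have : nu_lim nuT (fun K => chi (\sum_(k < K) (st (F k)).1.1 i)) (chi (c i)).
    move=> d /(hc i) [K hK]; exists K => k /hK; apply: le_lt_trans.
    by rewrite -rmorphB; apply: chi_le.
  move=> /(nu_limMl HT (t ^+ i)); rewrite mulrC; apply: nu_lim_ext => K.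
  by rewrite mulrC.
by move: (nu_limMl HT g hh); rewrite mulrC; apply: nu_lim_ext => K; rewrite mulrC.
Qed.

End Chi.

Lemma weight_inj N a b : size a = n.+1 -> size b = n.+1 ->
  (forall i, nth 0 a i < N)%N -> (forall i, nth 0 b i < N)%N ->
  weight N a = weight N b -> a = b.
Proof.
rewrite /weight; elim: n.+1 a b => [|m IH] a b.
  by move=> /size0nil -> /size0nil ->.
case: a => [//|x a] [sa]; case: b => [//|y b] [sb] ha hb.
have N0 : (0 < N)%N by apply: leq_ltn_trans (ha 0%N).
rewrite !big_ord_recl /= !expn0 !muln1.
have E c : (\sum_(i < m) nth 0 c i * N ^ i.+1 = N * \sum_(i < m) nth 0 c i * N ^ i)%N.
  by rewrite big_distrr /=; apply: eq_bigr => i _; rewrite expnS mulnCA.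
rewrite !E => e; have := congr1 (modn^~ N) e.
rewrite /= ![(_ + N * _)%N]addnC ![(N * _)%N]mulnC !modnMDl.
rewrite (modn_small (ha 0%N)) (modn_small (hb 0%N)) /= => xy.
rewrite xy; congr (_ :: _); apply: IH => //; first by move=> i; apply: (ha i.+1).
  by move=> i; apply: (hb i.+1).
by move/eqP: e; rewrite xy eqn_add2l eqn_pmul2l // => /eqP.
Qed.

(** Over [chi A] the monomials of [g] whose coefficients have absolute value 1 get distinct degrees
    in [t]. Hence [g] is monic of some degree [s], up to a unit scalar and an error of norm [e < 1],
    and Weierstrass division applies. *)
Lemma normalization (g : T) : g != 0 ->
  exists (chi : {rmorphism A -> T}) (s : nat), is_lhom chi /\
    forall f, exists (c : nat -> A) (h : T),
      f = \sum_(i < s) chi (c i) * t ^+ i + h * g.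
Proof.
move=> g0; wlog g1 : g g0 / nuT g = 1.
  move=> W; have [c hc] := tate_attained g.
  have ng : nuT g != 0.
    by apply: contraNneq g0 => /(nu_eq0 HT) ->.
  have c0 : c != 0 by apply: contraNneq ng => c0; rewrite -hc c0 cvf_abs0.
  have e1 : nuT (la_str T c^-1 * g) = 1 by rewrite (nuZ HT) cvf_absV hc mulVf.
  have [|chi [s [chiL hd]]] := W _ _ e1.
    apply/eqP => e0; move/eqP: e1; rewrite e0 (nu0 HT) eq_sym; exact/negP/oner_neq0.
  exists chi, s; split=> // f; have [a [h ->]] := hd f.
  by exists a, (h * la_str T c^-1); rewrite mulrA.
have [m [um hm happ]] := @mono_approx R L n.+1 g (1 / 2) ltac:(by rewrite divr_gt0).
pose m1 := [seq x <- m | cvf_abs x.1 == 1].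
(* It bounds the approximation error 1/2 and every coefficient not of absolute value 1; there are
   finitely many of these, so [e < 1]. *)
pose e := \big[Num.max/1 / 2]_(x <- m | cvf_abs x.1 != 1) cvf_abs x.1.
have e_lt1 : e < 1.
  rewrite /e big_seq_cond; elim/big_ind: _ => [|x y hx hy|x /andP[/hm [_ hx] nx]].
  - by rewrite ltr_pdivrMr // mul1r ltr1n.
  - by rewrite gt_max hx hy.
  - by rewrite lt_neqAle nx -g1.
have e_ge : 1 / 2 <= e by apply: bigmax_ge_id.
have e0 : 0 < e by apply: lt_le_trans e_ge; rewrite divr_gt0.
(* Larger than all exponents that occur, so that digits in base [N] separate them. *)
pose N := (\max_(x <- m) \max_(i < n.+1) nth 0 x.2 i).+1.
have N0 : (0 < N)%N by [].
have ltN x i : x \in m -> (nth 0 x.2 i < N)%N.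
  move=> xm; rewrite ltnS; have [hi|hi] := ltnP i n.+1; last first.
    by rewrite nth_default //; have [-> _] := hm x xm.
  apply: (@leq_trans (\max_(i < n.+1) nth 0 x.2 i)%N).
    exact: (@leq_bigmax _ (fun i : 'I_n.+1 => nth 0 x.2 i)%N (Ordinal hi)).
  exact: (@leq_bigmax_seq _ _ predT (fun x : L * seq nat => \max_(i < n.+1) nth 0 x.2 i)%N).
pose y i := tC (xvar L n i) + t ^+ (N ^ i.+1).
have y1 i : nuT (y i) <= 1.
  apply: (nuD_le HT); first by rewrite nu_tC xvar_le.
  exact: (gaussXn (ban_norm (tate L n))).
have [chi [chiL chi_le chiX]] := tate_hom n y1.
pose G := \sum_(x <- m1) la_str T x.1 * mono L n.+1 x.2.
have gG : nuT (g - G) <= e.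
  rewrite -(subrKA (\sum_(x <- m) la_str T x.1 * mono L n.+1 x.2)).
  apply: (nuD_le HT); first exact: le_trans e_ge.
  rewrite (bigID (fun x : L * seq nat => cvf_abs x.1 == 1)) /= /G /m1 big_filter.
  rewrite addrAC subrr add0r big_seq_cond.
  apply: (nu_sum_le HT) => [|x /andP[xm nx]]; first exact: ltW.
  rewrite (nuZ HT); apply: (@le_trans _ _ (cvf_abs x.1)).
    by rewrite -[leRHS]mulr1 ler_wpM2l ?cvf_abs_ge0 ?mono_le.
  by apply: (@le_bigmax_seq _ _ _ m (1 / 2) x (fun x => cvf_abs x.1 != 1) (fun x => cvf_abs x.1)).
have m1_neq : m1 != [::].
  apply/eqP => m10; move: gG; rewrite /G m10 big_nil subr0 g1.
  by apply/negP; rewrite -ltNge.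
have [s [u u1 hs]] : exists s, lead chi s G.
  apply: (lead_sum chiL (w := fun x : L * seq nat => weight N x.2)) => //.
    rewrite map_inj_in_uniq; first by rewrite filter_uniq // (map_uniq um).
    move=> x z; rewrite !mem_filter => /andP[_ xm] /andP[_ zm] exz.
    have exz2 : x.2 = z.2.
      apply: weight_inj exz; [| |by move=> i; apply: ltN|by move=> i; apply: ltN].
        by have [] := hm x xm.
      by have [] := hm z zm.
    exact: (uniq_map_in_inj um).
  move=> x; rewrite mem_filter => /andP[/eqP x1 _]; apply: leadZ => //.
  exact: lead_mono.
exists chi, s; split=> //.
apply: (division chiL chi_le chiX e0 _ e_lt1).
have u0 : u != 0 by apply/eqP => u0; move/eqP: u1; rewrite u0 cvf_abs0 eq_sym oner_eq0.
(* Solve [g = u t^s + (G - u t^s) + (g - G)] for [t^s]. *)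
exists (- (la_str T u^-1 * (G - la_str T u * t ^+ s))), (la_str T u^-1), (- (la_str T u^-1 * (g - G))).
split.
- rewrite -mulrN (la_str_chi chiL); apply: subdegZ.
    by rewrite nu_str cvf_absV u1 invr1.
  exact: subdegN.
- by rewrite nu_str cvf_absV u1 invr1.
- by rewrite (nuN HT) (nuZ HT) cvf_absV u1 invr1 mul1r.
- have := rmorphM (la_str T) u^-1 u; rewrite mulVf // rmorph1 => e2.
  rewrite !mulrBr mulrA -e2; ring.
Qed.

End Normalization.

(** * Submodules of finite codimension *)

Section Vectors.
Variables (R : realType) (L : complete_valued_field R) (B : lalg L) (I : Type).
Implicit Types (x y : I -> B) (N : set (I -> B)).

Definition vscale (b : B) x : I -> B := fun i => b * x i.

Definition is_submod N :=
  [/\ N (fun=> 0), forall x y, N x -> N y -> N (fun i => x i + y i)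
    & forall b x, N x -> N (vscale b x)].

Definition is_functional (l : (I -> B) -> L) :=
  (forall x y, l (fun i => x i + y i) = l x + l y) /\
  (forall c x, l (vscale (la_str B c) x) = c * l x).

(** The quotient is represented by the functionals that cut out [N], since continuity is proved for
    these. *)
Definition fin_codim N := exists (J : finType) (l : J -> (I -> B) -> L),
  (forall j, is_functional (l j)) /\ forall x, N x <-> forall j, l j x = 0.

Lemma submodB N x y : is_submod N -> N x -> N y -> N (fun i => x i - y i).
Proof.
move=> [_ ND NZ] nx ny; have := ND _ _ nx (NZ (-1) _ ny).
by congr N; apply/funext => i; rewrite /vscale mulN1r.
Qed.

Lemma submod_sum N (K : Type) (r : seq K) (P : pred K) (F : K -> I -> B) :
  is_submod N -> (forall k, P k -> N (F k)) ->
  N (fun i => \sum_(k <- r | P k) F k i).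
Proof.
move=> [N0 ND NZ] h; elim: r => [|k r IH].
  by rewrite (_ : (fun i => _) = fun=> 0) //; apply/funext => i; rewrite big_nil.
have [Pk|/negPf nPk] := boolP (P k); last first.
  by move: IH; congr N; apply/funext => i; rewrite big_cons nPk.
by have := ND _ _ (h k Pk) IH; congr N; apply/funext => i; rewrite big_cons Pk.
Qed.

Lemma functionalB l x y : is_functional l -> l (fun i => x i - y i) = l x - l y.
Proof.
move=> [lD lZ]; rewrite -mulN1r -lZ -lD; congr l; apply/funext => i.
by rewrite /vscale rmorphN1 mulN1r.
Qed.

Lemma functional_sum l (K : Type) (r : seq K) (F : K -> I -> B) :
  is_functional l -> l (fun i => \sum_(k <- r) F k i) = \sum_(k <- r) l (F k).
Proof.
move=> [lD lZ]; elim: r => [|k r IH].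
  rewrite big_nil -[RHS](mul0r (l (fun=> 0))) -lZ; congr l.
  by apply/funext => i; rewrite big_nil /vscale mulr0.
by rewrite big_cons -IH -lD; congr l; apply/funext => i; rewrite big_cons.
Qed.

Definition is_maximal_avoiding N b := [/\ is_submod N, ~ N b
  & forall N', is_submod N' -> N `<=` N' -> ~ N' b -> N' `<=` N].

Lemma exists_maximal_avoiding N b : is_submod N -> ~ N b ->
  exists2 N', N `<=` N' & is_maximal_avoiding N' b.
Proof.
move=> sN nb.
pose P (M : set (I -> B)) := M = set0 \/ [/\ is_submod M, N `<=` M & ~ M b].
have [F FP tot|A [PA Amax]] := @Zorn_bigcup _ P.
  have [allempty|/existsNP[M /not_implyP[FM Mn]]] := pselect (forall M, F M -> M = set0).
    left; apply/seteqP; split=> // x [M FM]; by rewrite (allempty M FM).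
  have [//|[sM NM Mb]] := FP _ FM.
  have FS M' x : F M' -> M' x -> [/\ is_submod M', N `<=` M' & ~ M' b].
    by move=> /FP [->|].
  right; split; first split.
  - by exists M => //; case: sM.
  - move=> x y [M1 F1 x1] [M2 F2 y2].
    have [/(_ _ x1) x2|/(_ _ y2) y1] := tot _ _ F1 F2.
      by exists M2 => //; have [[_ h _] _ _] := FS _ _ F2 y2; apply: h.
    by exists M1 => //; have [[_ h _] _ _] := FS _ _ F1 x1; apply: h.
  - move=> c x [M1 F1 x1]; exists M1 => //.
    by have [[_ _ h] _ _] := FS _ _ F1 x1; apply: h.
  - by move=> x /NM Mx; exists M.
  - by move=> [M1 F1 b1]; have [_ _] := FS _ _ F1 b1.
case: PA => [A0|[sA NA Ab]].
  exfalso; apply: (Amax N); last by right; split.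
  rewrite A0 properEneq; split=> //; apply/eqP => /esym N0.
  by case: sN; rewrite N0.
exists A => //; split=> // N' sN' AN' Nb'; apply: contrapT => nsub.
by apply: (Amax N'); [split | right; split=> //; apply: subset_trans AN'].
Qed.

(** Otherwise [N + B x] would be a larger submodule avoiding [b]. Thus [b] lies in every nonzero
    submodule of the quotient. *)
Lemma maximal_avoidingP N b x : is_maximal_avoiding N b -> ~ N x ->
  exists h, N (fun i => b i - h * x i).
Proof.
move=> [sN nb Nmax] nx; apply: contrapT => /forallNP hn.
pose N' y := exists h, N (fun i => y i - h * x i).
have [N0 ND NZ] := sN.
apply: nx; apply: (Nmax N') => //.
- split.
  + exists 0; rewrite (_ : (fun i => _) = fun=> 0) //.
    by apply/funext => i; rewrite mul0r subr0.
  + move=> y z [h hy] [k hz]; exists (h + k); have := ND _ _ hy hz.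
    by congr N; apply/funext => i; ring.
  + move=> c y [h hy]; exists (c * h); have := NZ c _ hy.
    by congr N; apply/funext => i; rewrite /vscale; ring.
- move=> y ny; exists 0; congr N: ny.
  by apply/funext => i; rewrite mul0r subr0.
- by move=> [h]; apply: hn.
- exists 1; rewrite (_ : (fun i => _) = fun=> 0) //.
  by apply/funext => i; rewrite mul1r subrr.
Qed.

End Vectors.

Definition unit_vec (R : realType) (L : complete_valued_field R) (B : lalg L)
  (I : eqType) (i j : I) : B := if j == i then 1 else 0.

Lemma unit_vecE (R : realType) (L : complete_valued_field R) (B : lalg L)
    (I : finType) (x : I -> B) :
  x = fun j => \sum_i vscale (x i) (unit_vec B i) j.
Proof.
apply/funext => j; rewrite (bigD1 j) //= /vscale /unit_vec eqxx mulr1 big1 ?addr0 //.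
by move=> i /negPf; rewrite eq_sym => ->; rewrite mulr0.
Qed.

(** * Finite codimension over Tate algebras, by induction on the number of variables *)

Section FinCodim.
Variables (R : realType) (L : complete_valued_field R).
Local Notation T n := (tate L n).

Lemma tX_neq0 n : tX L n != 0.
Proof.
apply/eqP => /(congr1 (fun f : tate1_of (ban_norm (T n)) => f 1%N)).
by move=> h; have /eqP := tate_nontriv L n; apply.
Qed.

Lemma tX_nonunit n (f : T n.+1) : tX L n * f <> 1.
Proof. exact: tateX_not_unit (tate_nontriv L n). Qed.

Lemma tate_prod_neq0 n (I : finType) (g : I -> T n) :
  (forall i, g i != 0) -> \prod_i g i != 0.
Proof.
move=> h; elim/big_rec: _ => [|i x _ hx]; first exact: tate_nontriv.
by apply/eqP => /tate_idom [] /eqP; apply/negP.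
Qed.

(* A nonzero scalar killing each basis vector modulo [N] yields one killing
   the whole quotient. *)
Lemma torsion_annihilator n (I : finType) (N : set (I -> T n)) :
  is_submod N -> (forall i, exists2 g, g != 0 & N (vscale g (unit_vec (T n) i))) ->
  exists2 g, g != 0 & forall x : I -> T n, N (vscale g x).
Proof.
move=> sN /(_ _)/cid2 h; pose g i := s2val (h i).
exists (\prod_i g i); first by apply: tate_prod_neq0 => i; apply: (s2valP (h i)).
move=> x; rewrite [x]unit_vecE.
have [N0 ND NZ] := sN.
have := @submod_sum _ _ _ _ N I (index_enum I) predT (fun i => vscale (x i * \prod_(j | j != i) g j) (vscale (g i) (unit_vec (T n) i))) sN.
have hN i : predT i -> N (vscale (x i * \prod_(j | j != i) g j) (vscale (g i) (unit_vec (T n) i))).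
  by move=> _; apply: NZ; apply: (s2valP' (h i)).
move=> /(_ hN); congr N; apply/funext => j; rewrite /vscale mulr_sumr.
by apply: eq_bigr => i _; rewrite [in RHS](bigD1 i) //=; ring.
Qed.

Section Step.
Variables (n s : nat) (I : finType) (chi : {rmorphism T n -> T n.+1}) (g : T n.+1).
Hypotheses (chiL : is_lhom chi)
  (chiP : forall f, exists (c : nat -> T n) (h : T n.+1),
    f = \sum_(i < s) chi (c i) * tX L n ^+ i + h * g).

(** By [chiP], this [chi]-semilinear map is onto modulo any [N] that contains all multiples of [g];
    it presents a quotient over T_(n+1) as a quotient over T_n. *)
Definition expand (c : I * 'I_s -> T n) : I -> T n.+1 :=
  fun i => \sum_(j < s) chi (c (i, j)) * tX L n ^+ j.

Lemma expandD c c' : expand (fun k => c k + c' k) = fun i => expand c i + expand c' i.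
Proof.
apply/funext => i; rewrite /expand -big_split; apply: eq_bigr => j _.
by rewrite rmorphD mulrDl.
Qed.

Lemma expandB c c' : expand (fun k => c k - c' k) = fun i => expand c i - expand c' i.
Proof.
apply/funext => i; rewrite /expand -sumrB; apply: eq_bigr => j _.
by rewrite rmorphB mulrBl.
Qed.

Lemma expandZ a c : expand (vscale a c) = vscale (chi a) (expand c).
Proof.
apply/funext => i; rewrite /expand /vscale mulr_sumr; apply: eq_bigr => j _.
by rewrite rmorphM mulrA.
Qed.

Lemma expand0 : expand (fun=> 0) = fun=> 0.
Proof. by apply/funext => i; apply: big1 => j _; rewrite rmorph0 mul0r. Qed.

Variable N : set (I -> T n.+1).
Hypotheses (sN : is_submod N) (Ng : forall x, N (vscale g x)).

Lemma expand_surj (x : I -> T n.+1) : exists c, N (fun i => x i - expand c i).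
Proof.
have /choice[c hc] i := chiP (x i).
have /choice[h hh] := hc.
exists (fun k : I * 'I_s => c k.1 (k.2 : nat)); have := Ng h; congr N; apply/funext => i.
by rewrite /vscale {1}(hh i) /expand addrC addKr mulrC.
Qed.

Lemma submod_expand : is_submod [set c | N (expand c)].
Proof.
have [N0 ND NZ] := sN; split=> /=.
- by rewrite expand0.
- by move=> c c' h h'; rewrite expandD; apply: ND.
- by move=> a c h; rewrite expandZ; apply: NZ.
Qed.

End Step.

(* The pull-back of [N] along T_n^(I x s) -> T_(n+1)^I / N is enlarged to a
   submodule of finite codimension avoiding b; the largest T_(n+1)-submodule
   inside its image is [N] again, by maximality. *)
Lemma maximal_avoiding_fin_codim n (I : finType) (N : set (I -> T n)) b :
  is_maximal_avoiding N b -> fin_codim N.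
Proof.
elim: n I N b => [|n IH] I N b mN; have [sN nb Nmax] := mN; have [N0 ND NZ] := sN.
  (* Without variables, [N] and [b] span everything, so [N] is a hyperplane and the coefficient [mu]
     of [b] is its functional. *)
  have ex (x : I -> T 0) : exists mu : L, N (fun i => x i - mu * b i).
    have [nx|nx] := pselect (N x).
      by exists 0; congr N: nx; apply/funext => i; rewrite mul0r subr0.
    have [c hc] := maximal_avoidingP mN nx.
    have c0 : (c : L) != 0.
      apply/eqP => c0; apply: nb; congr N: hc; apply/funext => i.
      by rewrite c0 mul0r subr0.
    exists (c : L)^-1; have := NZ (- (c : L)^-1) _ hc; congr N; apply/funext => i.
    rewrite /vscale mulrBr !mulNr opprK addrC; congr (_ - _).
    by rewrite mulrA mulVf // mul1r.
  have /choice[mu hmu] := ex.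
  have uniq x c : N (fun i => x i - c * b i) -> mu x = c.
    move=> hc; apply/eqP; rewrite -subr_eq0; apply: contraT => ne; exfalso; apply: nb.
    have := NZ (mu x - c)^-1 _ (submodB sN hc (hmu x)); congr N; apply/funext => i.
    rewrite /vscale (_ : x i - c * b i - (x i - mu x * b i) = (mu x - c) * b i :> T 0).
      by rewrite mulrA mulVf // mul1r.
    ring.
  exists unit, (fun=> mu); split.
    move=> _; split=> [x y|c x]; apply: uniq.
      have := ND _ _ (hmu x) (hmu y); congr N; apply/funext => i; ring.
    have := NZ c _ (hmu x); congr N; apply/funext => i; rewrite /vscale.
    by rewrite mulrBr mulrA.
  move=> x; split=> [nx _|/(_ tt) e].
    by apply: uniq; congr N: nx; apply/funext => i; rewrite mul0r subr0.
  by have := hmu x; rewrite e; congr N; apply/funext => i; rewrite mul0r subr0.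
(* [b] is torsion modulo [N]: it is killed by [t] or, by maximality, by [1 - t h], which is nonzero
   because [t] is not a unit. *)
have [h0 h0n h0b] : exists2 h, h != 0 & N (vscale h b).
  have [nt|nt] := pselect (N (vscale (tX L n) b)); first by exists (tX L n); rewrite ?tX_neq0.
  have [h hb] := maximal_avoidingP mN nt; exists (1 - tX L n * h).
    by rewrite subr_eq0 eq_sym; apply/eqP/tX_nonunit.
  by congr N: hb; apply/funext => i; rewrite /vscale; ring.
(* Torsion passes from [b] to a basis vector [x] outside [N]: [b] is congruent to [h x] with [h]
   nonzero, so [h0 h] kills [x]. *)
have [g g0 Ng] : exists2 g, g != 0 & forall x : I -> T n.+1, N (vscale g x).
  apply: torsion_annihilator => // i; set x := unit_vec _ i.
  have [nx|nx] := pselect (N x).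
    by exists 1; rewrite ?tate_nontriv //; apply: NZ.
  have [h hb] := maximal_avoidingP mN nx; exists (h0 * h).
    apply/eqP => /tate_idom [] e; first by rewrite e eqxx in h0n.
    by apply: nb; congr N: hb; apply/funext => j; rewrite e mul0r subr0.
  have := submodB sN h0b (NZ h0 _ hb); congr N; apply/funext => j.
  by rewrite /vscale; ring.
have [chi [s [chiL chiP]]] := normalization g0.
pose im := @expand n s I chi.
have imP := expand_surj chiP Ng.
have sN1 := submod_expand s chi sN.
have [b1 hb1] := imP b.
have nb1 : ~ [set c | N (im c)] b1.
  by move=> /= h; apply: nb; have := ND _ _ hb1 h; congr N; apply/funext => i; rewrite subrK.
have [N1 sub1 mN1] := exists_maximal_avoiding sN1 nb1.
have [J [l [lF lN]]] := IH _ _ _ mN1.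
have [sN1' nb1' _] := mN1; have [N10 N1D N1Z] := sN1'.
pose N2 x := exists2 y, N1 y & N (fun i => x i - im y i).
have N2_sub x : N x -> N2 x.
  by move=> nx; exists (fun=> 0) => //; rewrite /im expand0; congr N: nx; apply/funext => i; rewrite subr0.
have N2D x x' : N2 x -> N2 x' -> N2 (fun i => x i + x' i).
  move=> [y hy nx] [y' hy' nx']; exists (fun k => y k + y' k); first exact: N1D.
  have := ND _ _ nx nx'; congr N; apply/funext => i; rewrite /im expandD; ring.
have N2Z a x : N2 x -> N2 (vscale (chi a) x).
  move=> [y hy nx]; exists (vscale a y); first exact: N1Z.
  by have := NZ (chi a) _ nx; congr N; apply/funext => i; rewrite /im expandZ /vscale; ring.
have N2_sum m (F : nat -> I -> T n.+1) : (forall j, (j < m)%N -> N2 (F j)) ->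
    N2 (fun i => \sum_(j < m) F j i).
  elim: m => [|m IHm] hF.
    by rewrite (_ : (fun i => _) = fun=> 0); [exact: N2_sub | apply/funext => i; rewrite big_ord0].
  rewrite (_ : (fun i => _) = fun i => \sum_(j < m) F j i + F m i).
    by apply: N2D; [apply: IHm => j jm; apply: hF; apply: ltnW | apply: hF].
  by apply/funext => i; rewrite big_ord_recr.
pose N3 x := forall f, N2 (vscale f x).
(* Modulo [g], every scalar is a combination of the [t^j], [j < s], over [chi T_n]. Finitely many
   memberships in [N2] therefore decide [N3], which is where its finite codimension comes from. *)
have N3P x : (forall j : 'I_s, N2 (vscale (tX L n ^+ j) x)) -> N3 x.
  move=> hx f; have [c [h ->]] := chiP f.
  rewrite (_ : vscale _ x = fun i => \sum_(j < s) vscale (chi (c j)) (vscale (tX L n ^+ j) x) i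
     + vscale g (vscale h x) i).
    apply: N2D; last exact/N2_sub/Ng.
    apply: (N2_sum s (fun j => vscale (chi (c j)) (vscale (tX L n ^+ j) x))) => j js; apply: N2Z; exact: (hx (Ordinal js)).
  apply/funext => i; rewrite /vscale mulrDl mulr_suml; congr (_ + _); last by ring.
  by apply: eq_bigr => j _; rewrite mulrA.
have N3N : N3 `<=` N.
  apply: Nmax.
  - split.
    + by move=> f; apply: N2_sub; rewrite (_ : vscale _ _ = fun=> 0) //; apply/funext => i; rewrite /vscale mulr0.
    + by move=> x y hx hy f; have := N2D _ _ (hx f) (hy f); congr N2; apply/funext => i; rewrite /vscale; ring.
    + by move=> a x hx f; have := hx (f * a); congr N2; apply/funext => i; rewrite /vscale; ring.
  - by move=> x nx f; apply/N2_sub/NZ.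
  - move=> /(_ 1) [y hy hn]; apply: nb1'.
    have : N1 (fun k => (b1 k - y k) + y k).
      apply: N1D => //; apply: sub1 => /=; rewrite /im expandB.
      have := submodB sN hn hb1; congr N; apply/funext => i; rewrite /vscale mul1r.
      by rewrite /im; ring.
    by congr N1; apply/funext => k; rewrite subrK.
have /choice[y hy] := imP.
(* The functionals kill the pull-back of [N], so their values do not depend on the lift chosen by
   [y]. *)
have yP x c : N (fun i => x i - im c i) -> forall j, l j (y x) = l j c.
  move=> hc j; apply/eqP; rewrite -subr_eq0 -functionalB //; apply/eqP; move: j; apply/lN.
  apply: sub1 => /=; rewrite expandB; have := submodB sN hc (hy x); congr N.
  by apply/funext => i; rewrite /im; ring.
exists ('I_s * J)%type, (fun (k : 'I_s * J) x => l k.2 (y (vscale (tX L n ^+ (k.1 : nat)) x))); split.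
  move=> [k j] /=; have [lD lZ] := lF j; split=> [x x'|c x].
    rewrite -lD; apply: yP; rewrite /im expandD.
    have := ND _ _ (hy (vscale (tX L n ^+ k) x)) (hy (vscale (tX L n ^+ k) x')).
    by congr N; apply/funext => i; rewrite /vscale; ring.
  rewrite -lZ; apply: yP; rewrite /im expandZ chiL.
  have := NZ (la_str _ c) _ (hy (vscale (tX L n ^+ k) x)).
  by congr N; apply/funext => i; rewrite /vscale; ring.
move=> x; split=> [nx [k j] /=|h].
  rewrite (yP _ (fun=> 0)); first by move: j; apply/lN.
  rewrite /im expand0; have := NZ (tX L n ^+ k) _ nx; congr N; apply/funext => i.
  by rewrite subr0.
apply/N3N/N3P => j; exists (y (vscale (tX L n ^+ j) x)) => //.
by apply/lN => i; exact: (h (j, i)).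
Qed.

Definition fin_gen (B : lalg L) (I : Type) (N : set (I -> B)) :=
  exists (K : finType) (y : K -> I -> B), (forall k, N (y k)) /\
    forall x, N x -> exists c : K -> B, x = fun i => \sum_k vscale (c k) (y k) i.

(** A nonzero [g] kills the quotient; generators of the pull-back under [expand], together with the
    [g]-multiples of the basis, then generate [N]. Without variables this is the kernel of a
    matrix. *)
Lemma fin_codim_fin_gen n (I : finType) (N : set (I -> T n)) :
  is_submod N -> fin_codim N -> fin_gen N.
Proof.
elim: n I N => [|n IH] I N sN [J [l [lF lN]]].
  pose K : 'M[L]_(#|I|, #|J|) :=
    \matrix_(i, j) l (enum_val j) (unit_vec (T 0) (enum_val i)).
  pose row_of (x : I -> T 0) : 'rV[L]_#|I| := \row_i x (enum_val i).
  pose fun_of (u : 'rV[L]_#|I|) : I -> T 0 := fun i => u 0 (enum_rank i).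
  have funK x : fun_of (row_of x) = x.
    by apply/funext => i; rewrite /fun_of mxE enum_rankK.
  have KP u : N (fun_of u) <-> u *m K = 0.
    have E j : l j (fun_of u) = (u *m K) 0 (enum_rank j).
      rewrite [X in l j X]unit_vecE functional_sum // mxE.
      rewrite (reindex (fun k : 'I_#|I| => enum_val k)) /=; last by apply: onW_bij; apply: enum_val_bij.
      apply: eq_bigr => i _; rewrite mxE enum_rankK /fun_of enum_valK.
      by case: (lF j) => _; apply.
    split=> [/lN h|h]; last by apply/lN => j; rewrite E h mxE.
    by apply/rowP => j; rewrite [RHS]mxE -[j]enum_valK -E h.
  exists 'I_#|I|, (fun k => fun_of (row k (kermx K))); split.
    by move=> k; apply/KP; rewrite -row_mul mulmx_ker row0.
  move=> x; rewrite -{1}(funK x) => /KP/sub_kermxP/submxP[w hw].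
  exists (fun k => w 0 k); apply/funext => i; rewrite -{1}(funK x) hw /fun_of mxE.
  by apply: eq_bigr => k _; rewrite /vscale [in RHS]mxE.
have [N0 ND NZ] := sN.
have [g g0 Ng] : exists2 g, g != 0 & forall x : I -> T n.+1, N (vscale g x).
  apply: torsion_annihilator => // i; set x := unit_vec _ i.
  (* One more power of [t] than there are functionals: a linear relation among the rows is a nonzero
     polynomial in [t] that carries [x] into [N]. *)
  pose M : 'M[L]_(#|J|.+1, #|J|) := \matrix_(k, j) l (enum_val j) (vscale (tX L n ^+ k) x).
  have : kermx M != 0.
    rewrite -mxrank_eq0 mxrank_ker -lt0n subn_gt0 ltnS; exact: rank_leq_col.
  move/rowV0Pn => [v /sub_kermxP hv vn].
  exists (\sum_k la_str (T n.+1) (v 0 k) * tX L n ^+ k).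
    have [k vk] : exists k, v 0 k != 0.
      apply/existsP; apply: contraNT vn => /existsPn h; apply/eqP/rowP => k.
      by rewrite mxE; apply/eqP/negPn/h.
    apply: contraNneq vk => e; apply/eqP/cvf_abs_eq0.
    rewrite -(nu_str n); apply/(nu_eq0 (ban_norm (T n))).
    have := congr1 (fun f : tate1_of (ban_norm (T n)) => f k) e => /= <-.
    transitivity ((\sum_(i < #|J|.+1) tateC (ban_norm (T n)) (la_str (T n) (v 0 i)) * tateX (ban_norm (T n)) ^+ i) k); last by [].
    rewrite tate_coef_sum (bigD1 k) // tateCM_coef tateXn_coef eqxx mulr1.
    rewrite -[LHS]addr0; congr (_ + _); apply/esym/big1 => j /andP[_ jk].
    rewrite tateCM_coef tateXn_coef; case: eqP => [e'|_]; last by rewrite mulr0.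
    by case/eqP: jk; apply: val_inj.
  apply/lN => j; rewrite (_ : vscale _ x = fun i => \sum_k vscale (la_str (T n.+1) (v 0 k)) (vscale (tX L n ^+ k) x) i).
    rewrite functional_sum //; have := congr1 (fun u : 'rV__ => u 0 (enum_rank j)) hv.
    rewrite [RHS]mxE => e; rewrite -[RHS]e mxE; apply: eq_bigr => k _; rewrite mxE enum_rankK.
    by case: (lF j) => _; apply.
  by apply/funext => i'; rewrite /vscale mulr_suml; apply: eq_bigr => k _; rewrite mulrA.
have [chi [s [chiL chiP]]] := normalization g0.
have imP := expand_surj chiP Ng.
have sN1 := submod_expand s chi sN.
have [|m [y [yN yg]]] := IH _ _ sN1.
  exists J, (fun j c => l j (expand chi c)); split; last by move=> c; apply: lN.
  move=> j; have [lD lZ] := lF j; split=> [c c'|a c]; first by rewrite expandD.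
  by rewrite expandZ chiL.
exists (m + I)%type, (fun k => match k with
  | inl k => expand chi (y k) | inr i => vscale g (unit_vec (T n.+1) i) end).
split; first by move=> [k|k]; [exact: yN | exact: Ng].
move=> x nx; have /choice[c hc] i := chiP (x i); have /choice[h hh] := hc.
pose c' := fun k : I * 'I_s => c k.1 k.2.
have xE i : x i = expand chi c' i + h i * g by rewrite {1}(hh i).
have [|a ha] := yg c'.
  have := submodB sN nx (Ng h); congr N; apply/funext => i.
  by rewrite xE /vscale [g * _]mulrC addrK.
exists (fun k => match k with inl k => chi (a k) | inr i => h i end).
apply/funext => i; rewrite xE big_sumType /=; congr (_ + _).
  rewrite ha /expand /vscale.
  under [LHS]eq_bigr => j _ do rewrite rmorph_sum mulr_suml.
  rewrite exchange_big; apply: eq_bigr => k _; rewrite mulr_sumr.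
  by apply: eq_bigr => j _; rewrite rmorphM mulrA.
rewrite (bigD1 i) //= /vscale /unit_vec eqxx mulr1 -[LHS]addr0; congr (_ + _).
by rewrite big1 // => j /negPf; rewrite eq_sym => ->; rewrite !mulr0.
Qed.

End FinCodim.

(** * Affinoid algebras as quotients of Tate algebras *)

Section Presentation.
Variables (R : realType) (L : complete_valued_field R).
Local Notation T n := (tate L n).

Definition mtail n (m : {ffun 'I_n.+1 -> nat}) : {ffun 'I_n -> nat} :=
  [ffun i => m (lift ord0 i)].
Definition mcons (A : Type) n (x : A) (m : {ffun 'I_n -> A}) : {ffun 'I_n.+1 -> A} :=
  [ffun i => if unlift ord0 i is Some j then m j else x].

Lemma mcons0 (A : Type) n (x : A) (m : {ffun 'I_n -> A}) : mcons x m ord0 = x.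
Proof. by rewrite ffunE unlift_none. Qed.
Lemma mconsS (A : Type) n (x : A) (m : {ffun 'I_n -> A}) i : mcons x m (lift ord0 i) = m i.
Proof. by rewrite ffunE liftK. Qed.
Lemma mtail_cons n (x : nat) (m : {ffun 'I_n -> nat}) : mtail (mcons x m) = m.
Proof. by apply/ffunP => i; rewrite ffunE mconsS. Qed.
Lemma mcons_tail n (m : {ffun 'I_n.+1 -> nat}) : mcons (m ord0) (mtail m) = m.
Proof.
by apply/ffunP => i; rewrite ffunE; case: unliftP => [j ->|->]; rewrite ?ffunE.
Qed.

Lemma mideg_cons n (x : nat) (m : {ffun 'I_n -> nat}) : mideg (mcons x m) = (x + mideg m)%N.
Proof.
rewrite /mideg big_ord_recl mcons0; congr (_ + _)%N.
by apply: eq_bigr => i _; rewrite mconsS.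
Qed.

Lemma mideg_ge n (m : {ffun 'I_n -> nat}) i : (m i <= mideg m)%N.
Proof. by rewrite /mideg (bigD1 i) //= leq_addr. Qed.

(** The convolution sum taken one index at a time, as iterated Cauchy products produce it;
    [below_sumE] matches it with the single sum of [tate_mul]. *)
Fixpoint below_sum n : ({ffun 'I_n -> nat} -> L) -> {ffun 'I_n -> nat} -> L :=
  match n with
  | 0 => fun F m => F m
  | k.+1 => fun F m => \sum_(x < (m ord0).+1) below_sum (fun m' => F (mcons (nat_of_ord x) m')) (mtail m)
  end.

Lemma below_sumE n N (F : {ffun 'I_n -> nat} -> L) (m : {ffun 'I_n -> nat}) :
  (forall i, (m i <= N)%N) ->
  \sum_(k : {ffun 'I_n -> 'I_N.+1} | [forall i, (k i <= m i)%N]) F [ffun i => k i : nat]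
  = below_sum F m.
Proof.
elim: n F m => [|n IH] F m mN.
  rewrite (big_pred1 [ffun i => ord0]) => [|k].
    by congr F; apply/ffunP => -[].
  rewrite /= (_ : k == _); first by apply/forallP => -[].
  by apply/eqP/ffunP => -[].
rewrite /= (reindex (fun p : 'I_N.+1 * {ffun 'I_n -> 'I_N.+1} => mcons p.1 p.2)) /=; last first.
  exists (fun k : {ffun 'I_n.+1 -> 'I_N.+1} => (k ord0, [ffun i => k (lift ord0 i)])).
    by move=> [x k] _ /=; rewrite mcons0; congr (_, _); apply/ffunP => i; rewrite ffunE mconsS.
  move=> k _ /=; apply/ffunP => i; rewrite ffunE.
  by case: unliftP => [j ->|->]; rewrite ?ffunE.
transitivity (\sum_(x : 'I_N.+1 | (x <= m ord0)%N)
   \sum_(k : {ffun 'I_n -> 'I_N.+1} | [forall i, (k i <= mtail m i)%N])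
      F (mcons (x : nat) [ffun i => k i : nat])).
  rewrite pair_big; apply: eq_big => [[x k]|[x k] _] /=.
    apply/forallP/andP => [h|[h /forallP h'] i].
      split; first by have := h ord0; rewrite mcons0.
      by apply/forallP => i; have := h (lift ord0 i); rewrite mconsS ffunE.
    case: (unliftP ord0 i) => [j ->|->]; last by rewrite mcons0.
    by have := h' j; rewrite mconsS ffunE.
  congr F; apply/ffunP => i; rewrite !ffunE.
  by case: unliftP => [j _|_]; rewrite ?ffunE.
rewrite (big_ord_widen_cond N.+1 predT (fun x => below_sum (fun m' => F (mcons x m')) (mtail m))).
  apply: eq_big => [x|x _]; first by rewrite ltnS.
  by rewrite -IH // => i; rewrite ffunE.
by rewrite ltnS.
Qed.

Lemma eq_below_sum n (F G : {ffun 'I_n -> nat} -> L) m : F =1 G -> below_sum F m = below_sum G m.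
Proof. by move=> /funext ->. Qed.

Fixpoint fcoef n : T n -> {ffun 'I_n -> nat} -> L :=
  match n with
  | 0 => fun f _ => f
  | k.+1 => fun f m => fcoef ((f : tate1_of (ban_norm (T k))) (m ord0)) (mtail m)
  end.

Lemma fcoefD n (f g : T n) m : fcoef (f + g) m = fcoef f m + fcoef g m.
Proof. by elim: n f g m => // n IH f g m; rewrite /= -IH. Qed.

Lemma fcoef0 n m : fcoef (0 : T n) m = 0.
Proof. by elim: n m => // n IH m; rewrite /= IH. Qed.

Lemma fcoef_sum n (I : Type) (r : seq I) (F : I -> T n) m :
  fcoef (\sum_(i <- r) F i) m = \sum_(i <- r) fcoef (F i) m.
Proof.
by elim: r => [|i r IH]; rewrite ?big_nil ?fcoef0 // !big_cons fcoefD IH.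
Qed.

Lemma fcoef_str n c m : fcoef (la_str (T n) c) m = tate_const c m.
Proof.
elim: n m => [|n IH] m.
  by rewrite /tate_const (_ : m == _) //; apply/eqP/ffunP => -[].
rewrite -tC_str /=; case E : (m ord0) => [|k].
  rewrite IH /tate_const; congr (if _ then _ else _); apply/eqP/eqP => [h|->].
    by rewrite -(mcons_tail m) E h; apply/ffunP => i; rewrite !ffunE; case: unliftP => [j _|_]; rewrite ?ffunE.
  by apply/ffunP => i; rewrite !ffunE.
rewrite fcoef0 /tate_const; case: eqP => // h.
by move: E; rewrite h ffunE.
Qed.

Lemma fcoefM n (f g : T n) m : fcoef (f * g) m = tate_mul (fcoef f) (fcoef g) m.
Proof.
rewrite /tate_mul.
transitivity (below_sum (fun k : {ffun 'I_n -> nat} => fcoef f k * fcoef g [ffun i => (m i - k i)%N]) m).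
  elim: n f g m => [|n IH] f g m.
    rewrite /=; congr (_ * _).
  rewrite (_ : fcoef (f * g) m = \sum_(x < (m ord0).+1)
    fcoef ((f : tate1_of _) x * (g : tate1_of _) (m ord0 - x)%N) (mtail m)); last by rewrite -fcoef_sum.
  rewrite /=; apply: eq_bigr => x _.
  rewrite IH; apply: eq_below_sum => k; rewrite mcons0 mtail_cons; congr (_ * _).
  rewrite ffunE mcons0; congr (fcoef _ _); apply/ffunP => i.
  by rewrite !ffunE liftK.
rewrite -(@below_sumE _ (mideg m)); last by move=> i; apply: mideg_ge.
apply: eq_bigr => k _; congr (_ * fcoef g _); apply/ffunP => i.
by rewrite !ffunE.
Qed.

Lemma fcoef_le n (f : T n) m : cvf_abs (fcoef f m) <= ban_nu f.
Proof.
elim: n f m => [|n IH] f m //=; apply: le_trans (IH _ _) _.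
exact: (gauss_ge (f : tate1_of _)).
Qed.

Lemma nu_fcoef_le n (f : T n) e : 0 <= e ->
  (forall m, cvf_abs (fcoef f m) <= e) -> ban_nu f <= e.
Proof.
move=> e0; elim: n f => [|n IH] f h; first exact: (h [ffun=> 0%N]).
apply: (gauss_le (f := (f : tate1_of _))) => i; apply: IH => m.
by have := h (mcons i m); rewrite /= mcons0 mtail_cons.
Qed.

Lemma fcoef_series n (f : T n) : tate_series (fcoef f).
Proof.
move=> e e0; elim: n f => [|n IH] f.
  by exists 1%N => m; rewrite /mideg big_ord0.
have [N hN] := tcoefP (f : tate1_of _) e0.
have /choice[M hM] i := IH ((f : tate1_of _) i).
(* Either the outer exponent reaches [N], or the remaining degree reaches the bound of one of the
   finitely many inner series. *)
exists (N + \max_(i < N) M i)%N => m; rewrite -(mcons_tail m) mideg_cons => hm /=.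
rewrite mcons0 mtail_cons.
have [h|h] := leqP N (m ord0); first exact: le_lt_trans (fcoef_le _ _) (hN _ h).
apply: hM; have := leq_bigmax (F := fun i : 'I_N => M i) (Ordinal h); move: hm.
rewrite /=; lia.
Qed.

Lemma fcoef_surj n (F : {ffun 'I_n -> nat} -> L) : tate_series F ->
  exists f : T n, fcoef f = F.
Proof.
elim: n F => [|n IH] F hF.
  exists (F [ffun=> 0%N] : L); apply/funext => m /=.
  by congr F; apply/ffunP => -[].
have /choice[f hf] i : exists f : T n, fcoef f = fun m => F (mcons i m).
  apply: IH => e /hF [N hN]; exists N => m hm; apply: hN.
  by rewrite mideg_cons; apply: leq_trans hm _; apply: leq_addl.
have fP e : 0 < e -> exists N, forall i, (N <= i)%N -> ban_nu (f i) < e.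
  move=> e0; have e2 : 0 < e / 2 by rewrite divr_gt0.
  have [N hN] := hF _ e2; exists N => i iN.
  apply: (@le_lt_trans _ _ (e / 2)); last by rewrite ltr_pdivrMr // ltr_pMr // ltr1n.
  apply: nu_fcoef_le => [|m]; first exact: ltW.
  rewrite hf; apply/ltW/hN; rewrite mideg_cons.
  by apply: leq_trans iN _; apply: leq_addr.
exists (Tate1 (ban_norm (T n)) fP); apply/funext => m /=.
by rewrite hf mcons_tail.
Qed.

(** [p] acts on all coefficient families but respects the operations only on convergent ones;
    composition with [fcoef] turns it into a ring morphism. *)
Lemma affinoid_presentation (B : lalg L) : is_affinoid B ->
  exists (n : nat) (q : {rmorphism T n -> B}),
    is_lhom q /\ forall b, exists f, q f = b.
Proof.
move=> [n [p [p1 pD pM psurj]]]; exists n.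
pose q (f : T n) : B := p (fcoef f).
have qD f g : q (f + g) = q f + q g.
  rewrite /q -pD; try exact: fcoef_series.
  by congr p; apply/funext => m; rewrite fcoefD.
have q0 : q 0 = 0 by apply: (addIr (q 0)); rewrite -qD !add0r.
have qB : zmod_morphism q.
  by move=> f g; rewrite -[LHS](addrK (q g)) -qD subrK.
have qL c : q (la_str (T n) c) = la_str B c.
  by rewrite /q -p1; congr p; apply/funext => m; rewrite fcoef_str.
have qM : monoid_morphism q.
  split; first by rewrite -(rmorph1 (la_str (T n))) qL rmorph1.
  move=> f g; rewrite /q -pM; try exact: fcoef_series.
  by congr p; apply/funext => m; rewrite fcoefM.
pose qz := GRing.isZmodMorphism.Build _ _ q qB.
pose qm := GRing.isMonoidMorphism.Build _ _ q qM.
pose qr : {rmorphism T n -> B} := HB.pack q qz qm.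
exists qr; split; first exact: qL.
by move=> b; have [F /fcoef_surj[f <-] <-] := psurj b; exists f.
Qed.

End Presentation.

(** * Baire category and the open mapping theorem *)

Section OpenMapping.
Variables (R : realType) (L : complete_valued_field R) (w : L).
Hypotheses (w0 : 0 < cvf_abs w) (w1 : cvf_abs w < 1).
Variables (B : lalg L) (nu : B -> R) (H : complete_norm nu).

Let wn0 : w != 0.
Proof. by apply/eqP => e; move: w0; rewrite e cvf_abs0 ltxx. Qed.

Let wKV k x : la_str B (w ^+ k) * (la_str B (w ^+ k)^-1 * x) = x.
Proof. by rewrite mulrA -rmorphM mulfV ?expf_neq0 // rmorph1 mul1r. Qed.

Variable D : set B.
Hypothesis DB : forall x y, D x -> D y -> D (x - y).
Hypothesis D_exhaust : forall x, exists k, D (la_str B (w ^+ k) * x).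
Hypothesis D_series : forall (d : nat -> B) l, (forall k, D (d k)) ->
  nu_lim nu (fun K => \sum_(k < K) la_str B (w ^+ k) * d k) l -> D l.

Let adh k (x : B) := forall e : R, 0 < e -> exists2 y, D (la_str B (w ^+ k) * y) & nu (x - y) < e.

(** [D] abstracts the image of a unit ball. If no [w^-k D] were dense in a ball around 0, one could
    nest balls, the k-th step avoiding [w^-k D]; they shrink to a point in none of these sets,
    against [D_exhaust]. *)
Lemma baire_ball : exists k d, 0 < d /\ forall x, nu x <= d -> adh k x.
Proof.
apply: contrapT => hno.
have no k d : 0 < d -> exists2 x, nu x <= d & ~ adh k x.
  move=> d0; apply: contrapT => h; apply: hno; exists k, d; split=> // x xd.
  by apply: contrapT => nx; apply: h; exists x.
have adhB k x y : adh k x -> adh k y -> adh k (x - y).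
  move=> hx hy e e0; have [x' Dx nx] := hx e e0; have [y' Dy ny] := hy e e0.
  exists (x' - y'); first by rewrite mulrBr; apply: DB.
  rewrite (_ : x - y - (x' - y') = (x - x') - (y - y')); last by ring.
  exact: (nuB_lt H).
have step k (s : B * R) : 0 < s.2 -> exists t : B * R,
    [/\ nu (t.1 - s.1) <= s.2, 0 < t.2, t.2 <= s.2 / 2
      & forall y, nu (y - t.1) <= t.2 -> ~ D (la_str B (w ^+ k) * y)].
  move=> s0; have [x xs nx] : exists2 x, nu x <= s.2 & ~ adh k (s.1 + x).
    (* If both the center and its translate by [x] were adherent, so would be their difference
       [x]. *)
    have [h|h] := pselect (adh k s.1); last first.
      by exists 0; rewrite ?addr0 ?(nu0 H) // ltW.
    have [x xs nx] := no k _ s0; exists x => // hx; apply: nx.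
    by have := adhB _ _ _ hx h; rewrite addrAC subrr add0r.
  have [e e0 he] : exists2 e : R, 0 < e & forall y, nu (s.1 + x - y) < e -> ~ D (la_str B (w ^+ k) * y).
    apply: contrapT => hn; apply: nx => e e0; apply: contrapT => h; apply: hn.
    by exists e => // y ny Dy; apply: h; exists y.
  exists (s.1 + x, Num.min (s.2 / 2) (e / 2)) => /=; split.
  - by rewrite addrAC subrr add0r.
  - by rewrite lt_min !divr_gt0.
  - by rewrite ge_min lexx.
  - move=> y hy; apply: he; rewrite (nu_distC H).
    apply: le_lt_trans hy _; rewrite gt_min; apply/orP; right.
    by rewrite ltr_pdivrMr // ltr_pMr // ltr1n.
have /choice[f hf] (p : nat * (B * R)) : exists t : B * R, 0 < p.2.2 ->
    [/\ nu (t.1 - p.2.1) <= p.2.2, 0 < t.2, t.2 <= p.2.2 / 2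
      & forall y, nu (y - t.1) <= t.2 -> ~ D (la_str B (w ^+ p.1) * y)].
  have [h|h] := pselect (0 < p.2.2); last by exists (0, 0) => /h.
  by have [t ht] := step p.1 p.2 h; exists t.
pose s := fix s k : B * R := if k is j.+1 then f (j, s j) else (0, 1).
have s0 k : 0 < (s k).2.
  by elim: k => [|k IH] /=; rewrite ?ltr01 //; case: (hf (k, s k) IH).
have sS k := hf (k, s k) (s0 k).
have sle k : (s k).2 <= (1 / 2) ^+ k.
  elim: k => [|k IH]; first by rewrite expr0.
  have [_ _ h _] := sS k; apply: le_trans h _ => /=.
  by rewrite exprS; move: IH; set z := _ ^+ k; set y := (s k).2; lra.
have sdec k j : (s (k + j)%N).2 <= (s k).2.
  elim: j => [|j IH]; first by rewrite addn0.
  rewrite addnS; have [_ _ h _] := sS (k + j)%N; apply: le_trans h _.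
  apply: le_trans IH; rewrite /= ler_pdivrMr // ler_pMr ?s0 //.
  by rewrite ler1n.
have sdist k j : nu ((s (k + j)%N).1 - (s k).1) <= (s k).2.
  elim: j => [|j IH]; first by rewrite addn0 subrr (nu0 H) ltW.
  rewrite addnS -(subrKA (s (k + j)%N).1); apply: (nuD_le H) => //.
  by have [h _ _ _] := sS (k + j)%N; apply: le_trans h _; apply: sdec.
have [l hl] : exists l, nu_lim nu (fun k => (s k).1) l.
  apply: (nu_complete H) => e e0.
  have h01 : 0 <= (1 / 2 : R) < 1 by rewrite divr_ge0 //= ltr_pdivrMr // mul1r ltr1n.
  have [K hK] := geometric_small h01 ler01 e0; exists K => k /hK; rewrite mulr1.
  apply: le_lt_trans; apply: le_trans (sle k).
  by have := sdist k 1%N; rewrite addn1.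
have [k Dk] := D_exhaust l.
have [_ _ _ h] := sS k; apply: (h l) Dk.
rewrite -[f _]/(s k.+1); apply: (nu_lim_le H (nu_limB H hl (nu_lim_cst H (s k.+1).1))).
by exists k.+1 => j /subnKC <-; apply: sdist.
Qed.

(** Successive approximation: an element of [D] within [d1 |w|] leaves a remainder which, divided by
    [w], is again in the ball; [D_series] sums the corrections. *)
Lemma open_mapping : exists2 d, 0 < d & forall x, nu x <= d -> D x.
Proof.
have [k [d [d0 hd]]] := baire_ball.
have wk0 : 0 < cvf_abs (w ^+ k) by rewrite cvf_absX exprn_gt0.
pose d1 := d * cvf_abs (w ^+ k).
have d10 : 0 < d1 by rewrite mulr_gt0.
have near x : nu x <= d1 -> forall e : R, 0 < e -> exists2 y, D y & nu (x - y) < e.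
  move=> hx e e0; have : nu (la_str B (w ^+ k)^-1 * x) <= d.
    by rewrite (nuZ H) cvf_absV mulrC ler_pdivrMr.
  move=> /hd /(_ _ (divr_gt0 e0 wk0)) [y Dy hy].
  exists (la_str B (w ^+ k) * y) => //.
  rewrite -{1}(wKV k x) -mulrBr (nuZ H) mulrC -ltr_pdivlMr //.
have /choice[f hf] x : exists y, nu x <= d1 -> D y /\ nu (x - y) < d1 * cvf_abs w.
  have [h|h] := pselect (nu x <= d1); last by exists 0.
  by have [|y ? ?] := near x h (d1 * cvf_abs w); [rewrite mulr_gt0 | exists y].
exists d1 => // x hx.
pose X := fix X k := if k is j.+1 then la_str B w^-1 * (X j - f (X j)) else x.
have Xle j : nu (X j) <= d1.
  elim: j => [|j IH] //=; rewrite (nuZ H) cvf_absV mulrC ler_pdivrMr //.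
  by have [_ /ltW] := hf _ IH.
apply: (D_series (d := fun j => f (X j))).
  by move=> j; have [] := hf _ (Xle j).
have E K : x - \sum_(j < K) la_str B (w ^+ j) * f (X j) = la_str B (w ^+ K) * X K.
  elim: K => [|K IH]; first by rewrite big_ord0 subr0 expr0 rmorph1 mul1r.
  rewrite big_ord_recr /= opprD addrA IH mulrA -rmorphM exprSr mulfK // -mulrBr.
  by [].
move=> e e0; have w01 : 0 <= cvf_abs w < 1 by rewrite cvf_abs_ge0.
have [K hK] := geometric_small w01 (ltW d10) e0; exists K => j /hK.
apply: le_lt_trans; rewrite (nu_distC H) E (nuZ H) cvf_absX.
by apply: ler_wpM2l => //; rewrite exprn_ge0 // cvf_abs_ge0.
Qed.

End OpenMapping.

(** * Continuity of functionals on quotients of finite codimension *)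

Section FunctionalContinuity.
Variables (R : realType) (L : complete_valued_field R).

(** The tuples [(l j x)_j] form a finite-dimensional space, spanned by those of [v]: a vector is
    added whenever the next functional is nonzero on the common kernel of those already treated. *)
Lemma functional_span (B : lalg L) (I : Type) (J : finType) (l : J -> (I -> B) -> L) :
  (forall j, is_functional (l j)) ->
  exists (W : finType) (v : W -> I -> B), forall x, exists c : W -> L,
    forall j, l j x = \sum_k c k * l j (v k).
Proof.
move=> lF; suff [W [v hv]] : exists (W : finType) (v : W -> I -> B), forall x,
    exists c : W -> L, forall j, j \in enum J -> l j x = \sum_k c k * l j (v k).
  by exists W, v => x; have [c hc] := hv x; exists c => j; rewrite -hc // mem_enum.
elim: (enum J) => [|j0 s [W [v hv]]].
  by exists void, (fun k : void => match k with end) => x; exists (fun=> 0) => j.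
have [h|/existsNP[u /not_implyP[us uj]]] :=
  pselect (forall x, (forall j, j \in s -> l j x = 0) -> l j0 x = 0).
  exists W, v => x; have [c hc] := hv x; exists c => j.
  rewrite inE => /orP[/eqP ->|]; last exact: hc.
  have E i : l i (fun t => x t - \sum_k vscale (la_str B (c k)) (v k) t)
      = l i x - \sum_k c k * l i (v k).
    rewrite functionalB // functional_sum //; congr (_ - _).
    by apply: eq_bigr => k _; case: (lF i) => _; apply.
  by apply/eqP; rewrite -subr_eq0 -E h // => i /hc; rewrite E => ->; rewrite subrr.
exists (unit + W)%type, (fun k => if k is inr k then v k else u) => x.
have [c hc] := hv x.
exists (fun k => if k is inr k then c k else (l j0 x - \sum_k c k * l j0 (v k)) / l j0 u).
move=> j; rewrite big_sumType (big_pred1 tt) /=; last by case.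
rewrite inE => /orP[/eqP ->|js] /=.
  by rewrite divfK ?subrK //; apply/eqP.
by rewrite (us j js) mulr0 add0r hc.
Qed.

Variable w : L.
Hypotheses (w0 : 0 < cvf_abs w) (w1 : cvf_abs w < 1).

Lemma small_power (C e : R) : 0 <= C -> 0 < e -> exists k, cvf_abs (w ^+ k) * C < e.
Proof.
move=> C0 e0; have w01 : 0 <= cvf_abs w < 1 by rewrite cvf_abs_ge0.
have [K hK] := geometric_small w01 C0 e0; exists K.
by rewrite cvf_absX; apply: hK.
Qed.

(** [B] is [N] plus the span of [v]. Combinations of the generators of [N] and of [v] with
    coefficients of norm at most 1 contain a ball by the open mapping theorem, and [l j] is bounded
    on them because it vanishes on [N]. *)
Lemma functional_continuous (B : lalg L) (nu : B -> R) (N : set (unit -> B))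
    (J : finType) (l : J -> (unit -> B) -> L) :
  complete_norm nu -> is_submod N -> fin_gen N -> (forall j, is_functional (l j)) ->
  (forall x, N x <-> forall j, l j x = 0) ->
  forall j u, nu_lim nu u 0 ->
    forall e, 0 < e -> exists M, forall n, (M <= n)%N -> cvf_abs (l j (fun=> u n)) < e.
Proof.
move=> H sN [K [g [gN gen]]] lF lN j u u0.
have [W [v hv]] := functional_span lF.
pose comb (b : K -> B) (c : W -> L) : B :=
  \sum_k b k * g k tt + \sum_i la_str B (c i) * v i tt.
pose D : set B := [set x | exists b c,
  [/\ forall k, nu (b k) <= 1, forall i, cvf_abs (c i) <= 1 & x = comb b c]].
have combP x : exists b c, x = comb b c.
  have [c hc] := hv (fun=> x).
  have [|b hb] := gen (fun t => x - \sum_i vscale (la_str B (c i)) (v i) t).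
    apply/lN => i; rewrite (functionalB (fun=> x)) // functional_sum // hc.
    apply/eqP; rewrite subr_eq0; apply/eqP/eq_bigr => k _.
    by case: (lF i) => _ ->.
  exists b, c; have := congr1 (@^~ tt) hb => /= /eqP; rewrite subr_eq => /eqP ->.
  by [].
have DB x y : D x -> D y -> D (x - y).
  move=> [b [c [b1 c1 ->]]] [b' [c' [b1' c1' ->]]].
  exists (fun k => b k - b' k), (fun i => c i - c' i); split.
  - by move=> k; apply: (nuB_le H).
  - by move=> i; apply: (nuB_le (base_norm L)).
  - rewrite /comb opprD addrACA -!sumrB; congr (_ + _); apply: eq_bigr => k _.
      by rewrite mulrBl.
    by rewrite rmorphB mulrBl.
have D_exhaust x : exists k, D (la_str B (w ^+ k) * x).
  have [b [c ->]] := combP x.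
  pose C := \sum_k nu (b k) + \sum_i cvf_abs (c i).
  have s0 (A : finType) (F : A -> R) : (forall a, 0 <= F a) -> 0 <= \sum_a F a.
    by move=> h; apply: sumr_ge0.
  have bC k : nu (b k) <= C.
    rewrite /C (bigD1 k) //= -addrA lerDl addr_ge0 ?sumr_ge0 ?s0 //= => *;
      by rewrite ?(nu_ge0 H) ?cvf_abs_ge0.
  have cC i : cvf_abs (c i) <= C.
    rewrite /C [X in _ + X](bigD1 i) //= addrCA lerDl addr_ge0 ?sumr_ge0 ?s0 //= => *;
      by rewrite ?(nu_ge0 H) ?cvf_abs_ge0.
  have C0 : 0 <= C by rewrite addr_ge0 ?s0 // => *; rewrite ?(nu_ge0 H) ?cvf_abs_ge0.
  have [k hk] := small_power C0 ltr01; exists k.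
  exists (fun i => la_str B (w ^+ k) * b i), (fun i => w ^+ k * c i); split.
  - move=> i; rewrite (nuZ H); apply: le_trans (ltW hk).
    by apply: ler_wpM2l; rewrite ?cvf_abs_ge0.
  - move=> i; rewrite cvf_absM; apply: le_trans (ltW hk).
    by apply: ler_wpM2l; rewrite ?cvf_abs_ge0.
  - rewrite /comb mulrDr !mulr_sumr; congr (_ + _); apply: eq_bigr => i _.
      by rewrite mulrA.
    by rewrite rmorphM mulrA.
(* A series in powers of [w] keeps coefficients in the unit ball. Applied in [B] and in [L], this
   closes [D] under such series. *)
have wser (A : lalg L) (mu : A -> R) (HA : complete_norm mu) (d : nat -> A) :
    (forall k, mu (d k) <= 1) -> exists s, mu s <= 1 /\
      nu_lim mu (fun M => \sum_(k < M) la_str A (w ^+ k) * d k) s.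
  move=> d1.
  have le k : mu (la_str A (w ^+ k) * d k) <= cvf_abs w ^+ k.
    by rewrite (nuZ HA) cvf_absX -[leRHS]mulr1 ler_wpM2l // exprn_ge0 ?cvf_abs_ge0.
  have [|s hs] := @nu_series _ _ _ _ HA (fun k => la_str A (w ^+ k) * d k).
    move=> e e0; have w01 : 0 <= cvf_abs w < 1 by rewrite cvf_abs_ge0.
    have [M hM] := geometric_small w01 ler01 e0; exists M => n /hM.
    by rewrite mulr1; apply: le_lt_trans.
  exists s; split=> //; apply: (nu_lim_le HA hs); exists 0%N => n _.
  apply: (nu_sum_le HA) => // k _; apply: le_trans (le k) _.
  by rewrite exprn_ile1 ?cvf_abs_ge0 // ltW.
have D_series (d : nat -> B) x : (forall k, D (d k)) ->
    nu_lim nu (fun M => \sum_(k < M) la_str B (w ^+ k) * d k) x -> D x.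
  move=> /choice[b /choice[c hbc]] hx.
  have b1 n k : nu (b n k) <= 1 by have [h _ _] := hbc n.
  have c1 n i : cvf_abs (c n i) <= 1 by have [_ h _] := hbc n.
  have /choice[b' hb'] k := wser _ _ H (fun n => b n k) (b1^~ k).
  have /choice[c' hc'] i := wser _ _ (base_norm L) (fun n => c n i) (c1^~ i).
  have bl k := (hb' k).2; have cl0 i := (hc' i).2.
  exists b', c'; split; [by move=> k; case: (hb' k)|by move=> i; case: (hc' i)|].
  have {hx} : x = comb b' c'; last by [].
    apply: (nu_lim_uniq H hx).
    have L1 := @nu_lim_sum _ _ _ _ H _ (index_enum K) predT _ _ (fun k _ => nu_limMl H (g k tt) (bl k)).
    have cl i : nu_lim nu (fun M => la_str B (\sum_(k < M) w ^+ k * c k i)) (la_str B (c' i)).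
      move=> e e0; have C0 : 0 <= nu 1 by apply: (nu_ge0 H).
      have e1 : 0 < e / (nu 1 + 1) by rewrite divr_gt0 // ltr_wpDl.
      have [M hM] := cl0 i _ e1; exists M => n /hM h.
      rewrite -rmorphB -[la_str _ _]mulr1 (nuZ H).
      apply: (@le_lt_trans _ _ (cvf_abs (\sum_(k < n) w ^+ k * c k i - c' i) * (nu 1 + 1))).
        by rewrite ler_wpM2l ?cvf_abs_ge0 // lerDl.
      by rewrite -ltr_pdivlMr // ltr_wpDl.
    have L2 := @nu_lim_sum _ _ _ _ H _ (index_enum W) predT _ _ (fun i _ => nu_limMl H (v i tt) (cl i)).
    have := nu_limD H L1 L2; rewrite /comb.
    rewrite (eq_bigr (fun k => b' k * g k tt)); last by move=> k _; rewrite mulrC.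
    rewrite [X in _ + X](eq_bigr (fun i => la_str B (c' i) * v i tt)); last by move=> k _; rewrite mulrC.
    apply: nu_lim_ext => n /=.
    rewrite (eq_bigr (fun k => \sum_(m < n) la_str B (w ^+ m) * (b m k * g k tt))); last first.
      by move=> k _; rewrite mulr_sumr; apply: eq_bigr => m _; ring.
    rewrite [X in _ + X](eq_bigr (fun i => \sum_(m < n) la_str B (w ^+ m) * (la_str B (c m i) * v i tt))); last first.
      by move=> i _; rewrite rmorph_sum mulr_sumr; apply: eq_bigr => m _; rewrite rmorphM /=; ring.
    rewrite exchange_big [X in _ + X]exchange_big -big_split /=; apply: eq_bigr => m _.
    by have [_ _ ->] := hbc m; rewrite -!mulr_sumr -mulrDr.
have [d d0 hd] := open_mapping w0 w1 H DB D_exhaust D_series.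
pose C := \sum_i cvf_abs (l j (v i)).
have C0 : 0 <= C by apply: sumr_ge0 => *; apply: cvf_abs_ge0.
have lD x : D x -> cvf_abs (l j (fun=> x)) <= C.
  move=> [b [c [_ c1 ->]]].
  have [lDj lZ] := lF j.
  have -> : (fun=> comb b c) = fun t => \sum_k vscale (b k) (g k) t + \sum_i vscale (la_str B (c i)) (v i) t :> B.
    by apply/funext => -[].
  rewrite lDj !functional_sum // big1 ?add0r; last first.
    by move=> k _; move: j {lDj lZ C C0}; apply/lN; have [_ _] := sN; apply.
  apply: (@nu_sum_le _ _ _ _ (base_norm L)) => // i _.
  rewrite lZ cvf_absM; apply: (@le_trans _ _ (cvf_abs (l j (v i)))).
    by rewrite -[leRHS]mul1r ler_wpM2r ?cvf_abs_ge0.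
  by rewrite /C (bigD1 i) //= lerDl sumr_ge0 // => *; apply: cvf_abs_ge0.
move=> e e0; have [k hk] := small_power C0 e0.
have wn0 : w != 0 by apply/eqP => E; move: w0; rewrite E cvf_abs0 ltxx.
have wk0 : 0 < cvf_abs (w ^+ k) by rewrite cvf_absX exprn_gt0.
have [M hM] := u0 _ (mulr_gt0 d0 wk0); exists M => n /hM; rewrite subr0 => hn.
have : nu (la_str B (w ^+ k)^-1 * u n) <= d.
  by rewrite (nuZ H) cvf_absV mulrC ler_pdivrMr // ltW.
move=> /hd/lD; have [_ lZ] := lF j; have := lZ (w ^+ k)^-1 (fun=> u n).
rewrite /vscale => ->; rewrite cvf_absM cvf_absV mulrC ler_pdivrMr // => h.
by apply: le_lt_trans h _; rewrite mulrC.
Qed.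

End FunctionalContinuity.

(** * Automatic continuity and norms on affinoid algebras *)

Section AffinoidNorm.
Variables (R : realType) (L : complete_valued_field R) (w : L).
Hypotheses (w0 : 0 < cvf_abs w) (w1 : cvf_abs w < 1).

Section Pullback.
Variables (A B : lalg L) (q : {rmorphism A -> B}) (qL : is_lhom q).

Lemma submod_pull I (N : set (I -> B)) :
  is_submod N -> is_submod [set y : I -> A | N (q \o y)].
Proof.
move=> [N0 ND NZ]; split=> /=.
- by move: N0; congr N; apply/funext => i /=; rewrite rmorph0.
- by move=> x y hx hy; have := ND _ _ hx hy; congr N; apply/funext => i /=; rewrite rmorphD.
- by move=> b x hx; have := NZ (q b) _ hx; congr N; apply/funext => i; rewrite /vscale /= rmorphM.
Qed.

Lemma functional_pull I (l : (I -> B) -> L) :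
  is_functional l -> is_functional (fun y : I -> A => l (q \o y)).
Proof.
move=> [lD lZ]; split=> [x y|c x].
  by rewrite -lD; congr l; apply/funext => i /=; rewrite rmorphD.
by rewrite -lZ; congr l; apply/funext => i; rewrite /vscale /= rmorphM qL.
Qed.

Lemma fin_codim_pull I (N : set (I -> B)) :
  fin_codim N -> fin_codim [set y : I -> A | N (q \o y)].
Proof.
move=> [J [l [lF lN]]]; exists J, (fun j y => l j (q \o y)); split.
  by move=> j; apply: functional_pull.
by move=> y; apply: lN.
Qed.

Hypothesis qsurj : forall b, exists a, q a = b.

Lemma lift_vec I (x : I -> B) : exists y : I -> A, q \o y = x.
Proof. by have /choice[y hy] i := qsurj (x i); exists y; apply/funext. Qed.

Lemma fin_gen_push I (N : set (I -> B)) :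
  fin_gen [set y : I -> A | N (q \o y)] -> fin_gen N.
Proof.
move=> [K [g [gN gen]]]; exists K, (fun k => q \o g k); split=> // x.
have [y <-] := lift_vec x; move=> /gen [c hc]; exists (fun k => q (c k)).
apply/funext => i /=; rewrite hc rmorph_sum; apply: eq_bigr => k _.
by rewrite /vscale /= rmorphM.
Qed.

Lemma fin_codim_push I (N : set (I -> B)) : is_submod N ->
  fin_codim [set y : I -> A | N (q \o y)] -> fin_codim N.
Proof.
move=> sN [J [l [lF lN]]]; have [N0 ND NZ] := sN; have /choice[s hs] := @lift_vec I.
have sP x y j : q \o y = x -> l j (s x) = l j y.
  move=> hy; apply/eqP; rewrite -subr_eq0 -functionalB //; apply/eqP; move: j; apply/lN => /=.
  move: N0; congr N; apply/funext => i /=.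
  by rewrite rmorphB -[q (s x i)]/((q \o s x) i) hs -hy /= subrr.
exists J, (fun j x => l j (s x)); split.
  move=> j; have [lD lZ] := lF j; split=> [x y|c x].
    rewrite -lD; apply: sP; apply/funext => i /=.
    by rewrite rmorphD -[q (s x i)]/((q \o s x) i) -[q (s y i)]/((q \o s y) i) !hs.
  rewrite -lZ; apply: sP; apply/funext => i; rewrite /vscale /= rmorphM qL.
  by rewrite -[q (s x i)]/((q \o s x) i) hs.
move=> x; have := lN (s x); by rewrite /= hs.
Qed.

(** A submodule containing the pull-back contains the kernel of [q], hence is itself a pull-back, so
    maximality transfers. *)
Lemma maximal_avoiding_pull I (N : set (I -> B)) (b : I -> A) :
  is_maximal_avoiding N (q \o b) -> is_maximal_avoiding [set y : I -> A | N (q \o y)] b.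
Proof.
move=> [sN nb Nmax]; split=> //; first exact: submod_pull.
move=> N' sN' NN' nb'; have [N0' ND' NZ'] := sN'.
have ker (y z : I -> A) : q \o y = q \o z -> N' z -> N' y.
  move=> e hz; have : N' (fun i => (y i - z i) + z i).
    apply: ND' => //; apply: NN' => /=; have [N0 _ _] := sN; move: N0; congr N.
    by apply/funext => i /=; rewrite rmorphB -[q (y i)]/((q \o y) i) e /= subrr.
  by congr N'; apply/funext => i; rewrite subrK.
move=> y hy /=; apply: (Nmax [set q \o z | z in N']).
- split=> /=.
  + by exists (fun=> 0) => //; apply/funext => i /=; rewrite rmorph0.
  + move=> _ _ [u hu <-] [v hv <-]; exists (fun i => u i + v i); first exact: ND'.
    by apply/funext => i /=; rewrite rmorphD.
  + move=> c _ [u hu <-]; have [a <-] := qsurj c; exists (vscale a u); first exact: NZ'.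
    by apply/funext => i; rewrite /vscale /= rmorphM.
- by move=> x; have [z <-] := lift_vec x => hz; exists z => //; apply: NN'.
- by move=> [z hz e]; apply: nb'; apply: ker hz.
- by exists y.
Qed.

End Pullback.

Lemma affinoid_fin_gen (B : lalg L) (I : finType) (N : set (I -> B)) : is_affinoid B ->
  is_submod N -> fin_codim N -> fin_gen N.
Proof.
move=> /affinoid_presentation[n [q [qL qs]]] sN fN; apply: (fin_gen_push qs).
by apply: fin_codim_fin_gen; [apply: submod_pull | apply: fin_codim_pull].
Qed.

Lemma affinoid_maximal_avoiding (B : lalg L) (I : finType) (N : set (I -> B)) b :
  is_affinoid B -> is_maximal_avoiding N b -> fin_codim N.
Proof.
move=> /affinoid_presentation[n [q [qL qs]]] mN; have [sN _ _] := mN.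
apply: (fin_codim_push qL qs) => //; have [y hy] := lift_vec qs b.
apply: (@maximal_avoiding_fin_codim _ _ _ _ _ y); apply: maximal_avoiding_pull => //.
by rewrite hy.
Qed.

Lemma submod_zero (B : lalg L) (I : Type) : is_submod [set (fun=> 0) : I -> B].
Proof.
split=> //= [x y -> ->|b x ->]; apply/funext => i; rewrite /vscale ?addr0 //.
by rewrite mulr0.
Qed.

(** The source of all separation arguments: ideals of finite codimension intersect in zero. Ideals
    appear as submodules of [B^unit]. *)
Lemma affinoid_separate (B : lalg L) (b : B) : is_affinoid B -> b <> 0 ->
  exists N : set (unit -> B), [/\ is_maximal_avoiding N (fun=> b), fin_codim N & fin_gen N].
Proof.
move=> aB b0; have [|N _ mN] := exists_maximal_avoiding (submod_zero B unit) (b := fun=> b).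
  by move=> /= /(congr1 (@^~ tt)).
have fN := affinoid_maximal_avoiding aB mN.
by exists N; split=> //; apply: affinoid_fin_gen => //; case: mN.
Qed.

(* Automatic continuity, in closed-graph form: it holds modulo every ideal of
   finite codimension, since there both sides become bounded functionals. *)
Lemma affinoid_closed_graph (B B' : lalg L) (f : {rmorphism B -> B'}) nu nu' u b :
  is_affinoid B -> is_affinoid B' -> is_lhom f ->
  @complete_norm R L B nu -> @complete_norm R L B' nu' ->
  nu_lim nu u 0 -> nu_lim nu' (fun n => f (u n)) b -> b = 0.
Proof.
move=> aB aB' fL H H' hu hfu; apply: contrapT => b0.
have [N [mN [J [l [lF lN]]] gN]] := affinoid_separate aB' b0.
have [sN nb _] := mN; apply: nb; apply/lN => j.
have c1 := functional_continuous w0 w1 H' sN gN lF lN j.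
have sP := submod_pull f sN.
have c2 := functional_continuous w0 w1 H sP _ (fun i => functional_pull fL (lF i)) (fun x => lN _) j.
have {c2} c2 := c2 (affinoid_fin_gen aB sP (fin_codim_pull fL (ex_intro _ J (ex_intro _ l (conj lF lN))))) _ hu.
apply/cvf_abs_eq0/eqP; rewrite eq_le cvf_abs_ge0 andbT; apply/ler_addgt0Pl => e e0.
rewrite addr0; have [M1 h1] := c1 _ ((nu_lim0 nu' _ _).1 hfu) e e0; have [M2 h2] := c2 e e0.
have {}h1 := h1 (maxn M1 M2) (leq_maxl _ _); have {}h2 := h2 (maxn M1 M2) (leq_maxr _ _).
have -> : l j (fun=> b) = l j (fun=> f (u (maxn M1 M2))) - l j (fun=> f (u (maxn M1 M2)) - b).
  by rewrite (functionalB (fun=> f (u (maxn M1 M2))) (fun=> b)) // subKr.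
exact/ltW/(nuB_lt (base_norm L)).
Qed.

(** The quotient norm of a presentation by a Tate algebra. *)
Lemma affinoid_has_norm (B : lalg L) : is_affinoid B -> exists nu, @complete_norm R L B nu.
Proof.
move=> aB; have [n0 [q [qL qs]]] := affinoid_presentation aB.
pose HT := ban_norm (tate L n0); pose nuT := @ban_nu _ _ (tate L n0).
pose S x := [set nuT f | f in [set f | q f = x]].
pose nu x := inf (S x).
have Sne x : S x !=set0 by have [f hf] := qs x; exists (nuT f), f.
have Slb x : has_inf (S x).
  by split=> //; exists 0 => _ [f _ <-]; apply: (nu_ge0 HT).
have nu_le f x : q f = x -> nu x <= nuT f.
  by move=> qf; apply: ge_inf; [case: (Slb x) | exists f].
have nu_lt x e : nu x < e -> exists2 f, q f = x & nuT f < e.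
  move=> h; have h0 : 0 < e - nu x by rewrite subr_gt0.
  have [_ [f qf <-] hf] := inf_adherent h0 (Slb x); exists f => //.
  by move: hf; rewrite -/(nu x) addrC subrK.
have nuge0 x : 0 <= nu x by apply: lb_le_inf => // _ [f _ <-]; apply: (nu_ge0 HT).
have nu_zero : nu 0 = 0.
  apply/eqP; rewrite eq_le nuge0 andbT -(nu0 HT); apply: nu_le; exact: rmorph0.
exists nu; split.
- move=> x; split=> //; split=> [x0|->//]; apply: contrapT => xn0.
  (* Lifts of [x] of norm below [2^-k] tend to 0, so the functionals of an ideal of finite
     codimension, continuous on the Tate algebra, vanish at [x]; yet such ideals separate points. *)
  have [N [mN [J [l [lF lN]]] _]] := affinoid_separate aB xn0.
  have [sN nb _] := mN; apply: nb; apply/lN => j.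
  have /choice[u hu] k : exists f, q f = x /\ nuT f < (1 / 2) ^+ k.
    have [|f qf hf] := nu_lt x ((1 / 2) ^+ k); last by exists f.
    by rewrite x0 exprn_gt0 // divr_gt0.
  have sP := submod_pull q sN.
  have fP := fin_codim_pull qL (ex_intro _ J (ex_intro _ l (conj lF lN))).
  have := functional_continuous w0 w1 HT sP (fin_codim_fin_gen sP fP)
    (fun i => functional_pull qL (lF i)) (fun x => lN _) j (u := u).
  have u0 : nu_lim nuT u 0.
    move=> e e0; have h01 : 0 <= (1 / 2 : R) < 1 by rewrite divr_ge0 //= ltr_pdivrMr // mul1r ltr1n.
    have [K hK] := geometric_small h01 ler01 e0; exists K => k /hK; rewrite mulr1 subr0.
    by apply: lt_trans; case: (hu k).
  move=> /(_ u0) hc; apply/cvf_abs_eq0/eqP; rewrite eq_le cvf_abs_ge0 andbT.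
  apply/ler_addgt0Pl => e e0; rewrite addr0; have [M hM] := hc e e0.
  have := hM M (leqnn _); rewrite (_ : q \o _ = fun=> x); first exact: ltW.
  by apply/funext => i /=; case: (hu M).
- move=> x y; apply/ler_addgt0Pl => e e0.
  have m0 : Num.max (nu x) (nu y) < Num.max (nu x) (nu y) + e by rewrite ltrDl.
  have [|f qf hf] := nu_lt x (Num.max (nu x) (nu y) + e).
    by apply: le_lt_trans m0; rewrite le_max lexx.
  have [|g qg hg] := nu_lt y (Num.max (nu x) (nu y) + e).
    by apply: le_lt_trans m0; rewrite le_max lexx orbT.
  apply: (@le_trans _ _ (nuT (f - g))); first by apply: nu_le; rewrite rmorphB qf qg.
  by rewrite [leRHS]addrC; apply/ltW/(nuB_lt HT).
- split; first by apply: le_trans (nu1_le HT); apply: nu_le; apply: rmorph1.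
  move=> x y; apply/ler_addgt0Pl => e e0.
  (* With [d <= 1], the product [(nu x + d) (nu y + d)] exceeds [nu x * nu y] by at most
     [d (nu x + nu y + 1)]. *)
  pose d := Num.min 1 (e / (nu x + nu y + 1)).
  have s0 : 0 < nu x + nu y + 1 by rewrite ltr_wpDl // addr_ge0.
  have d0 : 0 < d by rewrite lt_min ltr01 divr_gt0.
  have [|f qf hf] := nu_lt x (nu x + d); first by rewrite ltrDl.
  have [|g qg hg] := nu_lt y (nu y + d); first by rewrite ltrDl.
  apply: (@le_trans _ _ (nuT (f * g))); first by apply: nu_le; rewrite rmorphM qf qg.
  apply: le_trans (nuM_le HT _ _) _.
  apply: (@le_trans _ _ ((nu x + d) * (nu y + d))).
    by apply: ler_pM; rewrite ?(nu_ge0 HT) // ltW.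
  have d1 : d <= 1 by rewrite ge_min lexx.
  have d2 : d * (nu x + nu y + 1) <= e by rewrite -ler_pdivlMr // ge_min lexx orbT.
  have := nuge0 x; have := nuge0 y; nra.
- move=> c x; have [->|c0] := eqVneq c 0.
    by rewrite rmorph0 mul0r nu_zero cvf_abs0 mul0r.
  have le a y : nu (la_str B a * y) <= cvf_abs a * nu y.
    have [->|a0] := eqVneq a 0; first by rewrite rmorph0 mul0r nu_zero cvf_abs0 mul0r.
    rewrite [leRHS]mulrC -ler_pdivrMr ?cvf_abs_gt0 //; apply: lb_le_inf => // _ [f qf <-].
    rewrite ler_pdivrMr ?cvf_abs_gt0 // [leRHS]mulrC -(nuZ HT); apply: nu_le.
    by rewrite rmorphM qL qf.
  apply/eqP; rewrite eq_le le /= -ler_pdivlMl ?cvf_abs_gt0 // -cvf_absV.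
  by apply: le_trans (le _ _); rewrite mulrA -rmorphM mulVf // rmorph1 mul1r.
- move=> u hu.
  (* The steps of a subsequence with differences below [2^-k] lift with the same bounds; the lifts
     sum in the Tate algebra, and the image of the sum gives the limit. *)
  have /choice[M hM] k : exists M, forall m n, (M <= m)%N -> (M <= n)%N -> nu (u m - u n) < (1 / 2) ^+ k.
    by apply: hu; rewrite exprn_gt0 // divr_gt0.
  pose P := fix P k := if k is j.+1 then maxn (P j) (M k) else M 0%N.
  have MP k : (M k <= P k)%N by case: k => [|k] /=; rewrite ?leqnn ?leq_maxr.
  have PS k : (P k <= P k.+1)%N by rewrite /= leq_maxl.
  have /choice[d hd] k : exists f, q f = u (P k.+1) - u (P k) /\ nuT f < (1 / 2) ^+ k.
    have [|f qf hf] := nu_lt (u (P k.+1) - u (P k)) ((1 / 2) ^+ k); last by exists f.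
    by apply: hM; rewrite ?MP // (leq_trans (MP k)).
  have h01 : 0 <= (1 / 2 : R) < 1 by rewrite divr_ge0 //= ltr_pdivrMr // mul1r ltr1n.
  have [|s hs] := nu_series HT (u := d).
    move=> e e0; have [K hK] := geometric_small h01 ler01 e0; exists K => k /hK.
    by rewrite mulr1; apply: lt_trans; case: (hd k).
  exists (q s + u (P 0%N)) => e e0; have [K1 hK1] := hs e e0.
  have [K2 hK2] := geometric_small h01 ler01 e0.
  pose K := maxn K1 K2; exists (P K) => n hn.
  have tel : q (\sum_(i < K) d i) = u (P K) - u (P 0%N).
    rewrite rmorph_sum (eq_bigr (fun i : 'I_K => u (P i.+1) - u (P i))); last by move=> i _; case: (hd i).
    by rewrite -(big_mkord predT (fun i => u (P i.+1) - u (P i))) telescope_sumr.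
  have a1 : nu (u n - u (P K)) < e.
    apply: lt_trans (hM K n (P K) _ (MP K)) _; first exact: leq_trans (MP K) hn.
    by rewrite -[ltLHS]mulr1; apply: hK2; apply: leq_maxr.
  have a2 : nu (u (P K) - u (P 0%N) - q s) < e.
    apply: le_lt_trans (hK1 K (leq_maxl _ _)); apply: nu_le.
    by rewrite rmorphB tel.
  have nuB x y : nu (x + y) <= Num.max (nu x) (nu y).
    apply/ler_addgt0Pl => e' e'0.
    have m0 : Num.max (nu x) (nu y) < Num.max (nu x) (nu y) + e' by rewrite ltrDl.
    have [|f qf hf] := nu_lt x (Num.max (nu x) (nu y) + e').
      by apply: le_lt_trans m0; rewrite le_max lexx.
    have [|g qg hg] := nu_lt y (Num.max (nu x) (nu y) + e').
      by apply: le_lt_trans m0; rewrite le_max lexx orbT.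
    apply: (@le_trans _ _ (nuT (f + g))); first by apply: nu_le; rewrite rmorphD qf qg.
    by rewrite [leRHS]addrC; apply/ltW/(nuD_lt HT).
  have -> : u n - (q s + u (P 0%N)) = (u n - u (P K)) + (u (P K) - u (P 0%N) - q s).
    by ring.
  by apply: le_lt_trans (nuB _ _) _; rewrite gt_max a1 a2.
Qed.

End AffinoidNorm.

(** * Maximal ideals of affinoid algebras *)

Section Quotient.
Variables (R : realType) (L : complete_valued_field R) (B : lalg L).

Definition is_ideal (J : set B) :=
  [/\ J 0, forall x y, J x -> J y -> J (x + y) & forall b x, J x -> J (b * x)].

(** Cosets are taken as subsets, so that equality of classes is equality of sets; representatives
    come from choice. *)
Definition quot_of (J : set B) (h : is_ideal J) :=
  {c : set B | exists b, c = [set x | J (x - b)]}.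

Variables (J : set B) (HJ : is_ideal J).
Local Notation Q := (quot_of HJ).

HB.instance Definition _ := gen_eqMixin Q.
HB.instance Definition _ := gen_choiceMixin Q.

Let J0 : J 0. Proof. by case: HJ. Qed.
Let JD x y : J x -> J y -> J (x + y). Proof. by case: HJ => _ h _; apply: h. Qed.
Let JM b x : J x -> J (b * x). Proof. by case: HJ => _ _; apply. Qed.
Let JN x : J x -> J (- x). Proof. by move=> h; rewrite -mulN1r; apply: JM. Qed.
Let JB x y : J x -> J y -> J (x - y). Proof. by move=> ? ?; apply/JD/JN. Qed.

Definition quot_class (b : B) : Q :=
  exist _ [set x | J (x - b)] (ex_intro _ b erefl).

Definition quot_repr (c : Q) : B := projT1 (cid (projT2 (existT _ (sval c) (svalP c)))).

Lemma quot_reprK c : quot_class (quot_repr c) = c.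
Proof.
case: c => c hc; rewrite /quot_repr /=; case: cid => b hb /=.
by apply: eq_exist; rewrite /= hb.
Qed.

Lemma quot_eq x y : quot_class x = quot_class y <-> J (x - y).
Proof.
split=> [h|h].
  have : sval (quot_class x) x by rewrite /= subrr.
  by rewrite h.
apply: eq_exist; apply/seteqP; split=> z /= hz.
  by rewrite -(subrKA x); apply: JD.
by rewrite (_ : z - x = (z - y) - (x - y)); [apply: JB | ring].
Qed.

Lemma quot_repr_class x : J (quot_repr (quot_class x) - x).
Proof. by apply/quot_eq; rewrite quot_reprK. Qed.

Definition quot_add (c d : Q) := quot_class (quot_repr c + quot_repr d).
Definition quot_opp (c : Q) := quot_class (- quot_repr c).
Definition quot_mul (c d : Q) := quot_class (quot_repr c * quot_repr d).

Lemma quot_classD x y : quot_add (quot_class x) (quot_class y) = quot_class (x + y).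
Proof.
apply/quot_eq; rewrite opprD addrACA.
by apply: JD; apply: quot_repr_class.
Qed.

Lemma quot_classN x : quot_opp (quot_class x) = quot_class (- x).
Proof. by apply/quot_eq; rewrite -opprD; apply/JN/quot_repr_class. Qed.

Lemma quot_classM x y : quot_mul (quot_class x) (quot_class y) = quot_class (x * y).
Proof.
apply/quot_eq; set a := quot_repr _; set b := quot_repr _.
have -> : a * b - x * y = b * (a - x) + x * (b - y) by ring.
by apply: JD; apply: JM; apply: quot_repr_class.
Qed.

Let ind (P : Q -> Prop) : (forall b, P (quot_class b)) -> forall c, P c.
Proof. by move=> h c; rewrite -(quot_reprK c). Qed.

Lemma quot_addA : associative quot_add.
Proof. by elim/ind=> x; elim/ind=> y; elim/ind=> z; rewrite !quot_classD addrA. Qed.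
Lemma quot_addC : commutative quot_add.
Proof. by elim/ind=> x; elim/ind=> y; rewrite !quot_classD addrC. Qed.
Lemma quot_add0 : left_id (quot_class 0) quot_add.
Proof. by elim/ind=> x; rewrite quot_classD add0r. Qed.
Lemma quot_addN : left_inverse (quot_class 0) quot_opp quot_add.
Proof. by elim/ind=> x; rewrite quot_classN quot_classD addNr. Qed.
HB.instance Definition _ :=
  GRing.isZmodule.Build Q quot_addA quot_addC quot_add0 quot_addN.

Lemma quot_mulA : associative quot_mul.
Proof. by elim/ind=> x; elim/ind=> y; elim/ind=> z; rewrite !quot_classM mulrA. Qed.
Lemma quot_mulC : commutative quot_mul.
Proof. by elim/ind=> x; elim/ind=> y; rewrite !quot_classM mulrC. Qed.
Lemma quot_mul1 : left_id (quot_class 1) quot_mul.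
Proof. by elim/ind=> x; rewrite quot_classM mul1r. Qed.
Lemma quot_mulDl : left_distributive quot_mul quot_add.
Proof.
elim/ind=> x; elim/ind=> y; elim/ind=> z.
by rewrite !(quot_classM, quot_classD) mulrDl.
Qed.
HB.instance Definition _ :=
  GRing.Zmodule_isComPzRing.Build Q quot_mulA quot_mulC quot_mul1 quot_mulDl.

Lemma quot_class_zmod : zmod_morphism quot_class.
Proof.
move=> x y; apply/esym.
change (quot_add (quot_class x) (quot_opp (quot_class y)) = quot_class (x - y)).
by rewrite quot_classN quot_classD.
Qed.
Lemma quot_class_monoid : monoid_morphism quot_class.
Proof. by split=> // x y; apply/esym; exact: quot_classM. Qed.
HB.instance Definition _ := GRing.isZmodMorphism.Build B Q quot_class quot_class_zmod.
HB.instance Definition _ := GRing.isMonoidMorphism.Build B Q quot_class quot_class_monoid.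

Definition quot_str : L -> Q := quot_class \o la_str B.
HB.instance Definition _ := GRing.RMorphism.on quot_str.
Definition quot : lalg L := @LAlg R L Q quot_str.
Definition quot_map : {rmorphism B -> quot} := quot_class.

Lemma quot_map_lhom : is_lhom quot_map. Proof. by []. Qed.
Lemma quot_map_surj (c : quot) : exists b, quot_map b = c.
Proof. by exists (quot_repr c); exact: quot_reprK. Qed.
Lemma quot_map_eq0 b : quot_map b = 0 <-> J b.
Proof. by rewrite -[b in J b]subr0; apply: quot_eq. Qed.

Lemma quot_affinoid : is_affinoid B -> is_affinoid quot.
Proof.
move=> [n [p [pC pD pM ps]]]; exists n, (quot_map \o p); split=> /=.
- by move=> c; rewrite pC.
- by move=> f g hf hg; rewrite pD // rmorphD.
- by move=> f g hf hg; rewrite pM // rmorphM.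
- by move=> c; have [b <-] := quot_map_surj c; have [f hf <-] := ps b; exists f.
Qed.

Lemma quot_factor (C : lalg L) (f : {rmorphism B -> C}) : is_lhom f ->
  (forall b, J b -> f b = 0) ->
  exists g : {rmorphism quot -> C}, is_lhom g /\ forall b, g (quot_map b) = f b.
Proof.
move=> fL fJ; pose g (c : quot) : C := f (quot_repr c).
have gE b : g (quot_map b) = f b.
  by apply/eqP; rewrite -subr_eq0 /g -rmorphB fJ //; apply: quot_repr_class.
have gB : zmod_morphism g.
  by elim/ind=> x; elim/ind=> y; rewrite -[_ - _]/(quot_map x - quot_map y) -rmorphB !gE rmorphB.
have gM : monoid_morphism g.
  split; first by rewrite -(rmorph1 quot_map) gE rmorph1.
  by elim/ind=> x; elim/ind=> y; rewrite -[_ * _]/(quot_map x * quot_map y) -rmorphM !gE rmorphM.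
pose gz := GRing.isZmodMorphism.Build _ _ g gB.
pose gm := GRing.isMonoidMorphism.Build _ _ g gM.
pose gr : {rmorphism quot -> C} := HB.pack g gz gm.
by exists gr; split=> // c; rewrite -fL -gE.
Qed.

End Quotient.

(** * Residue fields and local quotients *)

Section MaximalIdeals.
Variables (R : realType) (L : complete_valued_field R).

Lemma maximal_is_ideal (B : lalg L) I : Sp B I -> is_ideal I.
Proof. by case. Qed.

Lemma ideal_submod (B : lalg L) (N : set (unit -> B)) :
  is_submod N -> is_ideal [set b | N (fun=> b)].
Proof.
move=> [N0 ND NZ]; split=> //= x y hx; first by move=> hy; apply: ND.
exact: NZ.
Qed.

(* [B] modulo the kernel [N] of finitely many functionals is strongly
   pi-regular, with witnesses polynomial in the element. *)
Lemma fin_codim_power (B : lalg L) (N : set (unit -> B)) (y : B) :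
  is_submod N -> fin_codim N -> exists k m (c : nat -> L),
    N (fun=> y ^+ k - y ^+ k.+1 * \sum_(i < m) la_str B (c i) * y ^+ i).
Proof.
move=> sN [J [l [lF lN]]].
pose M : 'M[L]_(#|J|.+1, #|J|) := \matrix_(k, j) l (enum_val j) (fun=> y ^+ k).
have : kermx M != 0.
  rewrite -mxrank_eq0 mxrank_ker -lt0n subn_gt0 ltnS; exact: rank_leq_col.
move/rowV0Pn => [v /sub_kermxP hv vn].
have ex : exists k, (k < #|J|.+1)%N && (v 0 (inord k) != 0).
  apply: contraNP vn => /forallNP h; apply/eqP/rowP => k.
  by have := h k; rewrite mxE ltn_ord /= inord_val => /negP/negPn/eqP.
(* Dividing the linear relation among the powers of [y] by its lowest nonzero coefficient expresses
   [y^k] through higher powers. *)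
case: (ex_minnP ex) => k /andP[kJ vk] kmin.
have low (i : 'I_#|J|.+1) : (i < k)%N -> v 0 i = 0.
  move=> ik; apply/eqP; apply: contraTT ik => vi; rewrite -leqNgt; apply: kmin.
  by rewrite ltn_ord inord_val.
exists k, (#|J| - k)%N, (fun i => - (v 0 (inord (k + i).+1) / v 0 (inord k))).
pose u := v 0 (inord k).
have NS : N (fun t => \sum_(i < #|J|.+1) vscale (la_str B (v 0 i)) (fun=> y ^+ i) t).
  apply/lN => j; rewrite functional_sum //.
  have := congr1 (fun x : 'rV__ => x 0 (enum_rank j)) hv; rewrite [RHS]mxE => e.
  rewrite -[RHS]e mxE; apply: eq_bigr => i _; rewrite mxE enum_rankK.
  by case: (lF j) => _ ->.
have [_ _ NZ] := sN; have := NZ (la_str B u^-1) _ NS; congr N; apply/funext => t.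
pose F i := la_str B (v 0 (inord i)) * y ^+ i.
transitivity (la_str B u^-1 * \sum_(0 <= i < #|J|.+1) F i).
  by rewrite /vscale big_mkord; congr (_ * _); apply: eq_bigr => i _; rewrite /F inord_val.
rewrite (@big_cat_nat _ _ _ k) //=; last exact: ltnW.
rewrite [X in _ * (X + _)]big_nat_cond big1 ?add0r => [|i /andP[/andP[_ ik] _]]; last first.
  have iJ : (i < #|J|.+1)%N by apply: ltn_trans kJ.
  by rewrite /F (_ : inord i = Ordinal iJ) ?low ?rmorph0 ?mul0r //; apply: val_inj; rewrite /= inordK.
rewrite (big_ltn kJ) -[k.+1]add0n big_addn add0n subSS big_mkord mulrDr.
have uV : la_str B u^-1 * la_str B u = 1 by rewrite -rmorphM mulVf // rmorph1.
rewrite /F mulrA uV mul1r; congr (_ + _).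
rewrite -mulNr !mulr_sumr; apply: eq_bigr => i _.
rewrite (_ : (i + k.+1)%N = (k + i).+1); last by rewrite addnS addnC.
by rewrite rmorphN rmorphM -/u -addSn exprD; ring.
Qed.

Lemma maximal_prime (B : lalg L) I x y : Sp B I -> I (x * y) -> I x \/ I y.
Proof.
move=> [_ ID IM _ Imax] xy; have [|nx] := pselect (I x); first by left.
right; have [b [z [Iz e]]] := Imax x nx.
have -> : y = b * (x * y) + y * z by rewrite -[LHS]mul1r -e; ring.
by apply: ID; apply: IM.
Qed.

Lemma maximal_exp (B : lalg L) I x k : Sp B I -> I (x ^+ k) -> I x.
Proof.
move=> SI; elim: k => [|k IH]; first by rewrite expr0; case: SI.
by rewrite exprS => /(maximal_prime SI) [].
Qed.

(** A proper ideal is one that avoids 1; the finiteness theorem for maximal avoiding submodules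
    thereby becomes the Nullstellensatz. *)
Lemma maximal_is_maximal_avoiding (B : lalg L) I : Sp B I ->
  is_maximal_avoiding [set y : unit -> B | I (y tt)] (fun=> 1).
Proof.
move=> [I0 ID IM I1 Imax]; split=> //.
  by split=> //= [x y|b x]; [apply: ID | apply: IM].
move=> N' [N0 ND NZ] sub n1 y ny /=; apply: contrapT => /Imax [b [z [Iz e]]].
apply: n1; have hz : N' (fun=> z) by apply: sub.
have := ND _ _ (NZ b _ ny) hz; congr N'; apply/funext => -[].
by rewrite /vscale e.
Qed.

Lemma maximal_fin_codim (B : lalg L) I : is_affinoid B -> Sp B I ->
  fin_codim [set y : unit -> B | I (y tt)].
Proof.
by move=> aB /maximal_is_maximal_avoiding; apply: affinoid_maximal_avoiding.
Qed.

(* The Nullstellensatz in the form needed: residue fields are finite over L. *)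
Lemma maximal_pull (B B' : lalg L) (g : {rmorphism B -> B'}) I :
  is_affinoid B' -> is_lhom g -> Sp B' I -> Sp B (g @^-1` I).
Proof.
move=> aB' gL SI; have [I0 ID IM I1 Imax] := SI; split=> /=.
- by rewrite rmorph0.
- by move=> x y; rewrite rmorphD; apply: ID.
- by move=> b x; rewrite rmorphM; apply: IM.
- by rewrite rmorph1.
move=> x nx; have sN : is_submod [set y : unit -> B' | I (y tt)].
  by case: (maximal_is_maximal_avoiding SI).
have [k [m [c /=]]] := fin_codim_power (g x) sN (maximal_fin_codim aB' SI).
pose P := \sum_(i < m) la_str B (c i) * x ^+ i.
have -> : \sum_(i < m) la_str B' (c i) * g x ^+ i = g P.
  by rewrite rmorph_sum; apply: eq_bigr => i _; rewrite rmorphM rmorphXn gL.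
(* With [y = g x], the element [y^k (1 - y (g P))] lies in the prime [I]: either [y] does, or [P], a
   polynomial in [x], inverts [x] modulo the pull-back. *)
rewrite exprSr -mulrA -{1}[_ ^+ k]mulr1 -mulrBr => /(maximal_prime SI) [/(maximal_exp SI)//|h].
exists P, (1 - P * x); split; last by rewrite addrC subrK.
by rewrite /= rmorphB rmorph1 rmorphM mulrC.
Qed.

Lemma nilpotent_mod_add (B : lalg L) J (x y : B) m n : is_ideal J ->
  J (x ^+ m) -> J (y ^+ n) -> J ((x + y) ^+ (m + n)).
Proof.
move=> [J0 JD JM] hx hy; rewrite exprDn; elim/big_ind: _ => // i _.
rewrite -mulr_natl; apply: (JM); move: (nat_of_ord i) (ltn_ord i) => {}i im.
have [h|h] := leqP n i; first by rewrite -(subnK h) exprD mulrA; apply: (JM).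
rewrite (_ : (m + n - i = (n - i) + m)%N); last by lia.
by rewrite exprD mulrAC; apply: (JM).
Qed.

(* Every nonzero [x] survives in a finite-dimensional local quotient: an ideal
   maximal among those avoiding [x] leaves no nontrivial idempotent. *)
Lemma affinoid_local_separate (B : lalg L) (x : B) : is_affinoid B -> x <> 0 ->
  exists (m : set B) (F : lalg L) (pi : {rmorphism B -> F}),
    [/\ Sp B m, is_affinoid F, is_lhom pi, pi x <> 0 & forall M, Sp F M -> pi @^-1` M = m].
Proof.
move=> aB x0; have [N [mN fN _]] := affinoid_separate aB x0.
have [sN nx Nmax] := mN; have HJ := ideal_submod sN.
pose J := [set b | N (fun=> b)]; have [J0 JD JM] := HJ.
have JB a b : J a -> J b -> J (a - b).
  by move=> ha hb; apply: JD => //; rewrite -mulN1r; apply: JM.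
have mult y : ~ J y -> exists h, J (x - h * y).
  by move=> ny; have [h hh] := maximal_avoidingP mN ny; exists h.
have nil_or_unit y : (exists k, J (y ^+ k)) \/ exists z, J (1 - z * y).
  have [k [n [c]]] := fin_codim_power y sN fN; set P := \sum_(i < n) _ => hP.
  have {}hP : J (y ^+ k - y ^+ k.+1 * P) by [].
  have step i : J (y ^+ k - y ^+ k * (y * P) ^+ i).
    elim: i => [|i IH]; first by rewrite expr0 mulr1 subrr.
    rewrite (_ : _ - _ = (y ^+ k - y ^+ k * (y * P) ^+ i) + (y * P) ^+ i * (y ^+ k - y ^+ k.+1 * P)).
      by apply: JD => //; apply: JM.
    by rewrite !exprS; ring.
  (* Idempotent modulo [J], because [y^k] absorbs all powers of [y P]. *)
  pose e := (y * P) ^+ k.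
  have ee : J (e - e * e).
    have := JM (P ^+ k) _ (step k); congr J.
    have E : P ^+ k * y ^+ k = e by rewrite /e exprMn mulrC.
    by rewrite mulrBr mulrA E.
  have [Je|nJe] := pselect (J e).
    left; exists k; rewrite -[y ^+ k](subrK (y ^+ k * e)).
    by apply: JD; [apply: step | apply: JM].
  have [J1e|nJ1e] := pselect (J (1 - e)).
    right; case: k hP @e {step ee nJe} J1e => [|k] hP e J1e.
      by exists P; move: hP; congr J; rewrite expr0 expr1 mulrC.
    by exists (P * (y * P) ^+ k); move: J1e; congr J; rewrite /e exprS; ring.
  (* A nontrivial idempotent is excluded: [x] would be a multiple of both [e] and [1 - e] modulo
     [J], so [(1 - e) x] and [e x] would both vanish there. *)
  exfalso; apply: nx; change (J x).
  have [h hh] := mult _ nJe; have [h' hh'] := mult _ nJ1e.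
  have -> : x = (x - h * e) + h * (e - e * e) - e * (x - h * e) + e * (x - h' * (1 - e)) + h' * (e - e * e).
    by ring.
  apply: (JD); last exact: JM.
  apply: (JD); last exact: JM.
  apply: (JB); last exact: JM.
  by apply: (JD) => //; exact: JM.
(* The radical of [J], maximal because every element is nilpotent or a unit modulo [J]. *)
pose m := [set b | exists k, J (b ^+ k)].
have J1 : ~ J 1 by move=> /(JM x); rewrite mulr1.
have m1 : ~ m 1 by move=> [k]; rewrite expr1n.
have Sm : Sp B m.
  split=> //.
  - by exists 1%N; rewrite expr1.
  - by move=> a b [i hi] [j hj]; exists (i + j)%N; apply: nilpotent_mod_add.
  - by move=> b a [i hi]; exists i; rewrite exprMn; apply: JM.
  - move=> a na; have [//|[z hz]] := nil_or_unit a.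
    exists z, (1 - z * a); split; last by rewrite addrC subrK.
    by exists 1%N; rewrite expr1.
exists m, (quot HJ), (quot_map HJ); split=> //.
- exact: quot_affinoid.
- by move=> /quot_map_eq0.
move=> M SM; apply/seteqP; split=> b /=; last first.
  move=> [k /(quot_map_eq0 HJ) hk]; apply: (maximal_exp (k := k) SM).
  by rewrite -rmorphXn hk; case: SM.
move=> Mb; have [//|[z hz]] := nil_or_unit b; exfalso.
have [_ _ MM M1 _] := SM; apply: M1.
have /eqP := (quot_map_eq0 HJ _).2 hz; rewrite rmorphB rmorph1 subr_eq0 => /eqP ->.
by rewrite rmorphM; apply: MM.
Qed.

End MaximalIdeals.

(** * Affinoid subdomains *)

Section Subdomains.
Variables (R : realType) (L : complete_valued_field R).

Lemma set_preimage_comp (A B C : Type) (f : A -> B) (g : B -> C) (h : A -> C) (I : set C) :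
  (forall a, g (f a) = h a) -> f @^-1` (g @^-1` I) = h @^-1` I.
Proof. by move=> e; apply/seteqP; split=> a /=; rewrite e. Qed.

Lemma represents_id (B : lalg L) : is_affinoid B -> represents (idfun : {rmorphism B -> B}) (Sp B).
Proof.
move=> aB; split=> // B'' g aB'' gL gS; exists g; split=> //.
Qed.

Lemma subdomain_adm (B : lalg L) W : is_affinoid_subdomain W -> @sp_adm R L B W.
Proof.
move=> [C [f [aC fL WS fW univ]]]; split=> //.
exists [set W]; split.
- by move=> V ->; exists C, f.
- by rewrite bigcup_set1.
move=> B' g aB' gL gW; exists 1%N, (fun=> Sp B'); split.
- by move=> _; exists B', idfun; apply: represents_id.
- by move=> I SI; exists ord0.
- by move=> _; exists W => // I; apply: gW.
Qed.

(* An element vanishing on an affinoid cover, even a merely set-theoretic one,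
   is zero: each local finite-dimensional quotient factors through the cover. *)
Lemma represents_separate (B : lalg L) (x : B) : is_affinoid B ->
  (forall m, Sp B m -> exists (C : lalg L) (f : {rmorphism B -> C}) W,
     [/\ represents f W, W m & f x = 0]) -> x = 0.
Proof.
move=> aB h; apply: contrapT => x0.
have [m [F [pi [Sm aF piL pix pim]]]] := affinoid_local_separate aB x0.
have [C [f [W [[aC fL _ _ univ] Wm fx]]]] := h m Sm; apply: pix.
have [|k [_ kf _]] := univ F pi aF piL; first by move=> M /pim ->.
by rewrite -kf fx rmorph0.
Qed.

Section Push.
Variables (B B' : lalg L) (f : {rmorphism B -> B'}) (W : set (set B)).
Hypotheses (aB : is_affinoid B) (rf : represents f W).

Definition push (V : set (set B')) : set (set B) := [set f @^-1` I | I in V].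

Let aB' : is_affinoid B'. Proof. by case: rf. Qed.
Let fL : is_lhom f. Proof. by case: rf. Qed.
Let fW I : Sp B' I -> W (f @^-1` I). Proof. by case: rf => _ _ _ h _; apply: h. Qed.

(** The residue map at [m] extends to a map [h] on [B']. For any [I] above [m], the projection to
    [B'/I] and the map induced by [h] both extend the same map on [B]; uniqueness of extensions
    makes [I] the kernel of [h]. *)
Lemma represents_inj I1 I2 : Sp B' I1 -> Sp B' I2 -> f @^-1` I1 = f @^-1` I2 -> I1 = I2.
Proof.
move=> S1 S2 e; have [_ _ WS _ univ] := rf.
pose m := f @^-1` I1; have Sm : Sp B m by apply: WS; apply: fW.
pose k := quot (maximal_is_ideal Sm); pose pk := quot_map (maximal_is_ideal Sm).
have akk : is_affinoid k by apply: quot_affinoid.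
have kW (M : set k) : Sp k M -> W (pk @^-1` M).
  move=> SM; have SpM := maximal_pull akk (quot_map_lhom _) SM.
  suff -> : pk @^-1` M = m by apply: fW.
  apply/seteqP; split=> b /= hb.
    apply: contrapT => nm; have [_ _ _ _ Smax] := Sm.
    have [c [z [mz ec]]] := Smax b nm.
    have [_ MD MM M1 _] := SM; apply: M1.
    have := congr1 pk ec; rewrite rmorphD rmorphM rmorph1 => <-.
    apply: MD; first exact: MM.
    by have /quot_map_eq0 -> := mz; case: SM.
  by have /quot_map_eq0 -> := hb; case: SM.
have [h [hL hf huniq]] := univ k pk akk (quot_map_lhom _) kW.
suff key I : Sp B' I -> f @^-1` I = m -> I = [set b | h b = 0] by rewrite (key I1) // (key I2).
move=> SI eI.
pose k1 := quot (maximal_is_ideal SI); pose p1 := quot_map (maximal_is_ideal SI).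
have ak1 : is_affinoid k1 by apply: quot_affinoid.
pose g : {rmorphism B -> k1} := p1 \o f.
have gL : is_lhom g by move=> c; rewrite /= fL.
have [j [jL jg]] := quot_factor (maximal_is_ideal Sm) gL (fun b (hb : m b) =>
  (quot_map_eq0 (maximal_is_ideal SI) (f b)).2 (eq_ind_r (fun J : set B => J b) hb eI)).
have gW M : Sp k1 M -> W (g @^-1` M).
  by move=> SM; exact: (fW (maximal_pull ak1 (quot_map_lhom _) SM)).
have [h1 [_ _ u1]] := univ k1 g ak1 gL gW.
have e1 : p1 =1 h1 by apply: u1.
have e2 : (j \o h : {rmorphism B' -> k1}) =1 h1.
  by apply: u1 => [c|b] /=; [rewrite hL jL | rewrite hf jg].
apply/seteqP; split=> b /= hb; last first.
  by apply/(quot_map_eq0 (maximal_is_ideal SI)); rewrite -/p1 e1 -e2 /= hb rmorph0.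
have [c hc] := quot_map_surj (h b).
have : m c.
  rewrite -eI /=; apply/(quot_map_eq0 (maximal_is_ideal SI)).
  rewrite -/p1 -[p1 (f c)]/(g c) -jg hc -[j (h b)]/((j \o h) b) e2 -e1.
  exact/(quot_map_eq0 (maximal_is_ideal SI)).
by move/(quot_map_eq0 (maximal_is_ideal Sm)); rewrite hc.
Qed.

(** The residue map at [m] extends to [B'] by the universal property; the kernel of the extension is
    the point above [m]. *)
Lemma represents_surj m : W m -> exists2 I, Sp B' I & f @^-1` I = m.
Proof.
move=> Wm; have [_ _ WS _ univ] := rf; have Sm := WS _ Wm.
pose k := quot (maximal_is_ideal Sm); pose pk := quot_map (maximal_is_ideal Sm).
have akk : is_affinoid k by apply: quot_affinoid.
have [m0 mD mM m1 mmax] := Sm.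
have kW (M : set k) : Sp k M -> W (pk @^-1` M).
  move=> SM; suff -> : pk @^-1` M = m by [].
  apply/seteqP; split=> b /= hb; last by have /quot_map_eq0 -> := hb; case: SM.
  apply: contrapT => nm; have [c [z [mz ec]]] := mmax b nm.
  have [_ MD MM M1 _] := SM; apply: M1.
  have := congr1 pk ec; rewrite rmorphD rmorphM rmorph1 => <-.
  apply: MD; first exact: MM.
  by have /quot_map_eq0 -> := mz; case: SM.
have [h [hL hf huniq]] := univ k pk akk (quot_map_lhom _) kW.
have pm : f @^-1` [set b | h b = 0] = m.
  apply/seteqP; split=> b /=; rewrite hf; first by move/quot_map_eq0.
  by move=> hb; apply/quot_map_eq0.
exists [set b | h b = 0] => //; split=> /=.
- exact: rmorph0.
- by move=> x y hx hy; rewrite rmorphD hx hy addr0.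
- by move=> b x hx; rewrite rmorphM hx mulr0.
- by move=> h1; apply: m1; rewrite -pm /= rmorph1.
move=> x hx; have [c hc] := quot_map_surj (h x).
have nm : ~ m c by move=> /(quot_map_eq0 (maximal_is_ideal Sm)); rewrite hc.
have [d [z [mz e]]] := mmax c nm; exists (f d), (1 - f d * x).
split; last by rewrite addrC subrK.
rewrite rmorphB rmorphM rmorph1 hf -hc -rmorphM -[1](rmorph1 pk) -rmorphB.
by apply/(quot_map_eq0 (maximal_is_ideal Sm)); rewrite -e addrC addKr.
Qed.

Lemma push_inj V1 V2 : V1 `<=` Sp B' -> V2 `<=` Sp B' -> push V1 = push V2 -> V1 = V2.
Proof.
move=> s1 s2 e; apply/seteqP; split=> I hI.
  have : push V2 (f @^-1` I) by rewrite -e; exists I.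
  by move=> [J hJ /represents_inj <-//]; [apply: s2 | apply: s1].
have : push V1 (f @^-1` I) by rewrite e; exists I.
by move=> [J hJ /represents_inj <-//]; [apply: s1 | apply: s2].
Qed.

Lemma push_mem V I : V `<=` Sp B' -> Sp B' I -> push V (f @^-1` I) -> V I.
Proof. by move=> sV SI [J VJ /represents_inj <-//]; apply: sV. Qed.

Lemma push_sub V : V `<=` Sp B' -> push V `<=` W.
Proof. by move=> sV _ [I /sV SI <-]; apply: fW. Qed.

Definition pull (U : set (set B)) : set (set B') := [set I | Sp B' I /\ U (f @^-1` I)].

Lemma pull_sub U : pull U `<=` Sp B'. Proof. by move=> I []. Qed.

Lemma push_pull U : U `<=` W -> push (pull U) = U.
Proof.
move=> UW; apply/seteqP; split=> [_ [I [_ h] <-]//|m Um].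
by have [I SI e] := represents_surj (UW _ Um); exists I; rewrite // /pull /= e.
Qed.

Lemma push_factor (C : lalg L) (g : {rmorphism B -> C}) V :
  is_affinoid C -> is_lhom g -> V `<=` Sp B' -> (forall I, Sp C I -> push V (g @^-1` I)) ->
  exists h : {rmorphism B' -> C}, [/\ is_lhom h, forall b, h (f b) = g b,
    forall I, Sp C I -> V (h @^-1` I)
    & forall h' : {rmorphism B' -> C}, is_lhom h' -> (forall b, h' (f b) = g b) -> h' =1 h].
Proof.
move=> aC gL sV gV; have [_ _ _ _ univ] := rf.
have [|h [hL hf hu]] := univ C g aC gL; first by move=> I /gV; apply: push_sub.
exists h; split=> // I SI; apply: (push_mem sV); first exact: (maximal_pull aC hL SI).
by rewrite (set_preimage_comp _ hf); apply: gV.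
Qed.

Lemma represents_push (C : lalg L) (g : {rmorphism B' -> C}) V :
  represents g V -> represents (g \o f : {rmorphism B -> C}) (push V).
Proof.
move=> [aC gL VS gV univ]; split=> //.
- by move=> c /=; rewrite fL gL.
- by have [_ _ WS _ _] := rf; apply: subset_trans (push_sub VS) WS.
- by move=> I SI; exists (g @^-1` I) => //; apply: gV.
move=> C' k aC' kL kV; have [h [hL hf hV hu]] := push_factor aC' kL VS kV.
have [h2 [h2L h2g h2u]] := univ C' h aC' hL hV.
exists h2; split=> //; first by move=> b /=; rewrite h2g hf.
move=> h' h'L h'f; apply: h2u => // b.
have h'gL : is_lhom (h' \o g : {rmorphism B' -> C'}) by move=> c /=; rewrite gL h'L.
exact: (hu (h' \o g : {rmorphism B' -> C'}) h'gL).
Qed.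

Lemma represents_of_push (C : lalg L) (g : {rmorphism B' -> C}) (k : {rmorphism B -> C}) V :
  is_lhom g -> (forall b, g (f b) = k b) -> V `<=` Sp B' ->
  represents k (push V) -> represents g V.
Proof.
move=> gL gf sV [aC kL _ kV univ]; split=> //.
  move=> I SI; apply: (push_mem sV); first exact: (maximal_pull aC gL SI).
  by rewrite (set_preimage_comp _ gf); apply: kV.
move=> C' h aC' hL hV.
have hfL : is_lhom (h \o f : {rmorphism B -> C'}) by move=> c /=; rewrite fL hL.
have [|h2 [h2L h2k h2u]] := univ C' (h \o f : {rmorphism B -> C'}) aC' hfL.
  by move=> I SI; exists (h @^-1` I) => //; apply: hV.
exists h2; split=> //; last first.
  by move=> h' h'L h'g; apply: h2u => // b; rewrite -gf h'g.
have h2gL : is_lhom (h2 \o g : {rmorphism B' -> C'}) by move=> c /=; rewrite gL h2L.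
have [_ _ _ _ univf] := rf.
have [|u [_ _ uu]] := univf C' (h \o f : {rmorphism B -> C'}) aC' hfL.
  by move=> I SI; exact: (fW (maximal_pull aC' hL SI)).
move=> b; rewrite (uu h hL) // -[h2 (g b)]/((h2 \o g : {rmorphism B' -> C'}) b) uu //.
by move=> a /=; rewrite gf h2k.
Qed.

Lemma subdomain_push V : V `<=` Sp B' ->
  is_affinoid_subdomain V <-> is_affinoid_subdomain (push V).
Proof.
move=> sV; split=> [[C [g hg]]|[C [k hk]]].
  by exists C, (g \o f : {rmorphism B -> C}); apply: represents_push.
have [aC kL _ kV _] := hk.
have [h [hL hf hV hu]] := push_factor aC kL sV kV.
by exists C, h; apply: represents_of_push hk.
Qed.

(** By [push_factor], affinoid morphisms into [push V] are those into [V], so both conditions test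
    the same refinements. *)
Lemma refines_push V (F : set (set (set B'))) : V `<=` Sp B' -> (forall U, F U -> U `<=` Sp B') ->
  finitely_refines V F <-> finitely_refines (push V) (push @` F).
Proof.
move=> sV sF; split=> h C g aC gL gV.
  have [k [kL kf kV _]] := push_factor aC gL sV gV.
  have [n [Z [Z1 Z2 Z3]]] := h C k aC kL kV; exists n, Z; split=> // i.
  have [U FU hU] := Z3 i; exists (push U); first by exists U.
  by move=> I /hU; rewrite -(set_preimage_comp _ kf) => ?; exists (k @^-1` I).
have [||n [Z [Z1 Z2 Z3]]] := h C (g \o f : {rmorphism B -> C}) aC.
- by move=> c /=; rewrite fL gL.
- by move=> I SI; exists (g @^-1` I) => //; apply: gV.
exists n, Z; split=> // i; have [_ [U FU <-] hU] := Z3 i; exists U => // I ZI.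
have SI : Sp C I by have [C' [g' [_ _ ZS _ _]]] := Z1 i; apply: ZS.
by apply: (push_mem (sF _ FU)); [exact: (maximal_pull aC gL SI) | exact: hU].
Qed.

Lemma push_bigcup (F : set (set (set B'))) :
  push (\bigcup_(U in F) U) = \bigcup_(U in push @` F) U.
Proof.
apply/seteqP; split=> [_ [I [U FU UI] <-]|_ [_ [U FU <-] [I UI <-]]].
  by exists (push U); [exists U | exists I].
by exists I => //; exists U.
Qed.

Lemma adm_push V : V `<=` Sp B' -> sp_adm V <-> sp_adm (push V).
Proof.
have [_ _ WS _ _] := rf.
move=> sV; split=> [[_ [F [F1 F2 F3]]]|[_ [F [F1 F2 F3]]]].
  have sF U : F U -> U `<=` Sp B' by move=> /F1 [C [g []]].
  split; first exact: subset_trans (push_sub sV) WS.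
  exists (push @` F); split.
  - by move=> _ [U FU <-]; apply/subdomain_push; [apply: sF | apply: F1].
  - by rewrite F2 push_bigcup.
  - exact/refines_push.
split=> //; have FW U : F U -> U `<=` W.
  move=> FU; apply: subset_trans (push_sub sV); rewrite F2; exact: bigcup_sup.
have eF : F = push @` (pull @` F).
  apply/seteqP; split=> [U FU|_ [_ [U FU <-] <-]].
    by exists (pull U); [exists U | rewrite push_pull //; apply: FW].
  by rewrite push_pull //; apply: FW.
exists (pull @` F); split.
- move=> _ [U FU <-]; apply/(subdomain_push (@pull_sub U)).
  by rewrite push_pull; [apply: F1 | apply: FW].
- apply: push_inj => //; first by move=> I [_ [U _ <-] []].
  by rewrite push_bigcup -eF -F2.
- apply/refines_push => //; first by move=> _ [U _ <-]; apply: pull_sub.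
  by rewrite -eF.
Qed.

Lemma cov_push V (F : set (set (set B'))) : V `<=` Sp B' -> (forall U, F U -> U `<=` Sp B') ->
  sp_cov V F <-> sp_cov (push V) (push @` F).
Proof.
move=> sV sF; split=> [[h1 h2 h3 h4]|[h1 h2 h3 h4]]; split.
- exact/adm_push.
- by move=> _ [U FU <-]; apply/adm_push; [apply: sF | apply: h2].
- by rewrite h3 push_bigcup.
- exact/refines_push.
- exact/adm_push.
- by move=> U FU; apply/adm_push; [apply: sF | apply: h2; exists U].
- apply: push_inj => //; first by move=> I [U /sF]; apply.
  by rewrite push_bigcup.
- exact/refines_push.
Qed.

End Push.
End Subdomains.

(** * Local properties on a rigid space *)

Section Site.
Variable X : gspace.
Implicit Types U V W T : aopen X.

Lemma aopen_eq U V : open_set U = open_set V -> U = V.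
Proof.
case: U V => U aU [V aV] /= e; case: _ / e aV => aV.
by congr AOpen; apply: Prop_irrelevance.
Qed.

Definition locally U (P : aopen X -> Prop) :=
  exists F, cov U F /\ forall V, F V -> P V.

Definition hereditary (P : aopen X -> Prop) := forall V W, W `<=` V -> P V -> P W.

Lemma cov_sub U F V : cov (open_set U) F -> F (open_set V) -> V `<=` U.
Proof. by move=> /cov_adm [_ _ ->] FV x Vx; exists (open_set V). Qed.

Lemma locally_id U (P : aopen X -> Prop) : P U -> locally U P.
Proof.
move=> PU; exists [set open_set U]; split; first exact/cov_id/open_adm.
by move=> V /= /aopen_eq ->.
Qed.

Lemma locally_mono U (P Q : aopen X -> Prop) :
  (forall V, V `<=` U -> P V -> Q V) -> locally U P -> locally U Q.
Proof.
move=> PQ [F [cF FP]]; exists F; split=> // V FV; apply: PQ (FP V FV).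
exact: cov_sub cF FV.
Qed.

Lemma locally_comp U (P : aopen X -> Prop) :
  locally U (fun V => locally V P) -> locally U P.
Proof.
move=> [F [cF FP]].
have /choice[G hG] (V : set X) : exists G, F V -> cov V G /\ forall W : aopen X, G W -> P W.
  have [FV|nF] := pselect (F V); last by exists set0.
  have [_ aF _] := cov_adm cF; have [G [h1 h2]] := FP (AOpen (aF V FV)) FV.
  by exists G.
exists (\bigcup_(V in F) G V); split.
  by apply: cov_comp => // V FV; case: (hG V FV).
by move=> W [V FV GW]; have [_] := hG V FV; apply.
Qed.

Lemma locally_pull U V (P : aopen X -> Prop) : V `<=` U -> locally U P ->
  locally V (fun W => exists2 W0, P W0 & W `<=` W0).
Proof.
move=> VU [F [cF FP]]; exists [set W `&` open_set V | W in F]; split.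
  exact: (cov_pull cF (open_adm V) VU).
move=> W [W0 FW0 eW]; have [_ aF _] := cov_adm cF.
by exists (AOpen (aF W0 FW0)); [apply: FP | rewrite /= -eW; exact: subIsetl].
Qed.

Lemma locally_here U V (P : aopen X -> Prop) : hereditary P -> V `<=` U ->
  locally U P -> locally V P.
Proof.
move=> hP VU /(locally_pull VU); apply: locally_mono => W _ [W0 PW0 WW0].
exact: hP PW0.
Qed.

Lemma locally_and U (P Q : aopen X -> Prop) : hereditary P -> hereditary Q ->
  locally U P -> locally U Q -> locally U (fun V => P V /\ Q V).
Proof.
move=> hP hQ lP lQ; apply: locally_comp; apply: locally_mono lP => V VU PV.
apply: locally_mono (locally_here hQ VU lQ) => W WV QW; split=> //.
exact: hP PV.
Qed.

Lemma locally_forall (I : finType) U (P : I -> aopen X -> Prop) :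
  (forall i, hereditary (P i)) -> (forall i, locally U (P i)) ->
  locally U (fun V => forall i, P i V).
Proof.
move=> hP lP; suff : locally U (fun V => forall i, i \in enum I -> P i V).
  by apply: locally_mono => V _ h i; apply: h; rewrite mem_enum.
elim: (enum I) => [|i s IH]; first exact: locally_id.
have h : hereditary (fun V => forall i, i \in s -> P i V).
  by move=> V W WV PV j js; apply: hP (PV j js).
apply: locally_mono (locally_and (hP i) h (lP i) IH) => V _ [PiV PsV] j.
by rewrite inE => /orP[/eqP ->|/PsV].
Qed.

Section SheafTheory.
Variables (S : aopen X -> Type) (res : forall U V : aopen X, V `<=` U -> S U -> S V).
Hypotheses (sh : is_sheaf res) (S0 : forall U, S U).
Hypothesis res_c : forall U V W (h : V `<=` U) (h' : W `<=` V) (h'' : W `<=` U) s,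
  res h' (res h s) = res h'' s.

Lemma sheaf_ext U x y :
  locally U (fun V => forall h : V `<=` U, res h x = res h y) -> x = y.
Proof.
move=> [F [cF Fxy]].
(* The sheaf axiom takes a family over all opens; [S0] fills in those outside [U]. *)
pose s V : S V := if pselect (V `<=` U) is left h then res h x else S0 V.
have [|t [_ tu]] := sh cF (s := s).
  move=> V W T hV hW FV FW; rewrite /s.
  case: pselect => [h|nh]; last by case: nh; apply: cov_sub cF FV.
  case: pselect => [h'|nh']; last by case: nh'; apply: cov_sub cF FW.
  have hT : T `<=` U := subset_trans hV h.
  by rewrite (res_c h hV hT) (res_c h' hW hT).
have sE V (h : V `<=` U) : s V = res h x.
  by rewrite /s; case: pselect => // h'; congr res.
by rewrite -(tu x) ?(tu y) // => V h FV; rewrite sE // Fxy.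
Qed.

(** [P] singles out the local sections. They agree wherever two of them are defined, so those picked
    by choice are compatible. *)
Lemma sheaf_glue U (P : forall V, S V -> Prop) :
  (forall V W T (hV : T `<=` V) (hW : T `<=` W) (s : S V) (s' : S W),
     V `<=` U -> W `<=` U -> P V s -> P W s' -> res hV s = res hW s') ->
  locally U (fun V => exists s, P V s) ->
  exists t : S U, locally U (fun V => forall h : V `<=` U, P V (res h t)).
Proof.
move=> Pc [F [cF FP]].
have FP' V : exists s, F (open_set V) -> P V s.
  have [FV|nF] := pselect (F (open_set V)); last by exists (S0 V) => /nF.
  by have [s hs] := FP V FV; exists s.
pose s V : S V := projT1 (cid (FP' V)).
have sP V : F (open_set V) -> P V (s V) := projT2 (cid (FP' V)).
have [|t [tP _]] := sh cF (s := s).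
  move=> V W T hV hW FV FW; apply: Pc; rewrite //;
    by [apply: cov_sub cF FV | apply: cov_sub cF FW | apply: sP].
by exists t, F; split=> // V FV h; rewrite tP //; apply: sP.
Qed.

End SheafTheory.
End Site.

(** * Affinoid opens as a basis *)

Section RigidSite.
Variables (R : realType) (L : complete_valued_field R) (X : rigid_space L).
Implicit Types U V W T : aopen X.

Lemma OX_ext U (x y : OX U) :
  locally U (fun V => forall h : V `<=` U, res h x = res h y) -> x = y.
Proof.
apply: (sheaf_ext (@OX_sheaf _ _ X) (fun V => 0 : OX V)).
by move=> *; apply: res_comp.
Qed.

Lemma OX_glue U (P : forall V, OX V -> Prop) :
  (forall V W T (hV : T `<=` V) (hW : T `<=` W) (s : OX V) (s' : OX W),
     V `<=` U -> W `<=` U -> P V s -> P W s' -> res hV s = res hW s') ->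
  locally U (fun V => exists s, P V s) ->
  exists t : OX U, locally U (fun V => forall h : V `<=` U, P V (res h t)).
Proof.
apply: (sheaf_glue (@OX_sheaf _ _ X) (fun V => 0 : OX V)).
Qed.

Lemma mod_ext (E : mod_sheaf X) U (x y : E U) :
  locally U (fun V => forall h : V `<=` U, mres h x = mres h y) -> x = y.
Proof.
apply: (sheaf_ext (@mod_is_sheaf _ _ _ E) (fun V => 0 : E V)).
by move=> *; apply: mres_comp.
Qed.

Lemma mod_glue (E : mod_sheaf X) U (P : forall V, E V -> Prop) :
  (forall V W T (hV : T `<=` V) (hW : T `<=` W) (s : E V) (s' : E W),
     V `<=` U -> W `<=` U -> P V s -> P W s' -> mres hV s = mres hW s') ->
  locally U (fun V => exists s, P V s) ->
  exists t : E U, locally U (fun V => forall h : V `<=` U, P V (mres h t)).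
Proof.
apply: (sheaf_glue (@mod_is_sheaf _ _ _ E) (fun V => 0 : E V)).
Qed.

Section InsideAffinoid.
Variables (U : aopen X) (p : X -> set (OX U)).
Hypotheses (aU : is_affinoid (OX U)) (pbij : set_bij U (Sp (OX U)) p).

Lemma aff_image_sub (V : set X) : V `<=` U -> p @` V `<=` Sp (OX U).
Proof. by move=> VU _ [x /VU Ux <-]; case: pbij => h _ _; apply: h. Qed.

Lemma aff_pre (Z : set (set (OX U))) : Z `<=` Sp (OX U) ->
  p @` [set x | open_set U x /\ Z (p x)] = Z.
Proof.
move=> ZS; apply/seteqP; split=> [_ [x [_ h] <-]//|m Zm].
case: pbij => _ _ surj; have [x Ux e] := surj _ (ZS _ Zm).
by exists x => //; rewrite /= e.
Qed.

Lemma aff_inj (V : set X) x : V `<=` U -> open_set U x -> (p @` V) (p x) -> V x.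
Proof.
move=> VU Ux [y Vy e]; case: pbij => _ inj _.
by rewrite (inj x y) ?inE //; exact: VU.
Qed.

End InsideAffinoid.

(** Through [push] along the restriction map, admissible sets, coverings and subdomains of
    [Sp (OX W)] become those of [Sp (OX U)] inside the image of [W], where they are known. *)
Lemma affinoid_open_subdomain U W (p : X -> set (OX U)) :
  is_affinoid (OX U) -> set_bij U (Sp (OX U)) p ->
  (forall V : set X, V `<=` U -> adm V <-> sp_adm (p @` V)) ->
  (forall (V : set X) (F : set (set X)), V `<=` U -> (forall W : set X, F W -> W `<=` V) ->
     cov V F <-> sp_cov (p @` V) [set p @` W | W in F]) ->
  (forall V (h : V `<=` U), is_affinoid_subdomain (p @` V) -> represents (res h) (p @` V)) ->
  W `<=` U -> is_affinoid_subdomain (p @` W) -> is_affinoid_open W.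
Proof.
move=> aU pb padm pcov prep WU subW; have rf := prep W WU subW.
pose f : {rmorphism OX U -> OX W} := res WU.
have aW : is_affinoid (OX W) by case: rf.
have pWW x : open_set W x -> (p @` W) (p x) by move=> Wx; exists x.
(* The unique point of [Sp (OX W)] above [p x], written as the union of all candidates. *)
pose pW x : set (OX W) := [set b | exists I, [/\ Sp (OX W) I, f @^-1` I = p x & I b]].
have pWE x : open_set W x -> Sp (OX W) (pW x) /\ f @^-1` (pW x) = p x.
  move=> /pWW/(represents_surj aU rf) [I SI e].
  suff -> : pW x = I by [].
  apply/seteqP; split=> b; last by exists I.
  by move=> [J [SJ eJ]]; rewrite (represents_inj aU rf SJ SI) // eJ e.
have pushE (V : set X) : V `<=` W -> push f (pW @` V) = p @` V.
  move=> VW; apply/seteqP; split=> [_ [_ [x Vx <-] <-]|_ [x Vx <-]].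
    by exists x => //; have [_ ->] := pWE x (VW _ Vx).
  by exists (pW x); [exists x | have [_ ->] := pWE x (VW _ Vx)].
have sV (V : set X) : V `<=` W -> pW @` V `<=` Sp (OX W).
  by move=> VW _ [x /VW Wx <-]; case: (pWE x Wx).
have pushF (F : set (set X)) : (forall V : set X, F V -> V `<=` W) ->
    push f @` [set pW @` V | V in F] = [set p @` V | V in F].
  move=> FW; apply/seteqP; split=> [_ [_ [V FV <-] <-]|_ [V FV <-]].
    by exists V => //; rewrite pushE //; apply: FW.
  by exists (pW @` V); [exists V | rewrite pushE //; apply: FW].
split=> //; exists pW; split.
- split.
  + by move=> x /pWE [].
  + move=> x y; rewrite !inE => Wx Wy e; case: pb => _ inj _.
    apply: inj; rewrite ?inE; [exact: (WU _ Wx)|exact: (WU _ Wy)|].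
    by have [_ <-] := pWE x Wx; have [_ <-] := pWE y Wy; rewrite e.
  + move=> I SI; have : (p @` W) (f @^-1` I) by case: rf => _ _ _ h _; apply: h.
    move=> [x Wx e]; exists x => //; have [Sx ex] := pWE x Wx.
    by apply: (represents_inj aU rf) => //; rewrite ex.
- move=> V VW; rewrite padm; last exact: (subset_trans VW WU).
  by rewrite -pushE // -(adm_push aU rf) //; apply: sV.
- move=> V F VW FV; rewrite pcov //; last exact: (subset_trans VW WU).
  have FW (W' : set X) : F W' -> W' `<=` W by move=> /FV h; apply: subset_trans VW.
  rewrite -pushE // -pushF // -(cov_push aU rf) //; first exact: sV.
  by move=> _ [W' /FW h <-]; apply: sV.
- move=> V h /(subdomain_push aU rf (sV _ h)); rewrite pushE // => sub.
  have hVU : V `<=` U := subset_trans h WU.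
  apply: (represents_of_push aU rf (k := res hVU)) (sV _ h) _.
  + exact: res_lhom.
  + by move=> b; apply: res_comp.
  + by rewrite pushE //; apply: prep.
Qed.

Lemma affinoid_open_basis U T : is_affinoid_open U -> T `<=` U -> locally T (@is_affinoid_open _ _ X).
Proof.
move=> [aU [p [pb padm pcov prep]]] TU.
have := open_adm T; rewrite padm // => -[_ [F [F1 F2 F3]]].
have FS Z : F Z -> Z `<=` Sp (OX U) by move=> /F1 [C [g []]].
pose pre (Z : set (set (OX U))) := [set x | open_set U x /\ Z (p x)].
have preE Z : F Z -> p @` pre Z = Z by move=> /FS; apply: aff_pre.
have preT Z : F Z -> pre Z `<=` T.
  move=> FV x [Ux Vx]; apply: (aff_inj pb TU Ux); rewrite F2.
  by exists Z.
have preU Z : pre Z `<=` U by move=> x [].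
exists (pre @` F); split.
  apply/pcov => //; first by move=> _ [V FV <-]; apply: preT.
  have -> : [set p @` W | W in pre @` F] = F.
    apply/seteqP; split=> [_ [_ [V FV <-] <-]|V FV]; first by rewrite preE.
    by exists (pre V); [exists V | rewrite preE].
  split=> //.
  - by rewrite -padm //; exact: open_adm.
  - by move=> V /F1; apply: subdomain_adm.
move=> W [V FV eW]; apply: (affinoid_open_subdomain aU pb padm pcov prep).
  by rewrite -eW.
by rewrite -eW preE //; apply: F1.
Qed.

Lemma affinoid_basis T : locally T (@is_affinoid_open _ _ X).
Proof.
have [F [cF FA]] := rs_affinoid_cover X.
have : locally (whole X) (@is_affinoid_open _ _ X) by exists F.
move=> /(locally_pull (V := T)) h; apply: locally_comp.
apply: locally_mono (h _) => [V _ [W aW VW]|//].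
exact: affinoid_open_basis aW VW.
Qed.

Lemma locally_affinoid U (P : aopen X -> Prop) : hereditary P -> locally U P ->
  locally U (fun V => is_affinoid_open V /\ P V).
Proof.
move=> hP lP; apply: locally_comp; apply: locally_mono lP => V _ PV.
apply: locally_mono (affinoid_basis V) => W WV aW; split=> //.
exact: hP PV.
Qed.

(** The finitely many subdomains [Z i] given by [finitely_refines] need not belong to the cover, but
    each lies in some [V i], so vanishing on the [V i] gives vanishing on the [Z i]. Later this
    yields uniform bounds on degrees and exponents. *)
Lemma affinoid_open_finite U (P : aopen X -> Prop) : is_affinoid_open U -> locally U P ->
  exists (n : nat) (V : 'I_n -> aopen X), (forall i, V i `<=` U /\ P (V i)) /\
    forall x : OX U, (forall i (h : V i `<=` U), res h x = 0) -> x = 0.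
Proof.
move=> [aU [p [pb padm pcov prep]]] [F [cF FP]].
have [_ aF UF] := cov_adm cF.
have FU (W : set X) : F W -> W `<=` U by move=> FW x Wx; rewrite UF; exists W.
have [_ _ _ fr] := (pcov _ _ (fun x h => h) FU).1 cF.
have pU : p @` U = Sp (OX U).
  apply/seteqP; split; first exact: (aff_image_sub pb).
  by move=> m; case: pb => _ _ surj /surj [x Ux <-]; exists x.
have [|n [Z [Z1 Z2 Z3]]] := fr (OX U) idfun aU (fun c => erefl).
  by move=> I SI; rewrite pU.
have /choice[V hV] i : exists V : aopen X, F V /\ Z i `<=` p @` V.
  have [_ [W FW <-] ZW] := Z3 i; exists (AOpen (aF W FW)); split=> //.
exists n, V; split.
  by move=> i; have [FV _] := hV i; split; [apply: FU | apply: FP].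
move=> x hx; apply: (represents_separate aU) => m Sm.
have [i Zm] := Z2 m Sm; have [FV ZV] := hV i.
have ZS : Z i `<=` Sp (OX U) by have [C [g []]] := Z1 i.
pose W0 : set X := [set y | open_set U y /\ Z i (p y)].
have W0U : W0 `<=` U by move=> y [].
have W0E : p @` W0 = Z i by apply: aff_pre.
have aW0 : adm W0 by rewrite padm // W0E; apply: subdomain_adm.
have VU := FU _ FV.
have W0V : AOpen aW0 `<=` V i.
  by move=> y [Uy Zy]; apply: (aff_inj pb VU Uy); apply: ZV.
pose W := AOpen aW0; have hW : W `<=` U := W0U.
exists (OX W), (res hW), (Z i); split=> //.
  by rewrite -W0E; apply: prep; rewrite /= W0E.
by rewrite -(res_comp VU W0V) hx rmorph0.
Qed.

End RigidSite.

(** * Twisted power series *)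

(** Stated for commuting elements because it is also applied to a scalar matrix and a nilpotent
    one. *)
Lemma comm_exprD_prime (R : pzRingType) (p : nat) (x y : R) : prime p ->
  p%:R = 0 :> R -> GRing.comm x y -> (x + y) ^+ p = x ^+ p + y ^+ p.
Proof.
case: p => // p pp p0 cxy; rewrite exprDn_comm // big_ord_recl big_ord_recr /= subn0.
rewrite /bump /= add1n subnn bin0 binn !mulr1n !expr0 mulr1 mul1r big1 ?add0r //.
move=> i _; rewrite /bump /= add1n -mulr_natr.
have /dvdnP[k ->] : (p.+1 %| 'C(p.+1, i.+1))%N.
  by apply: prime_dvd_bin; rewrite //= !ltnS ltn_ord.
by rewrite natrM p0 mulr0 mulr0.
Qed.

Lemma comm_exprD_primeX (R : pzRingType) (p s : nat) (x y : R) : prime p ->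
  p%:R = 0 :> R -> GRing.comm x y -> (x + y) ^+ (p ^ s) = x ^+ (p ^ s) + y ^+ (p ^ s).
Proof.
move=> pp p0 cxy; elim: s => [|s IH]; first by rewrite expn0 !expr1.
rewrite expnSr !exprM IH; apply: comm_exprD_prime => //.
by apply: commrX; apply: commr_sym; apply: commrX; apply: commr_sym.
Qed.

Section Twisted.
Variables (R : realType) (L : complete_valued_field R) (q : nat).
Hypothesis q1 : (1 < q)%N.

Definition frobenius_additive (B : lalg L) := forall x y : B, (x + y) ^+ q = x ^+ q + y ^+ q.

Section Algebra.
Variables (B : lalg L) (HF : frobenius_additive B).

Definition fpow j (x : B) := x ^+ (q ^ j).

Lemma fpow_zmod j : zmod_morphism (fpow j).
Proof.
have D i x y : fpow i (x + y) = fpow i x + fpow i y.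
  by rewrite /fpow; elim: i => [|i IH]; rewrite ?expn0 ?expr1 // expnSr !exprM IH HF.
have N : fpow j 0 = 0 by rewrite /fpow expr0n expn_eq0 gtn_eqF // ltnW.
move=> x y; apply: (addIr (fpow j y)).
by rewrite -D !subrK.
Qed.
Lemma fpow_monoid j : monoid_morphism (fpow j).
Proof. by rewrite /fpow; split=> [|x y]; [exact: expr1n | exact: exprMn]. Qed.

Definition frobm j : {rmorphism B -> B} :=
  HB.pack (fpow j) (GRing.isZmodMorphism.Build _ _ (fpow j) (fpow_zmod j))
    (GRing.isMonoidMorphism.Build _ _ (fpow j) (fpow_monoid j)).

Definition twist j m n (M : 'M[B]_(m, n)) : 'M[B]_(m, n) := map_mx (fpow j) M.

Lemma twistE j m n (M : 'M[B]_(m, n)) : twist j M = map_mx (frobm j) M.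
Proof. by []. Qed.
Lemma twistM j m n r (M : 'M[B]_(m, n)) (N : 'M[B]_(n, r)) :
  twist j (M *m N) = twist j M *m twist j N.
Proof. by rewrite !twistE map_mxM. Qed.
Lemma twistD j m n (M N : 'M[B]_(m, n)) : twist j (M + N) = twist j M + twist j N.
Proof. by rewrite !twistE map_mxD. Qed.
Lemma twistB j m n (M N : 'M[B]_(m, n)) : twist j (M - N) = twist j M - twist j N.
Proof. by rewrite !twistE map_mxB. Qed.
Lemma twist0 j m n : twist j (0 : 'M[B]_(m, n)) = 0.
Proof. by rewrite !twistE map_mx0. Qed.
Lemma twist_sum j m n (I : Type) (r : seq I) (P : pred I) (F : I -> 'M[B]_(m, n)) :
  twist j (\sum_(i <- r | P i) F i) = \sum_(i <- r | P i) twist j (F i).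
Proof. by elim/big_rec2: _ => [|i x y _ <-]; [exact: twist0 | exact: twistD]. Qed.
Lemma twistZ j m n b (M : 'M[B]_(m, n)) : twist j (b *: M) = fpow j b *: twist j M.
Proof. by rewrite !twistE map_mxZ. Qed.
Lemma twist_scalar j n b : twist j (b%:M : 'M[B]_n) = (fpow j b)%:M.
Proof. by rewrite !twistE map_scalar_mx. Qed.
Lemma twist_twist i j m n (M : 'M[B]_(m, n)) : twist i (twist j M) = twist (i + j) M.
Proof. by apply/matrixP => a b; rewrite !mxE /fpow -exprM -expnD addnC. Qed.
Lemma twist_id m n (M : 'M[B]_(m, n)) : twist 0 M = M.
Proof. by apply/matrixP => a b; rewrite !mxE /fpow expn0 expr1. Qed.

(* Composition of twisted power series sum_j e_j sigma^j. *)
Definition tconv a b c (e : nat -> 'M[B]_(a, b)) (f : nat -> 'M[B]_(b, c)) n :=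
  \sum_(i < n.+1) e i *m twist i (f (n - i)%N).

Definition tcst a b (M : 'M[B]_(a, b)) (n : nat) := if n is 0 then M else 0.

Lemma tconvA a b c d (e : nat -> 'M[B]_(a, b)) (f : nat -> 'M[B]_(b, c)) (g : nat -> 'M[B]_(c, d)) :
  tconv e (tconv f g) = tconv (tconv e f) g.
Proof.
apply/funext => n; rewrite /tconv.
pose F j k := e j *m twist j (f k) *m twist (j + k) (g (n - (j + k))%N).
transitivity (\sum_(j < n.+1) \sum_(k < (n - j).+1) F j k).
  apply: eq_bigr => j _; rewrite twist_sum mulmx_sumr; apply: eq_bigr => k _.
  by rewrite /F twistM twist_twist mulmxA subnDA.
rewrite -triangle_sum; apply: eq_bigr => i _; rewrite mulmx_suml.
by apply: eq_bigr => j _; rewrite /F subnKC // -ltnS.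
Qed.

Lemma tconvBl a b c (e e' : nat -> 'M[B]_(a, b)) (f : nat -> 'M[B]_(b, c)) :
  tconv (fun j => e j - e' j) f = fun n => tconv e f n - tconv e' f n.
Proof. by apply/funext => n; rewrite -sumrB; apply: eq_bigr => i _; rewrite mulmxBl. Qed.

Lemma tconvBr a b c (e : nat -> 'M[B]_(a, b)) (f f' : nat -> 'M[B]_(b, c)) :
  tconv e (fun j => f j - f' j) = fun n => tconv e f n - tconv e f' n.
Proof.
by apply/funext => n; rewrite -sumrB; apply: eq_bigr => i _; rewrite twistB mulmxBr.
Qed.

Lemma tconv_tcstr a b c (e : nat -> 'M[B]_(a, b)) (M : 'M[B]_(b, c)) n :
  tconv e (tcst M) n = e n *m twist n M.
Proof.
rewrite /tconv big_ord_recr /= subnn big1 ?add0r // => i _.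
rewrite /tcst -(subnSK (ltn_ord i)) /=.
by rewrite twist0 mulmx0.
Qed.

Lemma tconv_tcstl a b c (M : 'M[B]_(a, b)) (e : nat -> 'M[B]_(b, c)) n :
  tconv (tcst M) e n = M *m e n.
Proof.
rewrite /tconv big_ord_recl /= subn0 twist_id big1 ?addr0 // => i _.
by rewrite mul0mx.
Qed.

(** The functional equation [exp phi' = phi exp] on coefficients, [P 0] being the matrix of the
    differential. *)
Definition intertwines d (e P : nat -> 'M[B]_d) := tconv e (tcst (P 0%N)) = tconv P e.

Section Recursion.
Variables (d : nat) (t : L).
Hypothesis t1 : 1 < cvf_abs t.

(** The factor in front of [e n] in the recursion: moving the scalar [t] across [sigma^n] turns it
    into [t^(q^n)]. *)
Definition gap n : L := t ^+ (q ^ n) - t.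

(** Since [|t| > 1], the power strictly dominates and the ultrametric inequality becomes an
    equality. *)
Lemma gap_abs n : (0 < n)%N -> cvf_abs (gap n) = cvf_abs t ^+ (q ^ n).
Proof.
move=> n0; have t0 : 0 <= cvf_abs t by apply: cvf_abs_ge0.
have qn : (1 < q ^ n)%N by rewrite -{1}(exp1n n) ltn_exp2r.
have lt : cvf_abs t < cvf_abs (t ^+ (q ^ n)).
  by rewrite cvf_absX -[ltLHS]expr1 ltr_eXn2l.
apply/eqP; rewrite -cvf_absX eq_le; apply/andP; split.
  apply: (nuB_le (base_norm L)) => //; exact: ltW.
rewrite leNgt; apply/negP => h.
have : cvf_abs (gap n + t) < cvf_abs (t ^+ (q ^ n)) by apply: (nuD_lt (base_norm L)).
by rewrite /gap subrK ltxx.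
Qed.

Lemma gap_neq0 n : (0 < n)%N -> gap n != 0.
Proof.
move=> n0; apply/eqP => e; have := gap_abs n0; rewrite e cvf_abs0 => /esym/eqP.
by rewrite expf_eq0 => /andP[_ /eqP t0]; move: t1; rewrite t0 ltr10.
Qed.

Variable P : nat -> 'M[B]_d.
Hypothesis P0 : P 0%N = (la_str B t)%:M.

Lemma intertwinesP e : intertwines e P <-> forall n,
  la_str B (gap n) *: e n = \sum_(i < n) P i.+1 *m twist i.+1 (e (n - i.+1)%N).
Proof.
have E n : tconv e (tcst (P 0%N)) n - tconv P e n
    = la_str B (gap n) *: e n - \sum_(i < n) P i.+1 *m twist i.+1 (e (n - i.+1)%N).
  rewrite tconv_tcstr P0 twist_scalar mul_mx_scalar /tconv big_ord_recl subn0 twist_id P0.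
  rewrite mul_scalar_mx opprD addrA /fpow -rmorphXn -scalerBl -rmorphB.
  by congr (_ - _); apply: eq_bigr => i _.
split=> [h n|h]; first by apply/eqP; rewrite -subr_eq0 -E h subrr.
by apply/funext => n; apply/eqP; rewrite -subr_eq0 E h subrr.
Qed.

Lemma la_strK (c : L) n r (M : 'M[B]_(n, r)) : c != 0 ->
  la_str B c^-1 *: (la_str B c *: M) = M.
Proof. by move=> c0; rewrite scalerA -rmorphM mulVf // rmorph1 scale1r. Qed.

Lemma intertwines_zero e : e 0%N = 0 -> intertwines e P -> forall n, e n = 0.
Proof.
move=> e0 /intertwinesP h n; elim: n {-2}n (leqnn n) => [|N IH] [|n] nN //.
rewrite -(la_strK (e n.+1) (gap_neq0 (ltn0Sn n))) h big1 ?scaler0 // => i _.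
by rewrite IH ?twist0 ?mulmx0 // subSS; apply: leq_trans (leq_subr _ _) _.
Qed.

Lemma intertwines_uniq e e' : e 0%N = e' 0%N -> intertwines e P -> intertwines e' P ->
  forall n, e n = e' n.
Proof.
move=> e0 h h' n; apply/eqP; rewrite -subr_eq0; apply/eqP.
apply: (intertwines_zero (e := fun n => e n - e' n)); first by rewrite e0 subrr.
by rewrite /intertwines tconvBl tconvBr h h'.
Qed.

(** The difference [e Q_0 - Q e] again intertwines [P], because [P_0] is scalar and [P] commutes
    with [Q]. Its constant term is 0, so it vanishes. *)
Lemma intertwines_commute e Q : e 0%N = 1%:M -> intertwines e P ->
  tconv P Q = tconv Q P -> intertwines e Q.
Proof.
move=> e0 h PQ; pose f n := tconv e (tcst (Q 0%N)) n - tconv Q e n.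
suff f0 : forall n, f n = 0.
  by apply/funext => n; apply/eqP; rewrite -subr_eq0; apply/eqP/f0.
apply: intertwines_zero.
  by rewrite /f tconv_tcstr /tconv big_ord1 subn0 !twist_id e0 mul1mx mulmx1 subrr.
rewrite /intertwines /f tconvBl tconvBr; apply/funext => n.
rewrite (_ : tconv (tconv e (tcst (Q 0%N))) (tcst (P 0%N)) = tconv P (tconv e (tcst (Q 0%N)))); last first.
  rewrite tconvA -h -!tconvA; congr (tconv e _); apply/funext => m.
  by rewrite !tconv_tcstl P0; case: m => [|m] /=; rewrite ?mulmx0 // scalar_mxC.
by congr (_ - _); rewrite -tconvA h !tconvA PQ.
Qed.

(** Course-of-values recursion: the [n]-th table is final at indices up to [n]. *)
Fixpoint rec_upto n : nat -> 'M[B]_d :=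
  match n with
  | 0 => fun=> 1%:M
  | m.+1 => fun k => if (k <= m)%N then rec_upto m k else
     la_str B (gap m.+1)^-1 *: \sum_(i < m.+1) P i.+1 *m twist i.+1 (rec_upto m (m - i)%N)
  end.

Definition exp_coef n := rec_upto n n.

Lemma rec_uptoE n k : (k <= n)%N -> rec_upto n k = exp_coef k.
Proof.
elim: n => [|n IH]; first by rewrite leqn0 => /eqP ->.
rewrite leq_eqVlt => /orP[/eqP -> //|]; rewrite ltnS => kn.
by rewrite /= kn IH.
Qed.

Lemma exp_coef_intertwines : intertwines exp_coef P.
Proof.
apply/intertwinesP => -[|n].
  by rewrite big_ord0 /gap expn0 expr1 subrr rmorph0 scale0r.
rewrite {1}/exp_coef /= ltnn scalerA -rmorphM mulfV ?gap_neq0 // rmorph1 scale1r.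
by apply: eq_bigr => i _; rewrite subSS rec_uptoE // leq_subr.
Qed.

End Recursion.
End Algebra.

(** * Growth of the coefficients *)

Section MxNorm.
Variables (B : lalg L) (nu : B -> R) (H : complete_norm nu).

Lemma mxnorm_ge0 m n (M : 'M[B]_(m, n)) : 0 <= mxnorm nu M.
Proof. exact: bigmax_ge_id. Qed.

Lemma mxnorm_ge m n (M : 'M[B]_(m, n)) i j : nu (M i j) <= mxnorm nu M.
Proof.
apply: le_trans (le_bigmax 0 (fun i => \big[Num.max/0]_j nu (M i j)) i).
exact: (le_bigmax 0 (fun j => nu (M i j)) j).
Qed.

Lemma mxnorm_le m n (M : 'M[B]_(m, n)) e : 0 <= e -> (forall i j, nu (M i j) <= e) ->
  mxnorm nu M <= e.
Proof. by move=> e0 h; apply: bigmax_le => // i _; apply: bigmax_le. Qed.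

Lemma mxnorm_mul m n r (M : 'M[B]_(m, n)) (N : 'M[B]_(n, r)) :
  mxnorm nu (M *m N) <= mxnorm nu M * mxnorm nu N.
Proof.
have p0 : 0 <= mxnorm nu M * mxnorm nu N by rewrite mulr_ge0 ?mxnorm_ge0.
apply: mxnorm_le => // i j; rewrite mxE; apply: (nu_sum_le H) => // k _.
apply: le_trans (nuM_le H _ _) _.
by apply: ler_pM; rewrite ?(nu_ge0 H) ?mxnorm_ge.
Qed.

Lemma mxnorm_sum m n (I : Type) (r : seq I) (P : pred I) (F : I -> 'M[B]_(m, n)) e : 0 <= e ->
  (forall i, P i -> mxnorm nu (F i) <= e) -> mxnorm nu (\sum_(i <- r | P i) F i) <= e.
Proof.
move=> e0 h; apply: mxnorm_le => // a b; rewrite summxE; apply: (nu_sum_le H) => // i Pi.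
by apply: le_trans (h i Pi); apply: mxnorm_ge.
Qed.

Lemma mxnormZ m n c (M : 'M[B]_(m, n)) : mxnorm nu (la_str B c *: M) <= cvf_abs c * mxnorm nu M.
Proof.
apply: mxnorm_le => [|i j]; first by rewrite mulr_ge0 ?cvf_abs_ge0 ?mxnorm_ge0.
by rewrite mxE (nuZ H) ler_wpM2l ?cvf_abs_ge0 ?mxnorm_ge.
Qed.

Lemma mxnorm_twist j m n (M : 'M[B]_(m, n)) : mxnorm nu (twist j M) <= mxnorm nu M ^+ (q ^ j).
Proof.
apply: mxnorm_le => [|a b]; first by rewrite exprn_ge0 ?mxnorm_ge0.
rewrite mxE; apply: le_trans (nuX_le H _ _) _.
by apply: lerXn2r; rewrite ?nnegrE ?(nu_ge0 H) ?mxnorm_ge0 ?mxnorm_ge.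
Qed.

(** The exponentiated form of [q^-j log |e j| -> -oo], in which zero matrices cause no exception. *)
Definition entire a b (e : nat -> 'M[B]_(a, b)) := forall s : R, 0 < s ->
  exists J, forall j, (J <= j)%N -> mxnorm nu (e j) <= s ^+ (q ^ j).

Lemma ltn_expq j : (j < q ^ j)%N. Proof. exact: ltn_expl. Qed.

Lemma power_large (s C : R) : 1 < s -> exists J, forall j, (J <= j)%N -> C <= s ^+ (q ^ j).
Proof.
move=> s1; have s0 : 0 < s by apply: lt_trans s1.
have C0 : 0 < `|C| + 1 by rewrite ltr_wpDl.
have h : 0 <= s^-1 < 1 by rewrite invr_ge0 (ltW s0) /= invf_lt1.
have [J hJ] := geometric_small h (ltW C0) ltr01; exists J => j Jj.
have := hJ (q ^ j)%N (leq_trans Jj (ltnW (ltn_expq j))).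
rewrite exprVn mulrC ltr_pdivrMr ?exprn_gt0 // mul1r => /ltW; apply: le_trans.
by apply: le_trans (ler_norm C) _; rewrite lerDl.
Qed.

(** The recursion bounds [e j] through its [N] predecessors and gains a factor [r^-(q^j)],
    [r = |t|], at the cost of a constant [C]. Starting from a bound [T^(q^j)], repetition lowers the
    base indefinitely. *)
Lemma exp_coef_entire (HF : frobenius_additive B) d (t : L) (P : nat -> 'M[B]_d) N e :
  1 < cvf_abs t -> P 0%N = (la_str B t)%:M -> (forall j, (N < j)%N -> P j = 0) ->
  intertwines e P -> entire e.
Proof.
move=> t1 P0 PN /(intertwinesP HF P0) he.
set r := cvf_abs t in t1; have r0 : 0 < r by apply: lt_trans t1.
pose C := 1 + \sum_(i < N.+1) mxnorm nu (P i).
have C1 : 1 <= C by rewrite lerDl sumr_ge0 // => i _; apply: mxnorm_ge0.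
have C0 : 0 < C by apply: lt_le_trans C1.
have PC i : mxnorm nu (P i) <= C.
  have [h|h] := ltnP N i.
    by rewrite PN //; apply: mxnorm_le => [|a b]; rewrite ?mxE ?(nu0 H) ltW.
  have h' : (i < N.+1)%N by [].
  rewrite /C (bigD1 (Ordinal h')) //= addrCA lerDl addr_ge0 //.
  by apply: sumr_ge0 => j _; apply: mxnorm_ge0.
have step j (T : R) : 0 < T -> (0 < j)%N ->
    (forall i, (i < j)%N -> (j <= i + N)%N -> mxnorm nu (e i) <= T ^+ (q ^ i)) ->
    mxnorm nu (e j) <= C * (T / r) ^+ (q ^ j).
  move=> T0 j0 hT; rewrite -[e j](la_strK _ (gap_neq0 t1 j0)) he.
  apply: le_trans (mxnormZ _ _) _; rewrite cvf_absV gap_abs // -/r exprMn exprVn.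
  rewrite mulrA mulrC ler_wpM2r ?invr_ge0 ?exprn_ge0 ?(ltW r0) //.
  have CT0 : 0 <= C * T ^+ (q ^ j) by rewrite mulr_ge0 ?exprn_ge0 ?ltW.
  apply: mxnorm_sum => // i _; have ij := ltn_ord i.
  have [h|h] := ltnP N i.+1.
    by rewrite PN // mul0mx; apply: mxnorm_le => // a b; rewrite mxE (nu0 H).
  apply: le_trans (mxnorm_mul _ _) _; apply: ler_pM; rewrite ?mxnorm_ge0 //.
  apply: le_trans (mxnorm_twist _ _) _.
  rewrite -[in leRHS](subnK ij) expnD exprM.
  apply: lerXn2r; rewrite ?nnegrE ?mxnorm_ge0 ?exprn_ge0 ?(ltW T0) //.
  by apply: hT; lia.
(* From [j1] on the gain absorbs [C]; [T] bounds the terms up to [j1], and the recursion carries the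
   bound [T^(q^j)] to all others. *)
have [j1 hj1] := power_large C t1.
pose T := 1 + \sum_(i < j1.+1) mxnorm nu (e i).
have T1 : 1 <= T by rewrite lerDl sumr_ge0 // => i _; apply: mxnorm_ge0.
have T0 : 0 < T by apply: lt_le_trans T1.
have A j : mxnorm nu (e j) <= T ^+ (q ^ j).
  elim: j {-2}j (leqnn j) => [|n IH] j jn; have [h|h] := ltnP j j1.+1.
  - apply: (@le_trans _ _ T); last first.
      by rewrite -[leLHS]expr1 ler_weXn2l // expn_gt0 ltnW.
    rewrite /T (bigD1 (Ordinal h)) //= addrCA lerDl addr_ge0 //.
    by apply: sumr_ge0 => k _; apply: mxnorm_ge0.
  - by move: h; rewrite leqn0 in jn; rewrite (eqP jn).
  - apply: (@le_trans _ _ T); last first.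
      by rewrite -[leLHS]expr1 ler_weXn2l // expn_gt0 ltnW.
    rewrite /T (bigD1 (Ordinal h)) //= addrCA lerDl addr_ge0 //.
    by apply: sumr_ge0 => k _; apply: mxnorm_ge0.
  - have j0 : (0 < j)%N by apply: leq_trans h.
    apply: (le_trans (step j T T0 j0 _)).
      by move=> i ij _; apply: IH; rewrite -ltnS (leq_trans ij).
    rewrite exprMn exprVn mulrCA -[leRHS]mulr1 ler_wpM2l ?exprn_ge0 ?(ltW T0) //.
    by rewrite ler_pdivrMr ?exprn_gt0 // mul1r; apply: hj1; apply: ltnW.
(* The gain is split in two: one factor [s] absorbs [C], the other improves the base at each
   round. *)
pose s := Num.sqrt r.
have s1 : 1 < s by rewrite -sqrtr1 ltr_sqrt.
have s0 : 0 < s by apply: lt_trans s1.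
have ss : r = s * s by rewrite -expr2 sqr_sqrtr // ltW.
have Bk k : exists J, forall j, (J <= j)%N -> mxnorm nu (e j) <= (T / s ^+ k) ^+ (q ^ j).
  elim: k => [|k [J hJ]]; first by exists 0%N => j _; rewrite expr0 divr1.
  have [j2 hj2] := power_large C s1; exists (J + N + j2).+1 => j hj.
  have Tk0 : 0 < T / s ^+ k by rewrite divr_gt0 // exprn_gt0.
  have j0 : (0 < j)%N by apply: leq_trans hj.
  apply: (le_trans (step j _ Tk0 j0 _)); first by move=> i ij jiN; apply: hJ; lia.
  have -> : T / s ^+ k / r = (T / s ^+ k.+1) / s.
    by rewrite ss exprS !invfM; ring.
  rewrite exprMn exprVn mulrCA -[leRHS]mulr1 ler_wpM2l ?exprn_ge0 ?divr_ge0 ?exprn_ge0 ?(ltW T0) ?(ltW s0) //.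
  rewrite ler_pdivrMr ?exprn_gt0 // mul1r; apply: hj2; lia.
move=> u u0; have h : 0 <= s^-1 < 1 by rewrite invr_ge0 (ltW s0) /= invf_lt1.
have [k hk] := geometric_small h (ltW T0) u0.
have [J hJ] := Bk k; exists J => j /hJ /le_trans; apply.
apply: lerXn2r; rewrite ?nnegrE ?divr_ge0 ?exprn_ge0 ?(ltW T0) ?(ltW s0) ?(ltW u0) //.
by have := hk k (leqnn k); rewrite exprVn mulrC => /ltW.
Qed.

End MxNorm.
End Twisted.

(** * Values of twisted series *)

Section Evaluation.
Variables (R : realType) (L : complete_valued_field R) (q : nat).
Hypotheses (q1 : (1 < q)%N) (HF : forall B : lalg L, frobenius_additive q B).

Section OneAlgebra.
Variable B : lalg L.

Definition evalS a b c (e : nat -> 'M[B]_(a, b)) (z : 'M[B]_(b, c)) n :=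
  \sum_(j < n) e j *m twist q j z.

(** An exact identity of partial sums, the inner ones stopping at [n - i]; since [P] is a
    polynomial, the limit can then be taken term by term. *)
Lemma evalS_tconv a b c r (P : nat -> 'M[B]_(a, b)) (e : nat -> 'M[B]_(b, c)) (z : 'M[B]_(c, r)) N n :
  (forall j, (N < j)%N -> P j = 0) ->
  evalS (tconv q P e) z n = \sum_(i < N.+1) P i *m twist q i (evalS e z (n - i)).
Proof.
move=> PN; pose F i := P i *m twist q i (evalS e z (n - i)).
have F0 i : (n <= i)%N -> F i = 0.
  by rewrite /F -subn_eq0 => /eqP ->; rewrite /evalS big_ord0 (twist0 q1 (@HF B)) mulmx0.
have FN i : (N < i)%N -> F i = 0 by move=> /PN e0; rewrite /F e0 mul0mx.
have W m : (forall i, (m <= i)%N -> F i = 0) -> forall M, (m <= M)%N ->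
    \sum_(i < M) F i = \sum_(i < m) F i.
  move=> h M mM; rewrite -(subnKC mM) big_split_ord /= [X in _ + X]big1 ?addr0 // => i _.
  by rewrite h // leq_addr.
rewrite -[RHS](W _ FN (n + N.+1)%N (leq_addl _ _)) (W _ F0 _ (leq_addr _ _)).
rewrite /F; case: n {F F0 FN W} => [|n]; first by rewrite /evalS !big_ord0.
pose G i k := P i *m twist q i (e k) *m twist q (i + k) z.
transitivity (\sum_(i < n.+1) \sum_(k < (n - i).+1) G i k).
  rewrite -triangle_sum; apply: eq_bigr => i _; rewrite mulmx_suml.
  by apply: eq_bigr => j _; rewrite /G subnKC // -ltnS.
apply: eq_bigr => i _; rewrite subSn -1?ltnS // (twist_sum q1 (@HF B)) mulmx_sumr.
by apply: eq_bigr => k _; rewrite (twistM q1 (@HF B)) twist_twist mulmxA.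
Qed.

Lemma evalS_tcst a b c r (e : nat -> 'M[B]_(a, b)) (M : 'M[B]_(b, c)) (z : 'M[B]_(c, r)) n :
  evalS (tconv q e (tcst M)) z n = evalS e (M *m z) n.
Proof.
by apply: eq_bigr => j _; rewrite (tconv_tcstr q1 (@HF B)) (twistM q1 (@HF B)) mulmxA.
Qed.

Lemma evalS_tcstl a b c r (M : 'M[B]_(a, b)) (e : nat -> 'M[B]_(b, c)) (z : 'M[B]_(c, r)) n :
  evalS (tconv q (tcst M) e) z n = M *m evalS e z n.
Proof. by rewrite mulmx_sumr; apply: eq_bigr => j _; rewrite tconv_tcstl mulmxA. Qed.

Lemma evalSD a b c (e : nat -> 'M[B]_(a, b)) (y z : 'M[B]_(b, c)) n :
  evalS e (y + z) n = evalS e y n + evalS e z n.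
Proof.
by rewrite -big_split; apply: eq_bigr => j _; rewrite (twistD q1 (@HF B)) mulmxDr.
Qed.

Lemma evalSBl a b c (e e' : nat -> 'M[B]_(a, b)) (z : 'M[B]_(b, c)) n :
  evalS (fun j => e j - e' j) z n = evalS e z n - evalS e' z n.
Proof. by rewrite -sumrB; apply: eq_bigr => j _; rewrite mulmxBl. Qed.

Lemma evalS_trunc a b c (P : nat -> 'M[B]_(a, b)) (z : 'M[B]_(b, c)) N n :
  (forall j, (N < j)%N -> P j = 0) -> (N < n)%N -> evalS P z n = evalS P z N.+1.
Proof.
move=> PN Nn; rewrite /evalS -(subnKC Nn) big_split_ord /= [X in _ + X]big1 ?addr0 // => i _.
by rewrite PN ?mul0mx // leq_addr.
Qed.

(** On scalar multiples of a basis vector, the series becomes one in the scalar alone, from which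
    the coefficients can be read off. *)
Lemma evalS_delta a b (e : nat -> 'M[B]_(a, b)) (c : L) i n :
  evalS e (la_str B c *: delta_mx i (0 : 'I_1)) n =
  \sum_(j < n) la_str B (c ^+ (q ^ j)) *: col i (e j).
Proof.
apply: eq_bigr => j _; rewrite (twistZ q1 (@HF B)) -scalemxAr /fpow -rmorphXn colE.
congr (_ *: (_ *m _)); apply/matrixP => x y; rewrite !mxE.
by case: (_ && _); rewrite /fpow ?expr1n // expr0n expn_eq0 gtn_eqF // ltnW.
Qed.

Lemma col_eq0 a b (M : 'M[B]_(a, b)) : (forall i, col i M = 0) -> M = 0.
Proof. by move=> h; apply/matrixP => i j; have /matrixP/(_ i 0) := h j; rewrite !mxE. Qed.

Section Zero.
Variable w : L.
Hypotheses (w0 : 0 < cvf_abs w) (w1 : cvf_abs w < 1).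

(** Replacing [c] by [w c] and subtracting [w^(q^n)] times the relation removes the top term and
    multiplies the others by nonzero scalars of [L]. *)
Lemma twisted_poly_zero n (V : lmodType B) (D : nat -> V) :
  (forall c : L, \sum_(j < n) la_str B (c ^+ (q ^ j)) *: D j = 0) ->
  forall j, (j < n)%N -> D j = 0.
Proof.
elim: n D => // n IH D h.
have wpow i : (i < n)%N -> w ^+ (q ^ i) - w ^+ (q ^ n) != 0.
  move=> i_n; rewrite subr_eq0; apply/eqP => /(congr1 (@cvf_abs _ L)); rewrite !cvf_absX.
  by apply/eqP; rewrite gt_eqF // ltr_iXn2l ?ltn_exp2l.
have D0 j : (j < n)%N -> D j = 0.
  move=> jn; suff : la_str B (w ^+ (q ^ j) - w ^+ (q ^ n)) *: D j = 0.
    move=> /(congr1 (fun y => la_str B (w ^+ (q ^ j) - w ^+ (q ^ n))^-1 *: y)).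
    by rewrite scaler0 scalerA -rmorphM mulVf ?wpow // rmorph1 scale1r.
  apply: (IH (fun j => la_str B (w ^+ (q ^ j) - w ^+ (q ^ n)) *: D j)) jn => c.
  have := h (w * c); rewrite big_ord_recr /= => e1.
  have := congr1 (fun y => la_str B (w ^+ (q ^ n)) *: y) (h c).
  rewrite /= scaler0 big_ord_recr /= scalerDr scalerA -rmorphM -exprMn => e2.
  have := congr2 (fun x y => x - y) e1 e2; rewrite subr0 opprD addrACA subrr addr0.
  move=> e3; rewrite -[RHS]e3 scaler_sumr -sumrB; apply: eq_bigr => i _.
  rewrite !scalerA -scalerBl -!rmorphM -rmorphB; congr (la_str B _ *: _).
  by rewrite exprMn; ring.
move=> j; rewrite ltnS leq_eqVlt => /orP[/eqP ->|/D0 //].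
have := h 1; rewrite big_ord_recr big1 /= => [|i _]; last by rewrite D0 // scaler0.
by rewrite add0r expr1n rmorph1 scale1r.
Qed.

Variables (nu : B -> R) (H : complete_norm nu).

(** Suppose [D i = 0] for [i < m]. At [c = w^k], each term beyond [D m] is at most
    [|c|^(q^m) |c| C], since [q^i > q^m]; letting [k] grow forces [D m = 0]. *)
Lemma twisted_series_zero (D : nat -> B) :
  (forall c : L, nu_lim nu (fun n => \sum_(j < n) la_str B (c ^+ (q ^ j)) * D j) 0) ->
  forall j, D j = 0.
Proof.
(* The value [c = 1] shows that the coefficients tend to 0, hence are bounded. *)
move=> h; have Dlim : nu_lim nu D 0.
  have h1 := h 1; have h2 : nu_lim nu (fun n => \sum_(j < n.+1) la_str B (1 ^+ (q ^ j)) * D j) 0.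
    by move=> e /h1 [N hN]; exists N => n Nn; apply: hN; apply: leqW.
  have := nu_limB H h2 h1; rewrite subrr; apply: nu_lim_ext => n.
  by rewrite big_ord_recr /= addrAC subrr add0r expr1n rmorph1 mul1r.
have [C C0 DC] : exists2 C, 0 <= C & forall j, nu (D j) <= C.
  have [N hN] := Dlim 1 ltr01; exists (1 + \sum_(i < N) nu (D i)).
    by rewrite addr_ge0 // sumr_ge0 // => i _; apply: (nu_ge0 H).
  move=> j; have [Nj|jN] := leqP N j.
    have := hN j Nj; rewrite subr0 => /ltW/le_trans; apply.
    by rewrite lerDl sumr_ge0 // => i _; apply: (nu_ge0 H).
  rewrite (bigD1 (Ordinal jN)) //= addrCA lerDl addr_ge0 // sumr_ge0 // => i _.
  exact: (nu_ge0 H).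
suff D0 m : (forall i, (i < m)%N -> D i = 0) -> D m = 0.
  move=> j; elim: j {-2}j (leqnn j) => [|m IH] j jm; apply: D0 => i ij.
    by move: jm ij; rewrite leqn0 => /eqP ->.
  by apply: IH; rewrite -ltnS (leq_trans ij).
move=> Dm; apply/(nu_eq0 H)/eqP; rewrite eq_le (nu_ge0 H) andbT.
apply/ler_addgt0Pl => e e0; rewrite addr0.
have [k hk] := small_power w1 C0 e0; pose c := w ^+ k.
have c0 : 0 < cvf_abs c by rewrite cvf_absX exprn_gt0.
have c1 : cvf_abs c <= 1 by rewrite cvf_absX exprn_ile1 // ltW.
have cm0 j : 0 < cvf_abs c ^+ (q ^ j) by rewrite exprn_gt0.
have em : 0 < e * cvf_abs c ^+ (q ^ m) by rewrite mulr_gt0.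
have [N hN] := h c _ em; pose n := (N + m.+1)%N.
have mn : (m < n)%N by rewrite leq_addl.
have := hN n (leq_addr _ _); rewrite subr0 (bigD1 (Ordinal mn)) //=.
set S := \sum_(_ < _ | _) _ => hS.
have hS' : nu S <= e * cvf_abs c ^+ (q ^ m).
  apply: (nu_sum_le H) => [|i im]; first exact: ltW.
  have [i_m|mi] := ltnP i m; first by rewrite Dm // mulr0 (nu0 H) ltW.
  have {}mi : (m < i)%N by rewrite ltn_neqAle mi andbT eq_sym.
  rewrite (nuZ H) cvf_absX.
  have le1 : cvf_abs c ^+ (q ^ i) <= cvf_abs c ^+ (q ^ m).+1.
    by apply: ler_wiXn2l; rewrite ?(ltW c0) ?ltn_exp2l.
  apply: le_trans (ler_pM (ltW (cm0 _)) (nu_ge0 H _) le1 (DC i)) _.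
  by rewrite exprSr -mulrA mulrC ler_wpM2r ?(ltW (cm0 _)) // ltW.
have : nu (la_str B (c ^+ (q ^ m)) * D m) <= e * cvf_abs c ^+ (q ^ m).
  by rewrite -[_ * D m](addrK S); apply: (nuB_le H) => //; apply: ltW.
by rewrite (nuZ H) cvf_absX mulrC ler_pM2r.
Qed.

End Zero.
Section Limits.
Variables (nu : B -> R) (H : complete_norm nu).

Definition mlim a b (u : nat -> 'M[B]_(a, b)) (l : 'M[B]_(a, b)) :=
  forall i j, nu_lim nu (fun n => u n i j) (l i j).

Lemma mlim_uniq a b (u : nat -> 'M[B]_(a, b)) l l' : mlim u l -> mlim u l' -> l = l'.
Proof. by move=> h h'; apply/matrixP => i j; apply: nu_lim_uniq (h i j) (h' i j). Qed.

Lemma mlim_ext a b (u v : nat -> 'M[B]_(a, b)) l : u =1 v -> mlim u l -> mlim v l.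
Proof. by move=> uv h i j; apply: nu_lim_ext (h i j) => n; rewrite uv. Qed.

Lemma mlimD a b (u v : nat -> 'M[B]_(a, b)) l m : mlim u l -> mlim v m ->
  mlim (fun n => u n + v n) (l + m).
Proof.
move=> hu hv i j; rewrite mxE; apply: nu_lim_ext (nu_limD H (hu i j) (hv i j)) => n.
by rewrite mxE.
Qed.

Lemma mlimB a b (u v : nat -> 'M[B]_(a, b)) l m : mlim u l -> mlim v m ->
  mlim (fun n => u n - v n) (l - m).
Proof.
move=> hu hv i j; rewrite !mxE; apply: nu_lim_ext (nu_limB H (hu i j) (hv i j)) => n.
by rewrite !mxE.
Qed.

Lemma mlim_mul a b c (A : 'M[B]_(a, b)) (u : nat -> 'M[B]_(b, c)) l : mlim u l ->
  mlim (fun n => A *m u n) (A *m l).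
Proof.
move=> hu i j; rewrite mxE.
apply: nu_lim_ext (nu_lim_sum H (u := fun k n => A i k * u n k j) _ _) => [n|k _].
  by rewrite mxE.
exact: nu_limMl.
Qed.

Lemma mlim_sum a b (I : Type) (r : seq I) (P : pred I) (u : I -> nat -> 'M[B]_(a, b)) l :
  (forall i, P i -> mlim (u i) (l i)) ->
  mlim (fun n => \sum_(i <- r | P i) u i n) (\sum_(i <- r | P i) l i).
Proof.
move=> h i j; rewrite summxE.
apply: nu_lim_ext (nu_lim_sum H (u := fun k n => u k n i j) _ _) => [n|k Pk].
  by rewrite summxE.
exact: h.
Qed.

Lemma mlim_sub a b (u : nat -> 'M[B]_(a, b)) l k : mlim u l -> mlim (fun n => u (n - k)%N) l.
Proof.
move=> h i j; apply: (nu_lim_shift (k := k)); apply: nu_lim_ext (h i j) => n.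
by rewrite addnK.
Qed.

(** By additivity of Frobenius, the difference of the powers is the power of the difference, no
    larger than the difference itself once that has norm below 1. *)
Lemma mlim_twist k a b (u : nat -> 'M[B]_(a, b)) l : mlim u l ->
  mlim (fun n => twist q k (u n)) (twist q k l).
Proof.
move=> h i j e e0; have m0 : 0 < Num.min e 1 by rewrite lt_min e0 ltr01.
have [N hN] := h i j _ m0; exists N => n /hN; rewrite lt_min => /andP[he h1].
rewrite !mxE -!(rmorphB (frobm q1 (@HF B) k)) /=; apply: le_lt_trans he.
apply: le_trans (nuX_le H _ _) _; rewrite -[leRHS]expr1.
by apply: ler_wiXn2l; rewrite ?(nu_ge0 H) ?ltW // expn_gt0 ltnW.
Qed.

Lemma entire_small a b (e : nat -> 'M[B]_(a, b)) (rho eps : R) : entire q nu e ->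
  0 <= rho -> 0 < eps ->
  exists J, forall j, (J <= j)%N -> mxnorm nu (e j) * rho ^+ (q ^ j) < eps.
Proof.
move=> he r0 e0; have r1 : 0 < rho + 1 by rewrite ltr_wpDl.
(* This base leaves at most [2^-(q^j)] after multiplication by [rho^(q^j)]. *)
have s0 : 0 < (2 * (rho + 1))^-1 by rewrite invr_gt0 mulr_gt0.
have [J hJ] := he _ s0.
have h2 : 0 <= (2^-1 : R) < 1 by rewrite invr_ge0 ler0n /= invf_lt1 // ltr1n.
have [K hK] := geometric_small h2 ler01 e0.
exists (J + K)%N => j hj.
have jJ : (J <= j)%N by lia.
have jK : (K <= q ^ j)%N by apply: leq_trans (ltnW (ltn_expq q1 j)); lia.
apply: le_lt_trans (hK _ jK); rewrite mulr1.
apply: (@le_trans _ _ ((2 * (rho + 1))^-1 ^+ (q ^ j) * (rho + 1) ^+ (q ^ j))).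
  apply: ler_pM; rewrite ?mxnorm_ge0 ?exprn_ge0 //; first exact: hJ.
  by apply: lerXn2r; rewrite ?nnegrE ?(ltW r1) // lerDl.
by rewrite -exprMn invfM -mulrA mulVf ?gt_eqF // mulr1.
Qed.

Lemma entire_term_small a b c (e : nat -> 'M[B]_(a, b)) (z : 'M[B]_(b, c)) eps : entire q nu e ->
  0 < eps -> exists J, forall j, (J <= j)%N -> mxnorm nu (e j *m twist q j z) < eps.
Proof.
move=> he e0; have [J hJ] := entire_small he (mxnorm_ge0 nu z) e0.
exists J => j /hJ; apply: le_lt_trans; apply: le_trans (mxnorm_mul H _ _) _.
by rewrite ler_wpM2l ?mxnorm_ge0 // mxnorm_twist.
Qed.

Lemma evalS_cvg a b c (e : nat -> 'M[B]_(a, b)) (z : 'M[B]_(b, c)) : entire q nu e ->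
  exists l, mlim (evalS e z) l.
Proof.
move=> he; have h i j : exists l, nu_lim nu (fun n => evalS e z n i j) l.
  have [|l hl] := nu_series H (u := fun k => (e k *m twist q k z) i j).
    move=> eps /(entire_term_small z he) [J hJ]; exists J => k /hJ.
    by apply: le_lt_trans; apply: mxnorm_ge.
  by exists l; apply: nu_lim_ext hl => n; rewrite /evalS summxE.
have /choice[l hl] (ij : 'I_a * 'I_c) := h ij.1 ij.2.
exists (\matrix_(i, j) l (i, j)) => i j; rewrite mxE; exact: (hl (i, j)).
Qed.

Lemma mlim_tconv a b c r (P : nat -> 'M[B]_(a, b)) (e : nat -> 'M[B]_(b, c))
    (z : 'M[B]_(c, r)) N l : (forall j, (N < j)%N -> P j = 0) -> mlim (evalS e z) l ->
  mlim (evalS (tconv q P e) z) (\sum_(i < N.+1) P i *m twist q i l).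
Proof.
move=> PN hl; apply: mlim_ext (fun n => esym (evalS_tconv e z n PN)) _.
by apply: mlim_sum => i _; apply/mlim_mul/mlim_twist/mlim_sub.
Qed.

Lemma entire_lne a (e : nat -> 'M[B]_a) : entire q nu e ->
  ((q%:R ^- j)%:E * lne (mxnorm nu (e j))%:E)%E @[j --> \oo] --> -oo%E.
Proof.
move=> he; apply/cvgeNyPle => A.
(* The base [exp A] turns the bound into [q^-j log |e j| <= A]. *)
have [J hJ] := he (expR A) (expR_gt0 A).
exists J => // j /= /hJ le.
have q0 : 0 < (q%:R ^+ j : R) by rewrite exprn_gt0 // ltr0n ltnW.
rewrite lee_pdivrMl //.
case: ifPn => [_|]; first by rewrite leNye.
rewrite -ltNge => mp; rewrite -EFinM lee_fin -[leRHS]expRK ler_ln ?posrE ?expR_gt0 //.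
by rewrite -natrX expRM_natl.
Qed.

End Limits.
End OneAlgebra.
End Evaluation.

(** * Coordinates *)

Section Coordinates.
Variables (R : realType) (L : complete_valued_field R) (X : rigid_space L).
Implicit Types U V W T : aopen X.

Section OneSheaf.
Variables (E : mod_sheaf X) (d : nat).
Implicit Types k : coords E d.

Lemma coordsS U V k : V `<=` U -> is_coords U k -> is_coords V k.
Proof.
by move=> VU [kl kr]; split=> [W WV|W T h WV]; [apply: kl | apply: kr]; apply: subset_trans VU.
Qed.

Section Coords.
Variables (U V : aopen X) (k : coords E d).
Arguments k : clear implicits.
Hypotheses (kU : is_coords U k) (VU : V `<=` U).

Lemma coordsP b x y : k V (b *: x + y) = b *: k V x + k V y.
Proof. by case: kU => h _; case: (h V VU). Qed.
Lemma coordsD x y : k V (x + y) = k V x + k V y.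
Proof. by have := coordsP 1 x y; rewrite !scale1r. Qed.
Lemma coords0 : k V 0 = 0.
Proof. by apply: (addIr (k V 0)); rewrite -coordsD !add0r. Qed.
Lemma coordsZ b x : k V (b *: x) = b *: k V x.
Proof. by rewrite -[b *: x]addr0 coordsP coords0 addr0. Qed.
Lemma coordsB x y : k V (x - y) = k V x - k V y.
Proof. by rewrite addrC -scaleN1r coordsP scaleN1r addrC. Qed.
Lemma coords_sum I (r : seq I) (P : pred I) (F : I -> E V) :
  k V (\sum_(i <- r | P i) F i) = \sum_(i <- r | P i) k V (F i).
Proof. by elim/big_rec2: _ => [|i x y _ <-]; [exact: coords0 | exact: coordsD]. Qed.
Lemma coords_inj : injective (k V).
Proof. by case: kU => h _; case: (h V VU) => /bij_inj. Qed.
Lemma coords_surj z : exists x, k V x = z.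
Proof. by case: kU => h _; case: (h V VU) => -[g _ gK] _; exists (g z). Qed.
Lemma coords_res W (h : W `<=` V) x : k W (mres h x) = map_mx (res h) (k V x).
Proof. by case: kU => _; apply. Qed.

End Coords.
End OneSheaf.

Lemma coords_change (E : mod_sheaf X) d d' U (k : coords E d) (k' : coords E d') :
  is_coords U k -> is_coords U k' -> exists G : 'M[OX U]_(d', d),
    forall V (h : V `<=` U) x, k' V x = map_mx (res h) G *m k V x.
Proof.
move=> kU k'U; have UU : U `<=` U by [].
have /choice[v hv] i := coords_surj kU UU (delta_mx i 0).
(* Column [i] holds the new coordinates of the section whose old coordinates are the [i]-th basis
   vector. *)
exists (\matrix_(a, i) k' U (v i) a 0) => V h x.
have ex : x = \sum_i k V x i 0 *: mres h (v i).
  apply: (coords_inj kU h); rewrite (coords_sum kU h).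
  apply/matrixP => a b; rewrite ord1 summxE (bigD1 a) //=.
  rewrite (coordsZ kU h) (coords_res kU UU) hv map_delta_mx !mxE !eqxx mulr1 big1 ?addr0 // => i ia.
  by rewrite (coordsZ kU h) (coords_res kU UU) hv map_delta_mx !mxE eq_sym (negbTE ia) mulr0.
rewrite {1}ex (coords_sum k'U h); apply/matrixP => a b; rewrite ord1 summxE mxE.
apply: eq_bigr => i _; rewrite (coordsZ k'U h) (coords_res k'U UU) !mxE mulrC.
by [].
Qed.

Lemma mulmx_cV_inj (B : pzRingType) a b (M N : 'M[B]_(a, b)) :
  (forall z : 'cV[B]_b, M *m z = N *m z) -> M = N.
Proof.
move=> h; apply/matrixP => i j; have /matrixP/(_ i 0) := h (delta_mx j 0).
by rewrite -!colE !mxE.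
Qed.

Lemma coords_change_inv (E : mod_sheaf X) d U (k k' : coords E d) :
  is_coords U k -> is_coords U k' -> exists G G' : 'M[OX U]_d,
    [/\ forall V (h : V `<=` U) x, k' V x = map_mx (res h) G *m k V x,
        forall V (h : V `<=` U) x, k V x = map_mx (res h) G' *m k' V x,
        G *m G' = 1%:M & G' *m G = 1%:M].
Proof.
move=> kU k'U; have [G hG] := coords_change kU k'U; have [G' hG'] := coords_change k'U kU.
have UU : U `<=` U by [].
have rid (M : 'M[OX U]_d) : map_mx (res UU) M = M.
  by apply/matrixP => a b; rewrite mxE res_id.
exists G, G'; split=> //; apply: mulmx_cV_inj => z; rewrite -mulmxA mul1mx.
  have [x <-] := coords_surj k'U UU z.
  by have := hG U UU x; rewrite (hG' U UU x) !rid => {2}->.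
have [x <-] := coords_surj kU UU z.
by have := hG' U UU x; rewrite (hG U UU x) !rid => {2}->.
Qed.

Lemma Ga_coords U : is_coords (E := Ga X) U (fun V s => const_mx (s : OX V) : 'cV_1).
Proof.
split=> [V VU|V W h VU x]; last by apply/matrixP => i j; rewrite !mxE.
split=> [|b x y]; last by apply/matrixP => i j; rewrite !mxE.
exists (fun z : 'cV_1 => z 0 0) => [s|z]; first by rewrite mxE.
by apply/matrixP => i j; rewrite !mxE !ord1.
Qed.

Variable q : nat.
Hypotheses (q1 : (1 < q)%N) (HF : forall B : lalg L, frobenius_additive q B).

Lemma map_twist (B B' : lalg L) (f : {rmorphism B -> B'}) j a b (M : 'M[B]_(a, b)) :
  map_mx f (twist q j M) = twist q j (map_mx f M).
Proof. by apply/matrixP => x y; rewrite !mxE /fpow rmorphXn. Qed.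

Lemma map_tconv (B B' : lalg L) (f : {rmorphism B -> B'}) a b c (e : nat -> 'M[B]_(a, b))
    (g : nat -> 'M[B]_(b, c)) :
  (fun n => map_mx f (tconv q e g n)) = tconv q (fun n => map_mx f (e n)) (fun n => map_mx f (g n)).
Proof.
apply/funext => n; rewrite (map_mx_sum f); apply: eq_bigr => i _.
by rewrite map_mxM map_twist.
Qed.

Lemma map_evalS (B B' : lalg L) (f : {rmorphism B -> B'}) a b c (e : nat -> 'M[B]_(a, b))
    (z : 'M[B]_(b, c)) n :
  map_mx f (evalS q e z n) = evalS q (fun j => map_mx f (e j)) (map_mx f z) n.
Proof. by rewrite (map_mx_sum f); apply: eq_bigr => i _; rewrite map_mxM map_twist. Qed.

Lemma map_tcst (B B' : lalg L) (f : {rmorphism B -> B'}) a b (M : 'M[B]_(a, b)) :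
  (fun n => map_mx f (tcst M n)) = tcst (map_mx f M).
Proof. by apply/funext => -[|n] //=; rewrite map_mx0. Qed.

Lemma map_res_comp U V W (h : V `<=` U) (h' : W `<=` V) (h'' : W `<=` U) a b (M : 'M[OX U]_(a, b)) :
  map_mx (res h') (map_mx (res h) M) = map_mx (res h'') M.
Proof. by apply/matrixP => i j; rewrite !mxE (res_comp h h' h''). Qed.

(** [is_poly_on] with coefficients extended by zero, so that polynomials compose by [tconv] and are
    compared coefficientwise whatever their degree bounds. *)
Definition polyE (E E' : mod_sheaf X) d d' U (k : coords E d) (k' : coords E' d') (f : smap E E')
    (P : nat -> 'M[OX U]_(d', d)) N :=
  (forall j, (N < j)%N -> P j = 0) /\
  forall V (h : V `<=` U) x,
    k' V (f V x) = evalS q (fun j => map_mx (res h) (P j)) (k V x) N.+1.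

Section OnePoly.
Variables (E E' : mod_sheaf X) (d d' : nat) (k : coords E d) (k' : coords E' d') (f : smap E E').
Arguments k : clear implicits.
Arguments k' : clear implicits.
Arguments f : clear implicits.

Lemma polyE_res U V (h : V `<=` U) P N :
  polyE k k' f P N -> polyE k k' f (fun j => map_mx (res h) (P j) : 'M[OX V]_(d', d)) N.
Proof.
move=> [PN Pf]; split=> [j /PN ->|W h' x]; first by rewrite map_mx0.
rewrite (Pf W (subset_trans h' h)); apply: eq_bigr => j _; congr (_ *m _).
by rewrite (map_res_comp h h' (subset_trans h' h)).
Qed.

Lemma polyE_weaken U P N M : (N <= M)%N -> @polyE E E' d d' U k k' f P N -> polyE k k' f P M.
Proof.
move=> NM [PN Pf]; split=> [j Mj|V h x]; first by rewrite PN // (leq_ltn_trans NM).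
rewrite Pf; symmetry; apply: evalS_trunc => // j /PN ->; exact: map_mx0.
Qed.

Lemma polyE_ext U (g : smap E E') P N : (forall V x, V `<=` U -> f V x = g V x) ->
  @polyE E E' d d' U k k' f P N -> polyE k k' g P N.
Proof. by move=> fg [PN Pf]; split=> // V h x; rewrite -fg. Qed.

Lemma polyE_poly_on U n (A : nat -> 'M[OX U]_(d', d)) : is_poly_on q k k' f n A ->
  polyE k k' f (fun j => if (j <= n)%N then A j else 0) n.
Proof.
move=> h; split=> [j|V hV x]; first by rewrite ltnNge => /negbTE ->.
rewrite h; apply: eq_bigr => j _.
by rewrite -ltnS ltn_ord.
Qed.

Lemma polyE_coords U d1 d1' (k1 : coords E d1) (k1' : coords E' d1') M M' P N :
  (forall V (h : V `<=` U) x, k V x = map_mx (res h) M *m k1 V x) ->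
  (forall V (h : V `<=` U) x, k1' V x = map_mx (res h) M' *m k' V x) ->
  @polyE E E' d d' U k k' f P N ->
  polyE k1 k1' f (tconv q (tcst M') (tconv q P (tcst M))) N.
Proof.
move=> hM hM' [PN Pf]; split=> [j /PN Pj|V h x].
  by rewrite tconv_tcstl (tconv_tcstr q1 (@HF _)) Pj mul0mx mulmx0.
rewrite (map_tconv (res h)) (map_tconv (res h)) !map_tcst.
rewrite evalS_tcstl (evalS_tcst q1 HF) -hM -Pf.
exact: hM'.
Qed.

Section Uniqueness.
Variable w : L.
Hypotheses (w0 : 0 < cvf_abs w) (w1 : cvf_abs w < 1).

Lemma evalS_zero (B : lalg L) a b (D : nat -> 'M[B]_(a, b)) n :
  (forall z : 'cV[B]_b, evalS q D z n = 0) -> forall j, (j < n)%N -> D j = 0.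
Proof.
move=> h j jn; apply: col_eq0 => i.
apply: (twisted_poly_zero q1 w0 w1 (D := fun j => col i (D j)) _ jn) => c.
by rewrite -(evalS_delta q1 HF).
Qed.

Lemma polyE_uniq U P P' N N' : is_coords U k ->
  @polyE E E' d d' U k k' f P N -> polyE k k' f P' N' -> forall j, P j = P' j.
Proof.
move=> kU hP hP' j; pose M := (N + N' + j)%N.
have [PM Pf] := polyE_weaken (M := M) (leq_trans (leq_addr _ _) (leq_addr _ _)) hP.
have [PM' Pf'] := polyE_weaken (M := M) (leq_trans (leq_addl _ _) (leq_addr _ _)) hP'.
apply/eqP; rewrite -subr_eq0; apply/eqP.
have UU : U `<=` U by [].
have rid n (A : nat -> 'M[OX U]_(d', d)) z : evalS q (fun j => map_mx (res UU) (A j)) z n = evalS q A z n.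
  apply: eq_bigr => i _; congr (_ *m _); apply/matrixP => a b; rewrite mxE; exact: res_id.
apply: (@evalS_zero (OX U) _ _ (fun j => P j - P' j) M.+1); last by rewrite ltnS leq_addl.
move=> z; rewrite evalSBl; have [x <-] := coords_surj kU UU z.
have := Pf U UU x; have := Pf' U UU x; rewrite !rid => -> ->.
by rewrite subrr.
Qed.

(** Morphisms in Vec are polynomial only locally. Uniqueness glues the coefficients, and finitely
    many members of the cover detect zero, which bounds the degree on [U]. *)
Lemma polyE_glue U : is_affinoid_open U -> is_coords U k -> is_coords U k' ->
  res_compatible U f ->
  locally U (fun V => exists P N, @polyE E E' d d' V k k' f P N) ->
  exists P N, @polyE E E' d d' U k k' f P N.
Proof.
move=> aU kU k'U fr loc; have UU : U `<=` U by [].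
pose Pr j a b V (s : OX V) := exists P N, @polyE E E' d d' V k k' f P N /\ s = P j a b.
have her : hereditary (fun V => exists P N, @polyE E E' d d' V k k' f P N).
  by move=> V W h [P [N hP]]; exists (fun j => map_mx (res h) (P j)), N; apply: polyE_res.
have glue (x : nat * 'I_d' * 'I_d) : exists t : OX U,
    locally U (fun V => forall h : V `<=` U, Pr x.1.1 x.1.2 x.2 V (res h t)).
  case: x => -[j a] b /=; apply: OX_glue.
    move=> V W T hV hW s s' VU WU [P [N [hP ->]]] [P' [N' [hP' ->]]].
    have TU : T `<=` U := subset_trans hV VU.
    have /(_ j)/matrixP/(_ a b) := polyE_uniq (coordsS TU kU) (polyE_res hV hP) (polyE_res hW hP').
    by rewrite !mxE.
  by apply: locally_mono loc => V _ [P [N hP]]; exists (P j a b), P, N.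
have /choice[t ht] := glue.
pose P j : 'M[OX U]_(d', d) := \matrix_(a, b) t (j, a, b).
have PE V (h : V `<=` U) Q N : @polyE E E' d d' V k k' f Q N ->
    forall j, map_mx (res h) (P j) = Q j.
  move=> hQ j; apply/matrixP => a b; rewrite !mxE.
  have ht' : locally U (fun W => exists hW : W `<=` U, Pr j a b W (res hW (t (j, a, b)))).
    by apply: locally_mono (ht (j, a, b)) => W hW /(_ hW) ?; exists hW.
  apply: OX_ext; apply: locally_mono (locally_pull h ht') => W _ [W0 [W0U hW0] WW0] hWV.
  have [P' [N' [hP' e]]] := hW0.
  rewrite (res_comp h hWV (subset_trans hWV h)) -(res_comp W0U WW0) e /=.
  have /(_ j)/matrixP/(_ a b) := polyE_uniq (coordsS (subset_trans hWV h) kU)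
     (polyE_res WW0 hP') (polyE_res hWV hQ).
  by rewrite !mxE.
have [N PN] : exists N, forall j, (N < j)%N -> P j = 0.
  have [n [V [hV sep]]] := affinoid_open_finite aU loc.
  have /choice[N hN] i : exists N, exists Q, @polyE E E' d d' (V i) k k' f Q N.
    by have [_ [Q [N hQ]]] := hV i; exists N, Q.
  exists (\max_i N i)%N => j Nj; apply/matrixP => a b; rewrite [RHS]mxE.
  apply: sep => i h; have [Q hQ] := hN i.
  have /matrixP/(_ a b) := PE _ h _ _ hQ j; rewrite [LHS]mxE => ->.
  have [Qz _] := hQ; rewrite Qz ?mxE //.
  by apply: leq_ltn_trans Nj; apply: leq_bigmax.
exists P, N; split=> // V h x; apply/matrixP => a b; apply: OX_ext.
apply: locally_mono (locally_here her h loc) => W WV [Q [M hQ]] hW.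
have WU := subset_trans WV h.
have eQ j : Q j = map_mx (res WU) (P j) by rewrite (PE _ WU _ _ hQ).
have mxr m n (A : 'M[OX V]_(m, n)) i j : res hW (A i j) = map_mx (res hW) A i j by rewrite mxE.
rewrite !mxr -(coords_res k'U h hW) -(fr _ _ hW h).
have [QM Qf] := polyE_weaken (leq_addl N M) hQ.
have idW : W `<=` W by [].
rewrite (Qf W idW) (coords_res kU h).
rewrite map_evalS; congr (fun_of_matrix _ a b).
transitivity (evalS q (fun j => map_mx (res WU) (P j)) (map_mx (res hW) (k V x)) (N + M).+1).
  apply: eq_bigr => j _; rewrite eQ (map_res_comp WU idW WU); congr (_ *m _).
rewrite (@evalS_trunc _ _ _ _ _ _ _ _ _ N); first last.
- by rewrite ltnS leq_addr.
- by move=> j /PN ->; rewrite map_mx0.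
by apply: eq_bigr => j _; rewrite (map_res_comp h hW WU).
Qed.

End Uniqueness.
End OnePoly.

Lemma polyE_comp (E E' E'' : mod_sheaf X) d d' d'' U (k : coords E d) (k' : coords E' d')
    (k'' : coords E'' d'') (f : smap E' E'') (g : smap E E') P Q N M :
  @polyE E' E'' d' d'' U k' k'' f P N -> @polyE E E' d d' U k k' g Q M ->
  polyE k k'' (fun V x => f V (g V x)) (tconv q P Q) (N + M).
Proof.
move=> [PN Pf] [QM Qg]; split=> [j hj|V h x].
  rewrite /tconv big1 // => i _; have [Ni|iN] := ltnP N i; first by rewrite PN // mul0mx.
  by rewrite QM ?(twist0 q1 (@HF _)) ?mulmx0 //; lia.
rewrite Pf Qg (map_tconv (res h)).
rewrite (evalS_tconv q1 HF _ _ (N := N)); last by move=> j /PN ->; rewrite map_mx0.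
apply: eq_bigr => i _; congr (_ *m twist q i _).
have iN := ltn_ord i; symmetry; apply: evalS_trunc; last by lia.
by move=> j /QM ->; rewrite map_mx0.
Qed.

Lemma polyE_id (E : mod_sheaf X) d U (k : coords E d) :
  polyE k k (fun V x => x) (tcst (1%:M : 'M[OX U]_d)) 0.
Proof.
split=> [[|j] //|V h x]; rewrite /evalS big_ord1 twist_id map_mx1 mul1mx //.
Qed.

End Coordinates.

(** * Coefficients of the exponential *)

Lemma bd_q_gt1 (R : realType) (D : base_data R) : (1 < bd_q D)%N.
Proof. exact: card_finNzRing_gt1. Qed.

Lemma bd_char (R : realType) (D : base_data R) : exists p n, [/\ prime p, bd_q D = (p ^ n)%N
  & forall B : lalg (bd_L D), p%:R = 0 :> B].
Proof.
have [p pp pc] := finfield.finPcharP (bd_Fq D).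
exists p, (logn p #|bd_Fq D|); split=> //; first exact: (finfield.card_pprimeChar pc).
move=> B; have := pcharf0 pc => /(congr1 (fun c => la_str B (bd_iota D (bd_FqA D c)))).
by rewrite !rmorph_nat !rmorph0.
Qed.

Lemma bd_frobenius_additive (R : realType) (D : base_data R) (B : lalg (bd_L D)) :
  frobenius_additive (bd_q D) B.
Proof.
have [p [n [pp -> p0]]] := bd_char D => x y.
by apply: (comm_exprD_primeX n pp (p0 B)); rewrite /GRing.comm mulrC.
Qed.

(** An element of [K] outside the valuation ring at infty has absolute value greater than 1 and lies
    in [L]; [w] is its inverse, the scalar used for all rescalings. *)
Lemma bd_small (R : realType) (D : base_data R) :
  exists2 w : bd_L D, 0 < cvf_abs w & cvf_abs w < 1.
Proof.
have [_ _ _ [x xi]] := bd_infty_point D.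
have : 1 < cvf_abs (bd_KC D x) by rewrite ltNge; apply/negP => /bd_KC_abs.
have [|c _ <-] := @bd_Koo_sub_L _ D (bd_KC D x).
  by move=> e e0; exists (bd_KC D x); [exists x | rewrite subrr cvf_abs0].
rewrite bd_LC_abs => c1; have c0 : 0 < cvf_abs c by apply: lt_trans c1.
by exists c^-1; rewrite cvf_absV ?invr_gt0 // invf_lt1.
Qed.

Lemma vec_hom_polyE (R : realType) (L : complete_valued_field R) (X : rigid_space L) q
    (q1 : (1 < q)%N) (HF : forall B : lalg L, frobenius_additive q B)
    (E E' : mod_sheaf X) d d' (U V : aopen X) (f : smap E E') (k : coords E d) (k' : coords E' d') :
  is_vec_hom q d d' U f -> V `<=` U -> is_coords V k -> is_coords V k' ->
  locally V (fun W => exists P N, polyE q (U := W) k k' f P N).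
Proof.
move=> [_ [F [cF FP]]] VU kV k'V.
have loc : locally U (fun W => is_affinoid_open W /\ exists (k0 : coords E d) (k0' : coords E' d')
    n (A : nat -> 'M[OX W]_(d', d)), [/\ is_coords W k0, is_coords W k0' & is_poly_on q k0 k0' f n A]).
  by exists F.
apply: locally_mono (locally_pull VU loc) => W WV [W0 [_ [k0 [k0' [n [A [hk hk' hA]]]]]] WW0].
have [G hG] := coords_change (coordsS WV kV) (coordsS WW0 hk).
have [G' hG'] := coords_change (coordsS WW0 hk') (coordsS WV k'V).
eexists; exists n; apply: (polyE_coords q1 HF hG hG').
exact: (polyE_res WW0 (polyE_poly_on hA)).
Qed.

Lemma locally_coords (R : realType) (L : complete_valued_field R) (X : rigid_space L)
    (E : mod_sheaf X) d (U : aopen X) : is_vector_bundle E d ->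
  locally U (fun V => is_affinoid_open V /\ exists k : coords E d, is_coords V k).
Proof.
move=> [F [cF FP]].
have her : hereditary (fun V : aopen X => exists k : coords E d, is_coords V k).
  by move=> V W WV [k kV]; exists k; apply: coordsS kV.
have loc : locally (whole X) (fun V : aopen X => exists k : coords E d, is_coords V k).
  by exists F.
apply: locally_affinoid => //; apply: locally_here her _ loc; exact: subsetT.
Qed.

Section Coefficients.
Variables (R : realType) (D : base_data R) (X : rigid_space (bd_L D)) (d r : nat).
Variable E : abelian_module X d r.
Implicit Types U V W : aopen X.
Notation q := (bd_q D).
Let q1 := bd_q_gt1 D.
Let HF := @bd_frobenius_additive R D.
Variable w : bd_L D.
Hypotheses (w0 : 0 < cvf_abs w) (w1 : cvf_abs w < 1).

Section OnOpen.
Variables (U : aopen X) (k : coords E d).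
Arguments k : clear implicits.
Hypotheses (aU : is_affinoid_open U) (kU : is_coords U k).

Lemma am_phi_res a V W (h : W `<=` V) (x : E V) :
  am_phi a (mres h x) = mres h (am_phi a x).
Proof. by case: (am_phi_hom E a) => fr _; apply: fr; exact: subsetT. Qed.

Lemma am_dphi_res a V W (h : W `<=` V) (x : E V) :
  am_dphi a (mres h x) = mres h (am_dphi a x).
Proof. by case: (am_dphi_diff E a) => fr _; apply: fr; exact: subsetT. Qed.

Lemma am_polyE a : exists P N, polyE q (U := U) k k (am_phi a) P N.
Proof.
apply: (polyE_glue q1 HF w0 w1) => //.
  by move=> V W h VU x; apply: am_phi_res.
apply: (vec_hom_polyE q1 HF (am_phi_hom E a)) => //; exact: subsetT.
Qed.

Lemma am_dphiE a P N V (h : V `<=` U) v : polyE q k k (am_phi a) P N ->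
  k V (am_dphi a v) = map_mx (res h) (P 0%N) *m k V v.
Proof.
move=> [_ Pf]; have [_ df] := am_dphi_diff E a.
exact: (df U k k N P aU kU kU Pf).
Qed.

Lemma am_polyE_exp a P N m : polyE q k k (am_phi a) P N ->
  exists Q M, polyE q k k (am_phi (a ^+ m)) Q M /\ Q 0%N = P 0%N ^+ m :> 'M[OX U]_d.
Proof.
move=> hP; elim: m => [|m [Q [M [hQ Q0]]]].
  exists (tcst 1%:M), 0%N; split=> //; apply: polyE_ext (polyE_id q U k) => V x _.
  by rewrite am_phi1.
exists (tconv q P Q), (N + M)%N; split; last first.
  by rewrite /tconv big_ord1 subn0 twist_id Q0 exprS.
by apply: polyE_ext (polyE_comp q1 HF hP hQ) => V x _; rewrite exprS am_phiM.
Qed.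

(** The exponent of nilpotence is given on the members of a cover; finitely many of them detect the
    zero matrix, so a maximum serves on [U]. *)
Lemma am_nilpotent_coords a P N : polyE q k k (am_phi a) P N ->
  exists n, ((la_str (OX U) (bd_iota D a))%:M - P 0%N : 'M[OX U]_d) ^+ n = 0.
Proof.
move=> hP; pose M : 'M[OX U]_d := (la_str (OX U) (bd_iota D a))%:M - P 0%N.
have loc : locally (whole X) (fun V => exists n, forall W (v : E W), W `<=` V ->
    iter n (fun w => la_str (OX W) (bd_iota D a) *: w - am_dphi a w) v = 0).
  have [F [cF FP]] := am_nilpotent E; exists F; split=> // V /FP [n hn].
  by exists (n a) => W v; apply: hn.
have UX : U `<=` whole X by apply: subsetT.
have [m [V [hV sep]]] := affinoid_open_finite aU (locally_pull UX loc).
have /choice[n hn] i : exists n, forall (W : aopen X) (v : E W), W `<=` V i ->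
    iter n (fun w => la_str (OX W) (bd_iota D a) *: w - am_dphi a w) v = 0.
  by have [_ [V0 [n hn] VV0]] := hV i; exists n => W v WV; apply: hn; apply: subset_trans VV0.
have iterE W (h : W `<=` U) j (v : E W) :
    k W (iter j (fun w => la_str (OX W) (bd_iota D a) *: w - am_dphi a w) v)
    = map_mx (res h) (M ^+ j) *m k W v.
  elim: j => [|j IH]; first by rewrite expr0 map_mx1 mul1mx.
  rewrite iterS (coordsB kU h) (coordsZ kU h) (am_dphiE h _ hP) IH.
  rewrite exprS -mulmxE map_mxM -mulmxA map_mxB mulmxBl; congr (_ - _).
  by rewrite map_scalar_mx mul_scalar_mx /= res_lhom.
exists (\max_i n i)%N; apply/matrixP => b c; rewrite [RHS]mxE.
apply: sep => i h.
have Mn0 : map_mx (res h) (M ^+ n i) = 0.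
  apply: mulmx_cV_inj => z; have [v <-] := coords_surj kU h z.
  by rewrite -iterE hn // (coords0 kU h) mul0mx.
rewrite -/M -(subnK (leq_bigmax i)) exprD -mulmxE.
have : map_mx (res h) (M ^+ ((\max_i n i) - n i) *m M ^+ n i) = 0 by rewrite map_mxM Mn0 mulmx0.
by move=> /matrixP/(_ b c); rewrite !mxE.
Qed.

(* Raising a to a large power of p kills the nilpotent part of phi_a'. *)
Lemma am_scalar a : exists s P N,
  polyE q (U := U) k k (am_phi (a ^+ s)) P N /\ (0 < s)%N /\
  P 0%N = (la_str (OX U) (bd_iota D a ^+ s))%:M.
Proof.
have [p [f [pp _ p0]]] := bd_char D.
have [P [N hP]] := am_polyE a; have [n hn] := am_nilpotent_coords hP.
have [Q [M [hQ Q0]]] := am_polyE_exp (p ^ n) hP.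
exists (p ^ n)%N, Q, M; split=> //; split; first by rewrite expn_gt0 prime_gt0.
pose T : 'M[OX U]_d := (la_str (OX U) (bd_iota D a))%:M.
have e : P 0%N = T + - (T - P 0%N) by rewrite opprB addrC subrK.
have pM : p%:R = 0 :> 'M[OX U]_d.
  apply/matrixP => i j; rewrite -[1]/(1%:M) mulmxnE !mxE.
  by rewrite -mulrnA mulnC mulrnA p0 mul0rn.
rewrite Q0 e (comm_exprD_primeX n pp pM); last first.
  by rewrite /GRing.comm -!mulmxE /T scalar_mxC.
rewrite exprNn -(subnK (ltnW (ltn_expl n (prime_gt1 pp)))) [in (_ - _) ^+ _]exprD hn.
by rewrite !mulr0 addr0 (rmorphXn (la_str _)) (rmorphXn (@scalar_mx _ d)).
Qed.

(** Quantifying over all [b] keeps the notion free of choices, while one element of absolute value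
    greater than 1 determines [e]. *)
Definition is_exp_coef (e : nat -> 'M[OX U]_d) := e 0%N = 1%:M /\
  forall b P N, polyE q k k (am_phi b) P N -> intertwines q e P.

Section Large.
Variable a : bd_A D.
Hypothesis a1 : 1 < cvf_abs (bd_iota D a).

Lemma large_exp s : (0 < s)%N -> 1 < cvf_abs (bd_iota D a ^+ s).
Proof. by move=> s0; rewrite cvf_absX exprn_egt1 // -lt0n. Qed.

(** Solve for a power of [a] whose [P 0] is scalar; the solution intertwines every [phi_b] because
    [A] is commutative. *)
Lemma is_exp_coef_exists : exists e, is_exp_coef e.
Proof.
have [s [P [N [hP [s0 P0]]]]] := am_scalar a; have t1 := large_exp s0.
exists (exp_coef q (bd_iota D a ^+ s) P); split=> // b Q M hQ.
apply: (intertwines_commute q1 (@HF _) t1 P0) => //.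
  exact: (exp_coef_intertwines q1 (@HF _) t1 P0).
apply/funext => n; apply: (polyE_uniq q1 HF w0 w1 kU (polyE_comp q1 HF hP hQ)).
apply: polyE_ext (polyE_comp q1 HF hQ hP) => V x _.
by rewrite -!am_phiM mulrC.
Qed.

Lemma is_exp_coef_uniq e e' : is_exp_coef e -> is_exp_coef e' -> e = e'.
Proof.
have [s [P [N [hP [s0 P0]]]]] := am_scalar a; have t1 := large_exp s0.
move=> [e0 he] [e0' he']; apply/funext.
apply: (intertwines_uniq q1 (@HF _) t1 P0); rewrite ?e0 //; [exact: he hP | exact: he' hP].
Qed.

Lemma is_exp_coef_entire e nu : is_exp_coef e -> complete_norm nu -> entire q nu e.
Proof.
have [s [P [N [hP [s0 P0]]]]] := am_scalar a; have t1 := large_exp s0.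
move=> [_ he] H; have [PN _] := hP.
exact: (exp_coef_entire q1 H (@HF _) t1 P0 PN (he _ _ _ hP)).
Qed.

End Large.
End OnOpen.

Section Large.
Variable a : bd_A D.
Hypothesis a1 : 1 < cvf_abs (bd_iota D a).

(** The restricted family satisfies the equation of one power of [a], and this equation already
    determines the family [f] that exists over [V]. *)
Lemma is_exp_coef_res U V (h : V `<=` U) (k : coords E d) e : is_affinoid_open U ->
  is_affinoid_open V -> is_coords U k -> is_exp_coef k e ->
  is_exp_coef k (fun j => map_mx (res h) (e j) : 'M[OX V]_d).
Proof.
move=> aU aV kU [e0 he]; have kV := coordsS h kU.
have [f hf] := is_exp_coef_exists aV kV a1; suff -> : (fun j => map_mx (res h) (e j)) = f by [].
have [s [P [N [hP [s0 P0]]]]] := am_scalar aU kU a; have t1 := large_exp a1 s0.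
have [f0 hf'] := hf; apply/funext.
have P0' : map_mx (res h) (P 0%N) = (la_str (OX V) (bd_iota D a ^+ s))%:M.
  by rewrite P0 map_scalar_mx /= res_lhom.
apply: (intertwines_uniq q1 (@HF _) t1 (P := fun j => map_mx (res h) (P j)) P0').
- by rewrite e0 map_mx1.
- have := congr1 (fun u n => map_mx (res h) (u n)) (he _ _ _ hP).
  by rewrite /= !map_tconv map_tcst.
- by apply: hf'; apply: polyE_res hP.
Qed.

Lemma is_exp_coef_change U (k k' : coords E d) e (G G' : 'M[OX U]_d) :
  (forall V (h : V `<=` U) x, k' V x = map_mx (res h) G *m k V x) ->
  (forall V (h : V `<=` U) x, k V x = map_mx (res h) G' *m k' V x) ->
  G *m G' = 1%:M -> G' *m G = 1%:M -> is_exp_coef k e ->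
  is_exp_coef k' (tconv q (tcst G) (tconv q e (tcst G'))).
Proof.
move=> hG hG' GG' G'G [e0 he]; split.
  by rewrite tconv_tcstl (tconv_tcstr q1 (@HF _)) e0 mul1mx twist_id.
have cc (A B : 'M[OX U]_d) : tconv q (tcst A) (tcst B) = tcst (A *m B).
  by apply/funext => -[|n]; rewrite tconv_tcstl //= mulmx0.
have c1 (u : nat -> 'M[OX U]_d) : tconv q (tcst 1%:M) u = u.
  by apply/funext => n; rewrite tconv_tcstl mul1mx.
have tA := tconvA q1 (@HF (OX U)).
move=> b P' N hP'; have hP := polyE_coords q1 HF hG hG' hP'.
have := he _ _ _ hP; rewrite /intertwines.
have -> : tconv q (tcst G') (tconv q P' (tcst G)) 0%N = G' *m P' 0%N *m G.
  by rewrite tconv_tcstl (tconv_tcstr q1 (@HF _)) twist_id mulmxA.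
move=> h; have e1 : G' *m P' 0%N = (G' *m P' 0%N *m G) *m G' by rewrite -mulmxA GG' mulmx1.
rewrite -!tA cc e1 -cc (tA _ _ _ _ e) h -!tA (tA _ _ _ _ (tcst G)) cc GG' c1.
by [].
Qed.

End Large.
End Coefficients.

(** * The exponential map *)

Section ConvergesMlim.
Variables (R : realType) (L : complete_valued_field R).

Lemma mlim_converges (B : lalg L) d (u : nat -> 'cV[B]_d) l :
  (forall nu, complete_norm nu -> mlim nu u l) -> converges u l.
Proof.
move=> h nu H e e0.
have /choice[N hN] i : exists N, forall n, (N <= n)%N -> nu ((u n - l) i 0) < e.
  by have [N hN] := h nu H i 0 e e0; exists N => n /hN; rewrite !mxE.
exists (\max_i N i)%N => n hn i; apply: hN; apply: leq_trans hn; exact: leq_bigmax.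
Qed.

Lemma converges_mlim (B : lalg L) d (u : nat -> 'cV[B]_d) l nu :
  converges u l -> complete_norm nu -> mlim nu u l.
Proof.
move=> h H i j e e0; have [N hN] := h nu H e e0.
by exists N => n /hN /(_ i); rewrite !mxE ord1.
Qed.

Variable w : L.
Hypotheses (w0 : 0 < cvf_abs w) (w1 : cvf_abs w < 1).

(** The image sequence is assumed to converge; the closed graph property, applied to differences,
    identifies its limit. *)
Lemma mlim_push (B B' : lalg L) (f : {rmorphism B -> B'}) nu nu' a b (u : nat -> 'M[B]_(a, b)) l l' :
  is_affinoid B -> is_affinoid B' -> is_lhom f -> complete_norm nu -> complete_norm nu' ->
  mlim nu u l -> mlim nu' (fun n => map_mx f (u n)) l' -> l' = map_mx f l.
Proof.
move=> aB aB' fL H H' hl hl'; apply/matrixP => i j; rewrite !mxE.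
apply/eqP; rewrite -subr_eq0; apply/eqP.
apply: (affinoid_closed_graph w0 w1 aB aB' fL H H' (u := fun n => u n i j - l i j)).
  by apply/(nu_lim0 nu (fun n => u n i j)).
apply: nu_lim_ext (nu_limB H' (hl' i j) (nu_lim_cst H' (f (l i j)))) => n.
by rewrite rmorphB mxE.
Qed.

End ConvergesMlim.

Lemma map_res_id (R : realType) (L : complete_valued_field R) (X : rigid_space L) (U : aopen X)
    (h : U `<=` U) a b (M : 'M[OX U]_(a, b)) : map_mx (res h) M = M.
Proof. by apply/matrixP => i j; rewrite mxE res_id. Qed.

(** * Twisted series as power series in d variables *)

Section Monomials.
Variables (R : realType) (L : complete_valued_field R) (q : nat).
Hypothesis q1 : (1 < q)%N.
Variables (B : lalg L) (d : nat).

Definition frob_monomial (i : 'I_d) j : {ffun 'I_d -> nat} :=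
  [ffun i' => if i' == i then (q ^ j)%N else 0%N].

(* sum_j e_j z^(j) as a power series in the entries of z: only the monomials
   z_i^(q^j) occur. *)
Definition monomial_coef (e : nat -> 'M[B]_d) (m : {ffun 'I_d -> nat}) : 'cV[B]_d :=
  \sum_(i < d) \sum_(j < (mideg m).+1) if m == frob_monomial i j then col i (e j) else 0.

Lemma mideg_frob i j : mideg (frob_monomial i j) = (q ^ j)%N.
Proof.
rewrite /mideg (bigD1 i) //= ffunE eqxx big1 ?addn0 // => i' ne.
by rewrite ffunE (negbTE ne).
Qed.

Lemma monomial_coefP (nu : B -> R) e m : complete_norm nu ->
  monomial_coef e m = 0 \/
  exists2 j, mideg m = (q ^ j)%N & mxnorm nu (monomial_coef e m) <= mxnorm nu (e j).
Proof.
move=> H; have [[i [j mE]]|nex] := pselect (exists i j, m = frob_monomial i j).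
  right; exists j; first by rewrite mE mideg_frob.
  apply: (mxnorm_sum H); first exact: mxnorm_ge0.
  move=> i' _; apply: (mxnorm_sum H); first exact: mxnorm_ge0.
  move=> j' _; case: eqP => [mE'|_]; last first.
    by apply: mxnorm_le => [|x y]; rewrite ?mxE ?(nu0 H) mxnorm_ge0.
  have : (q ^ j' = q ^ j)%N by rewrite -(mideg_frob i' j') -mE' mE mideg_frob.
  move=> /eqP; rewrite eqn_exp2l // => /eqP ->.
  by apply: mxnorm_le => [|x y]; rewrite ?mxnorm_ge0 // mxE mxnorm_ge.
left; rewrite /monomial_coef big1 // => i _; rewrite big1 // => j _.
by case: eqP => // mE; case: nex; exists i, j.
Qed.

Lemma monomial_coefE e m n : (mideg m < n)%N ->
  monomial_coef e m = \sum_(i < d) \sum_(j < n) if m == frob_monomial i j then col i (e j) else 0.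
Proof.
move=> mn; apply: eq_bigr => i _.
rewrite -(subnKC mn) big_split_ord /= [X in _ + X]big1 ?addr0 // => j _.
case: eqP => // mE; have : (mideg m < q ^ (mideg m + j.+1))%N.
  by apply: leq_ltn_trans (ltn_expq q1 _); rewrite leq_addr.
by rewrite {1}mE mideg_frob addSnnS ltnn.
Qed.

(** Only the monomials [z_i^(q^j)] survive, and total degree below [n] means [q^j < n]: fewer terms
    than in the partial sum over [j < n]. *)
Lemma monomial_sum (e : nat -> 'M[B]_d) (z : 'cV[B]_d) n :
  \sum_(m : {ffun 'I_d -> 'I_n} | (\sum_i m i < n)%N)
     (\prod_i z i 0 ^+ m i) *: monomial_coef e [ffun i => m i : nat]
  = \sum_(j < n) if (q ^ j < n)%N then e j *m twist q j z else 0.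
Proof.
pose nm (m : {ffun 'I_d -> 'I_n}) : {ffun 'I_d -> nat} := [ffun i => m i : nat].
have midegE m : mideg (nm m) = (\sum_i m i)%N by apply: eq_bigr => i _; rewrite ffunE.
under eq_bigr => m hm do rewrite -/(nm m) (@monomial_coefE _ _ n) ?midegE // scaler_sumr.
rewrite exchange_big /=.
under eq_bigr => i _ do under eq_bigr => m _ do rewrite scaler_sumr.
under eq_bigr => i _ do rewrite exchange_big /=.
rewrite exchange_big /=; apply: eq_bigr => j _.
case: ifP => [jn|/negbT]; last first.
  rewrite -leqNgt => nj; rewrite big1 // => i _; rewrite big1 // => m hm.
  case: eqP => [mE|_]; last by rewrite scaler0.
  by move: hm; rewrite -midegE mE mideg_frob ltnNge nj.
have n0 : (0 < n)%N by apply: leq_ltn_trans jn.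
have -> : e j *m twist q j z = \sum_(i < d) z i 0 ^+ (q ^ j) *: col i (e j).
  apply/matrixP => a b; rewrite mxE summxE; apply: eq_bigr => i _.
  by rewrite !mxE mulrC ord1.
apply: eq_bigr => i _.
pose m0 : {ffun 'I_d -> 'I_n} := [ffun i' => if i' == i then Ordinal jn else Ordinal n0].
have nm0 : nm m0 = frob_monomial i j by apply/ffunP => i'; rewrite !ffunE; case: eqP.
rewrite (bigD1 m0) /=; last by rewrite -midegE nm0 mideg_frob.
rewrite -/(nm m0) nm0 eqxx [X in _ + X]big1 ?addr0 => [|m /andP[_ ne]].
  congr (_ *: _); rewrite (bigD1 i) //= ffunE eqxx big1 ?mulr1 // => i' ne.
  by rewrite ffunE (negbTE ne) expr0.
case: eqP => [mE|_]; last by rewrite scaler0.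
case/eqP: ne; apply/ffunP => i'; apply: val_inj.
have := congr1 (fun u : {ffun 'I_d -> nat} => u i') mE; rewrite -nm0 !ffunE.
by [].
Qed.

End Monomials.

(** * Construction and uniqueness of the exponential *)

Section Exponential.
Variables (R : realType) (D : base_data R) (X : rigid_space (bd_L D)) (d r : nat).
Variable E : abelian_module X d r.
Implicit Types U V W : aopen X.
Notation q := (bd_q D).
Let q1 := bd_q_gt1 D.
Let HF := @bd_frobenius_additive R D.
Variable w : bd_L D.
Hypotheses (w0 : 0 < cvf_abs w) (w1 : cvf_abs w < 1).
Variable a : bd_A D.
Hypothesis a1 : 1 < cvf_abs (bd_iota D a).

Lemma am_locally_coords U : locally U (fun V => is_affinoid_open V /\ exists k : coords E d, is_coords V k).
Proof. exact: locally_coords (am_vector_bundle E). Qed.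

Lemma open_norm U : is_affinoid_open U -> exists nu : OX U -> R, complete_norm nu.
Proof. by move=> [aU _]; exact: (affinoid_has_norm w0 w1 aU). Qed.

(* u is the value at v of the exponential map. *)
Definition exp_rel U (v u : E U) :=
  forall W (h : W `<=` U) (k : coords E d) e, is_affinoid_open W -> is_coords W k ->
    is_exp_coef (E := E) k e -> forall nu, complete_norm nu ->
    mlim nu (evalS q e (k W (mres h v))) (k W (mres h u)).

Lemma exp_rel_res U V (h : V `<=` U) v u : exp_rel v u -> exp_rel (mres h v) (mres h u).
Proof.
move=> hvu W hW k e aW kW he nu H.
by rewrite !(mres_comp h hW (subset_trans hW h)); apply: hvu.
Qed.

Lemma exp_rel_uniq U v u u' : @exp_rel U v u -> exp_rel v u' -> u = u'.
Proof.
move=> hu hu'; apply: mod_ext; apply: locally_mono (am_locally_coords U) => W _ [aW [k kW]] h.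
have [e he] := is_exp_coef_exists w0 w1 aW kW a1.
have [nu H] := open_norm aW; apply: (coords_inj kW (fun x y => y)).
by apply: (mlim_uniq H); [apply: (hu W h k e) | apply: (hu' W h k e)].
Qed.

(** The limit over [U] is carried to each affinoid [W] by [mlim_push]: entireness over [OX W] gives
    the required convergence, and a change of coordinates conjugates the coefficients. *)
Lemma exp_rel_local U (k : coords E d) v : is_affinoid_open U -> is_coords U k ->
  exists u, @exp_rel U v u.
Proof.
move=> aU kU; have UU : U `<=` U by [].
have [e he] := is_exp_coef_exists w0 w1 aU kU a1; have [nu H] := open_norm aU.
have [l hl] := evalS_cvg q1 H (k U v) (is_exp_coef_entire w0 w1 aU kU a1 he H).
have [u hu] := coords_surj kU UU l; exists u => W h k' e' aW k'W he' nu' H'.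
have kW := coordsS h kU; have WW : W `<=` W by [].
have [G [G' [hG hG' GG' G'G]]] := coords_change_inv kW k'W.
have heW := is_exp_coef_res w0 w1 a1 h aU aW kU he.
have -> : e' = tconv q (tcst G) (tconv q (fun j => map_mx (res h) (e j)) (tcst G')).
  exact: (is_exp_coef_uniq w0 w1 aW k'W a1 he' (is_exp_coef_change hG hG' GG' G'G heW)).
have kWv x : k W (mres h x) = G' *m k' W (mres h x) by rewrite (hG' W WW) map_res_id.
have k'Wv x : k' W (mres h x) = G *m k W (mres h x) by rewrite (hG W WW) map_res_id.
apply: (mlim_ext (u := fun n => G *m evalS q (fun j => map_mx (res h) (e j)) (k W (mres h v)) n)).
  by move=> n; rewrite evalS_tcstl (evalS_tcst q1 HF) -kWv.
rewrite k'Wv; apply: (mlim_mul H').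
have [l' hl'] := evalS_cvg q1 H' (k W (mres h v)) (is_exp_coef_entire w0 w1 aW kW a1 heW H').
suff -> : k W (mres h u) = l' by [].
rewrite (coords_res kU UU) hu; symmetry.
apply: (mlim_push w0 w1 (aU.1) (aW.1) (res_lhom h) H H' hl).
by apply: mlim_ext hl' => n; rewrite map_evalS (coords_res kU UU).
Qed.

(** Local values agree by [exp_rel_uniq] and glue. Over an arbitrary affinoid [W] with coordinates,
    the relation is recovered by comparing the glued section with the value constructed on [W]. *)
Lemma exp_rel_exists U v : exists u, @exp_rel U v u.
Proof.
pose P V (s : E V) := exists h : V `<=` U, exp_rel (mres h v) s.
have [||u hu] := @mod_glue _ _ _ E U P.
- move=> V W T hV hW s s' VU WU [h hs] [h' hs'].
  apply: (@exp_rel_uniq T (mres (subset_trans hV h) v)).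
    by rewrite -(mres_comp h hV); apply: exp_rel_res.
  by rewrite -(mres_comp h' hW); apply: exp_rel_res.
- apply: locally_mono (am_locally_coords U) => V h [aV [k kV]].
  by have [u hu] := exp_rel_local (mres h v) aV kV; exists u, h.
have {}hu : locally U (fun V => exists h : V `<=` U, exp_rel (mres h v) (mres h u)).
  apply: locally_mono hu => V VU /(_ VU) [h hh]; exists VU.
  by rewrite (Prop_irrelevance h VU) in hh.
exists u => W h k e aW kW he nu H; have WW : W `<=` W by [].
have [u' hu'] := exp_rel_local (mres h v) aW kW.
suff -> : mres h u = u' by have := hu' W WW k e aW kW he nu H; rewrite !mres_id.
apply: mod_ext; apply: locally_mono (locally_pull h hu) => T _ [V [VU hV] TV] TW.
apply: (@exp_rel_uniq T (mres TW (mres h v))); last exact: exp_rel_res.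
rewrite !(mres_comp h TW (subset_trans TV VU)) -!(mres_comp VU TV).
exact: exp_rel_res.
Qed.

Definition exp_map : smap (Lie E) E := fun U v => projT1 (cid (@exp_rel_exists U v)).

Lemma exp_mapP U v : @exp_rel U v (exp_map v).
Proof. exact: (projT2 (cid (@exp_rel_exists U v))). Qed.

Lemma exp_mapE U v u : @exp_rel U v u -> exp_map v = u.
Proof. exact: exp_rel_uniq (exp_mapP v). Qed.

Lemma exp_map_res U V (h : V `<=` U) v : exp_map (mres h v) = mres h (exp_map v).
Proof. by apply/exp_mapE/exp_rel_res/exp_mapP. Qed.

Lemma exp_map_add U v v' : @exp_map U (v + v') = exp_map v + exp_map v'.
Proof.
apply: exp_mapE => W h k e aW kW he nu H; rewrite !mres_add !(coordsD kW (fun x y => y)).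
apply: mlim_ext (fun n => esym (evalSD q1 HF e _ _ n)) _.
by apply: (mlimD H); apply: exp_mapP.
Qed.

Lemma exp_map_phi b U v : exp_map (@am_dphi _ _ _ _ _ E b U v) = am_phi b (exp_map v).
Proof.
apply: exp_mapE => W h k e aW kW he nu H; have WW : W `<=` W by [].
have [P [N hP]] := am_polyE w0 w1 aW kW b; have [e0 he'] := he.
have [PN Pf] := hP; have ePN := he' _ _ _ hP.
rewrite -am_dphi_res -am_phi_res (am_dphiE aW kW WW _ hP) map_res_id.
apply: mlim_ext (fun n => evalS_tcst q1 HF e (P 0%N) _ n) _.
rewrite ePN Pf /evalS; under eq_bigr do rewrite map_res_id.
by apply: (mlim_tconv q1 HF H PN); apply: exp_mapP.
Qed.

Lemma exp_map_series U (k : coords E d) (e : nat -> 'M[OX U]_d) : is_affinoid_open U -> is_coords U k ->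
  is_exp_coef (E := E) k e -> is_exp_series exp_map k e.
Proof.
move=> aU kU he; split; first by case: he.
  by move=> nu H; apply: (entire_lne q1); exact: (is_exp_coef_entire w0 w1 aU kU a1 he H).
move=> V h aV v; apply: mlim_converges => nu H; have VV : V `<=` V by [].
have := exp_mapP v VV aV (coordsS h kU) (is_exp_coef_res w0 w1 a1 h aU aV kU he) H.
by rewrite !mres_id.
Qed.

Lemma exp_map_analytic : is_analytic_hom d d exp_map.
Proof.
split; [by move=> V W h _ x; apply: exp_map_res | by move=> U x y; apply: exp_map_add |].
have [F [cF FP]] := am_locally_coords (whole X); exists F; split=> // U /FP [aU [k kU]].
split=> //; have [e he] := is_exp_coef_exists w0 w1 aU kU a1.
exists k, k, (monomial_coef q e); split=> //.
  move=> nu H rho eps rho0 eps0.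
  have [J hJ] := entire_small q1 (is_exp_coef_entire w0 w1 aU kU a1 he H) (ltW rho0) eps0.
  exists (q ^ J)%N => m hm.
  have [->|[j mE le]] := monomial_coefP q1 e m H.
    suff -> : mxnorm nu (0 : 'cV[OX U]_d) = 0 by rewrite mul0r.
    apply/eqP; rewrite eq_le mxnorm_ge0 andbT.
    by apply: mxnorm_le => // i' j'; rewrite mxE (nu0 H).
  move: hm; rewrite mE leq_exp2l // => /hJ; apply: le_lt_trans.
  by rewrite ler_wpM2r // exprn_ge0 // ltW.
move=> V h aV x; apply: mlim_converges => nu H.
pose f j := map_mx (res h) (e j) : 'M[OX V]_d.
have hf : is_exp_coef k f := is_exp_coef_res w0 w1 a1 h aU aV kU he.
have kV := coordsS h kU; have fent := is_exp_coef_entire w0 w1 aV kV a1 hf H.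
have fl : mlim nu (evalS q f (k V x)) (k V (exp_map x)).
  have VV : V `<=` V by [].
  by have := exp_mapP x VV aV kV hf H; rewrite !mres_id.
(* The terms with [q^j >= n], which truncation by total degree omits; they tend to 0. *)
pose tl n := \sum_(j < n) if (q ^ j < n)%N then 0 else f j *m twist q j (k V x).
apply: (mlim_ext (u := fun n => evalS q f (k V x) n - tl n)) => [n|].
  transitivity (\sum_(m : {ffun 'I_d -> 'I_n} | (\sum_i m i < n)%N)
     (\prod_i k V x i 0 ^+ m i) *: monomial_coef q f [ffun i => m i : nat]).
    rewrite (monomial_sum q1) -sumrB; apply: eq_bigr => j _.
    by case: ifP; rewrite ?subr0 ?subrr.
  apply: eq_bigr => m _; congr (_ *: _).
  rewrite /monomial_coef (map_mx_sum (res h)); apply: eq_bigr => i _.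
  rewrite (map_mx_sum (res h)); apply: eq_bigr => j _.
  by case: ifP; rewrite ?map_mx0 // map_col.
rewrite -[k V (exp_map x)]subr0; apply: (mlimB H) => // i' j' eps eps0.
have [J hJ] := entire_term_small q1 H (k V x) fent eps0.
exists (q ^ J)%N => n hn; rewrite mxE subr0 summxE; apply: (nu_sum_lt H) => // j _.
case: ifP => [_|/negbT]; first by rewrite mxE (nu0 H).
rewrite -leqNgt => nj; apply: le_lt_trans (mxnorm_ge nu _ i' j') _; apply: hJ.
by rewrite -(leq_exp2l _ _ q1); apply: leq_trans nj.
Qed.

Lemma exp_map_exponential : is_exponential exp_map.
Proof.
split; first exact: exp_map_analytic.
  by move=> b U v; apply: exp_map_phi.
move=> U k aU kU; have [e he] := is_exp_coef_exists w0 w1 aU kU a1.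
by exists e; apply: exp_map_series.
Qed.

(** It suffices that the coefficients [f] of [psi] intertwine every [phi_b]. At each scalar multiple
    of a basis vector the two sides converge to [psi (phi_b' x)] and [phi_b (psi x)], so the
    difference series has value 0 there and its coefficients vanish. *)
Lemma exponential_uniq (psi : smap (Lie E) E) : is_exponential psi -> exp_map = psi.
Proof.
move=> [[psires _ _] psiphi psiser]; apply/functional_extensionality_dep => U; apply/funext => v.
apply: exp_mapE => W h k e aW kW he nu H; have WW : W `<=` W by [].
have [f [f0 _ hf]] := psiser W k aW kW.
have fl x nu' : complete_norm nu' -> mlim nu' (evalS q f (k W x)) (k W (psi W x)).
  move=> H'; apply: mlim_ext (converges_mlim (hf W WW aW x) H') => n.
  by apply: eq_bigr => j _; rewrite map_res_id.
suff -> : e = f by rewrite -psires //; apply: fl.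
apply: (is_exp_coef_uniq w0 w1 aW kW a1 he); split=> // b P N hP.
have [PN Pf] := hP.
pose Df n := tconv q f (tcst (P 0%N)) n - tconv q P f n.
suff D0 n : Df n = 0.
  by apply/funext => n; apply/eqP; rewrite -subr_eq0; apply/eqP/D0.
apply: col_eq0 => i; apply/matrixP => i' j'; rewrite [RHS]mxE.
apply: (twisted_series_zero q1 w0 w1 H (D := fun n => col i (Df n) i' j')) => c.
have [x hx] := coords_surj kW WW (la_str (OX W) c *: delta_mx i 0).
have lim0 : mlim nu (evalS q Df (k W x)) 0.
  apply: mlim_ext (fun n => esym (evalSBl _ _ _ _ n)) _.
  have e0 : k W (psi W (am_dphi b x)) = \sum_(i < N.+1) P i *m twist q i (k W (psi W x)).
    rewrite psiphi Pf; apply: eq_bigr => j _; rewrite map_res_id //.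
  rewrite -(subrr (k W (psi W (am_dphi b x)))); apply: (mlimB H); last first.
    by rewrite e0; apply: (mlim_tconv q1 HF H PN); apply: fl.
  apply: mlim_ext (fun n => esym (evalS_tcst q1 HF f (P 0%N) _ n)) _.
  have := fl (am_dphi b x) nu H; rewrite (am_dphiE aW kW WW _ hP) map_res_id.
  by [].
have := lim0 i' j'; rewrite [X in nu_lim _ _ X]mxE; apply: nu_lim_ext => m.
rewrite hx (evalS_delta q1 HF) summxE; apply: eq_bigr => j _.
by rewrite mxE.
Qed.

End Exponential.

(** * The case of absolutely bounded A *)

Section ValuationRing.
Variables (Fq : finFieldType) (K : fieldType) (FqK : {rmorphism Fq -> K}).

Definition is_subring_over (V : set K) := (forall c, V (FqK c)) /\
  forall x y, V x -> V y -> V (x - y) /\ V (x * y).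

Definition adjoin (V : set K) (z : K) : set K :=
  [set x | exists2 p : {poly K}, (forall i, V p`_i) & x = p.[z]].

Section Subring.
Variable V : set K.
Hypothesis sV : is_subring_over V.

Lemma subring0 : V 0. Proof. by rewrite -(rmorph0 FqK); apply: sV.1. Qed.
Lemma subring1 : V 1. Proof. by rewrite -(rmorph1 FqK); apply: sV.1. Qed.
Lemma subringB x y : V x -> V y -> V (x - y).
Proof. by move=> hx hy; case: (sV.2 x y hx hy). Qed.
Lemma subringM x y : V x -> V y -> V (x * y).
Proof. by move=> hx hy; case: (sV.2 x y hx hy). Qed.
Lemma subringD x y : V x -> V y -> V (x + y).
Proof.
by move=> hx hy; rewrite -[y]opprK -[- y]add0r; apply: subringB => //; apply: subringB => //; apply: subring0.
Qed.
Lemma subringX x n : V x -> V (x ^+ n).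
Proof.
by move=> hx; elim: n => [|n IH]; rewrite ?expr0 ?exprS; [apply: subring1 | apply: subringM].
Qed.
Lemma subring_sum (I : Type) (s : seq I) (P : pred I) (F : I -> K) :
  (forall i, P i -> V (F i)) -> V (\sum_(i <- s | P i) F i).
Proof. by move=> h; elim/big_ind: _ => //; [apply: subring0 | apply: subringD]. Qed.

Lemma adjoin_sub z x : V x -> adjoin V z x.
Proof.
move=> Vx; exists x%:P; last by rewrite hornerC.
by move=> i; rewrite coefC; case: eqP => // _; apply: subring0.
Qed.

Lemma adjoin_gen z : adjoin V z z.
Proof.
exists 'X; last by rewrite hornerX.
by move=> i; rewrite coefX; case: eqP => _; [apply: subring1 | apply: subring0].
Qed.

Lemma adjoin_subring z : is_subring_over (adjoin V z).
Proof.
split=> [c|_ _ [p hp ->] [p' hp' ->]]; first exact/adjoin_sub/sV.1.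
split; [exists (p - p') | exists (p * p')]; rewrite ?hornerE // => i.
  by rewrite coefB; apply: subringB.
by rewrite coefM; apply: subring_sum => j _; apply: subringM.
Qed.

End Subring.

(* Chevalley: a subring maximal among those containing x^-1 but not x is a
   valuation ring. *)
Section Maximal.
Variables (x : K) (A : set K).
Hypotheses (x0 : x != 0) (sA : is_subring_over A) (Ay : A x^-1) (nAx : ~ A x).
Hypothesis Amax : forall z, ~ A z -> adjoin A z x.
Notation y := x^-1.

(** If [u = 1 - b y] had no inverse in [A], then [x] would be a polynomial in [u^-1] over [A], so
    [x u^n] would be in [A] for some [n]. But [x u = x - b] puts every [x u^m - x] in [A], hence
    also [x]. *)
Lemma maximal_unit b : A b -> A (1 - b * y)^-1.
Proof.
move=> Ab; set u := 1 - b * y; apply: contrapT => nAu.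
have Au : A u by apply: (subringB sA); [apply: (subring1 sA) | apply: (subringM sA)].
have u0 : u != 0 by apply/eqP => e; apply: nAu; rewrite e invr0; apply: (subring0 sA).
have [p Ap xE] := Amax nAu; set n := size p.
have h1 : A (x * u ^+ n).
  rewrite xE horner_coef mulr_suml; apply: (subring_sum sA) => i _.
  have -> : p`_i * u^-1 ^+ i * u ^+ n = p`_i * u ^+ (n - i).
    have iN : (i <= n)%N by apply: ltnW.
    have -> : u ^+ n = u ^+ (n - i) * u ^+ i by rewrite -exprD subnK.
    by rewrite -mulrA [u^-1 ^+ i * _]mulrCA -exprMn mulVf // expr1n mulr1.
  by apply: (subringM sA) => //; apply: (subringX sA).
have h2 m : A (x * u ^+ m - x).
  elim: m => [|m IH]; first by rewrite expr0 mulr1 subrr; apply: (subring0 sA).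
  have -> : x * u ^+ m.+1 - x = (x * u ^+ m - x) * u - b.
    have -> : b = x - x * u by rewrite /u mulrBr mulr1 opprB addrC subrK mulrCA mulfV // mulr1.
    by rewrite exprSr; ring.
  by apply: (subringB sA) => //; apply: (subringM sA).
apply: nAx; have -> : x = x * u ^+ n - (x * u ^+ n - x) by rewrite opprB addrC subrK.
by apply: (subringB sA).
Qed.

(** The relation for [z^-1], multiplied by [z^n] and divided by the unit [1 - q_0 y], rewrites the
    top power [z^n] in lower powers. *)
Lemma maximal_reduce (p q : {poly K}) z : z != 0 -> (size q <= size p)%N ->
  (forall i, A p`_i) -> (forall i, A q`_i) -> y * p.[z] = 1 -> y * q.[z^-1] = 1 ->
  exists p' : {poly K}, [/\ (size p' < size p)%N, forall i, A p'`_i & y * p'.[z] = 1].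
Proof.
move=> z0 qp Ap Aq hp hq.
case pn : (size p) qp => [|n] qn.
  move: hp; have /eqP -> : p == 0 by rewrite -size_poly_eq0 pn.
  by rewrite horner0 mulr0 => /eqP; rewrite eq_sym oner_eq0.
pose u := 1 - q`_0 * y; pose v := u^-1.
have Av : A v by apply: maximal_unit.
have u0 : u != 0.
  rewrite subr_eq0; apply/eqP => e; apply: nAx.
  have -> : x = q`_0 by rewrite -[LHS]mul1r e mulfVK.
  exact: Aq.
have zn : z ^+ n = v * y * \sum_(i < n) q`_(n - i) * z ^+ i.
  apply: (mulfI u0); rewrite mulrA mulrA /v mulfV // mul1r.
  have : u = y * \sum_(j < n) q`_j.+1 * z^-1 ^+ j.+1.
    rewrite /u -hq (horner_coef_wide _ qn) big_ord_recl expr0 mulr1 mulrDr.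
    by rewrite [q`_0 * y]mulrC addrAC subrr add0r.
  move=> ->; rewrite -mulrA; congr (_ * _).
  rewrite mulr_suml (reindex_inj rev_ord_inj) /=; apply: eq_bigr => i _.
  have ni := ltn_ord i; have -> : (n - i.+1).+1 = (n - i)%N by lia.
  rewrite -mulrA; congr (_ * _).
  rewrite -[in z ^+ n](subnK (ltnW ni)) exprD mulrA -exprMn mulVf // expr1n mul1r.
  by [].
pose p' := \poly_(i < n) (p`_i + p`_n * v * y * q`_(n - i)).
exists p'; split; first by rewrite ltnS size_poly.
  move=> i; rewrite coef_poly; case: ifP => _; last exact: (subring0 sA).
  by apply: (subringD sA) => //; do !apply: (subringM sA) => //.
rewrite -hp; congr (_ * _).
rewrite horner_poly (horner_coef_wide _ (leqnn _)) pn big_ord_recr /= zn.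
rewrite mulr_sumr mulr_sumr -big_split /=; apply: eq_bigr => i _.
by ring.
Qed.

(** If neither [z] nor [z^-1] were in [A], each would express [x] as a polynomial. The longer of the
    two can always be shortened, a descent on the total size. *)
Lemma maximal_total z : A z \/ A z^-1.
Proof.
apply: contrapT => /not_orP[nz nz'].
have z0 : z != 0 by apply/eqP => e; apply: nz; rewrite e; apply: (subring0 sA).
suff F N (p q : {poly K}) (t : K) : (size p + size q <= N)%N -> t != 0 ->
    (forall i, A p`_i) -> (forall i, A q`_i) -> y * p.[t] = 1 -> y * q.[t^-1] = 1 -> False.
  have [p Ap pE] := Amax nz; have [q Aq qE] := Amax nz'.
  by apply: (F _ p q z (leqnn _) z0 Ap Aq); rewrite -?pE -?qE mulVf.
elim: N p q t => [|N IH] p q t hN t0 Ap Aq hp hq.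
  move: hp; have /eqP -> : p == 0 by rewrite -size_poly_eq0; lia.
  by rewrite horner0 mulr0 => /eqP; rewrite eq_sym oner_eq0.
have [qp|/ltnW pq] := leqP (size q) (size p).
  have [p' [sp Ap' hp']] := maximal_reduce t0 qp Ap Aq hp hq.
  by apply: (IH p' q t) => //; lia.
have [q' [sq Aq' hq']] := maximal_reduce (p := q) (q := p) (z := t^-1) (invr_neq0 t0) pq Aq Ap hq
  (etrans (congr1 (fun s => y * p.[s]) (invrK t)) hp).
by apply: (IH p q' t) => //; lia.
Qed.

End Maximal.

Lemma closed_point_avoiding x : ~ algebraicOver FqK x -> exists2 V, is_closed_point FqK V & ~ V x.
Proof.
move=> xtr; have x0 : x != 0.
  by apply/eqP => e; apply: xtr; rewrite e -(rmorph0 FqK); apply: algebraic_id.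
pose P (V : set K) := V = set0 \/ [/\ is_subring_over V, V x^-1 & ~ V x].
have [F FP tot|A [PA Amax]] := @Zorn_bigcup _ P.
  have [allempty|/existsNP[M /not_implyP[FM Mn]]] := pselect (forall M, F M -> M = set0).
    by left; apply/seteqP; split=> // z [M FM]; rewrite (allempty M FM).
  have [//|[sM My Mx]] := FP _ FM.
  have FS M' z : F M' -> M' z -> [/\ is_subring_over M', M' x^-1 & ~ M' x].
    by move=> /FP [->|].
  right; split; first split.
  - by move=> c; exists M => //; apply: sM.1.
  - move=> z t [M1 F1 z1] [M2 F2 t2].
    suff [M3 F3 [z3 t3]] : exists2 M3, F M3 & M3 z /\ M3 t.
      by have [[_ h] _ _] := FS _ _ F3 z3; have [? ?] := h _ _ z3 t3; split; exists M3.
    have [/(_ _ z1) z2|/(_ _ t2) t1] := tot _ _ F1 F2; [by exists M2 | by exists M1].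
  - by exists M.
  - by move=> [M1 F1 x1]; have [_ _] := FS _ _ F1 x1.
pose B0 := adjoin (range FqK) x^-1.
have sr : is_subring_over (range FqK).
  split=> [c|_ _ [c _ <-] [c' _ <-]]; first by exists c.
  by rewrite -rmorphB -rmorphM; split; [exists (c - c') | exists (c * c')].
have sB0 : is_subring_over B0 := adjoin_subring sr _.
(* An equation [x = p(x^-1)] makes [x^-1] a root of [X p - 1], hence [x] algebraic. *)
have B0x : ~ B0 x.
  move=> [p hp xE]; apply: xtr; rewrite -[x]invrK; apply: algebraic_inv.
  have /choice[c hc] i : exists c, FqK c = p`_i by have [c _ <-] := hp i; exists c.
  pose p0 := \poly_(i < size p) c i.
  have p0E : map_poly FqK p0 = p.
    apply/polyP => i; rewrite coef_map coef_poly; case: ltnP => [_|/leq_sizeP h]; first exact: hc.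
    by rewrite h //; exact: rmorph0.
  exists ('X * p0 - 1).
    apply/eqP => /(congr1 (fun s : {poly Fq} => s`_0)); rewrite coefB coefXM coef1 coef0 sub0r.
    by move=> /eqP; rewrite oppr_eq0 oner_eq0.
  by rewrite rootE rmorphB rmorphM rmorph1 /= map_polyX p0E !hornerE -xE mulVf // subrr.
have {PA}[sA Ay nAx] : [/\ is_subring_over A, A x^-1 & ~ A x].
  case: PA => // A0; exfalso; apply: (Amax B0).
    rewrite A0 properEneq; split=> //; apply/eqP => /esym e.
    by have := subring0 sB0; rewrite e.
  by right; split=> //; apply: adjoin_gen.
have Amax' z : ~ A z -> adjoin A z x.
  move=> nz; apply: contrapT => nx; apply: (Amax (adjoin A z)).
    split; first by move=> t; apply: adjoin_sub.
    by move=> h; apply: nz; apply: h; apply: adjoin_gen.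
  by right; split=> //; [apply: adjoin_subring | apply: adjoin_sub].
exists A => //; split; [exact: sA.1 | exact: sA.2 | | by exists x].
by move=> z; apply: (maximal_total x0 sA Ay nAx Amax').
Qed.

End ValuationRing.

Lemma bd_small_finite (R : realType) (D : base_data R) :
  (forall a, cvf_abs (bd_iota D a) <= 1) -> forall a, exists c, a = bd_FqA D c.
Proof.
move=> h a; have int V : is_closed_point (bd_FqK D) V -> V (bd_AK D a).
  move=> cV; have [->|ne] := pselect (V = @bd_infty R D).
    by apply/bd_KC_abs; rewrite -bd_iotaE bd_LC_abs.
  have : range (bd_AK D) (bd_AK D a) by exists a.
  by rewrite bd_AK_range; apply.
have [_ cst] := bd_function_field D.
have [|c e] := cst (bd_AK D a).
  apply: contrapT => ntr; have [V cV nV] := closed_point_avoiding ntr.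
  exact: nV (int V cV).
by exists c; apply: (@bd_AK_inj _ D); rewrite bd_AK_Fq.
Qed.

(** * If A = Fq, then E = 0 *)

Section Trivial.
Variables (R : realType) (D : base_data R) (X : rigid_space (bd_L D)) (d r : nat).
Variable E : abelian_module X d r.
Implicit Types U V W T : aopen X.
Notation q := (bd_q D).
Let q1 := bd_q_gt1 D.
Let HF := @bd_frobenius_additive R D.
Variable w : bd_L D.
Hypotheses (w0 : 0 < cvf_abs w) (w1 : cvf_abs w < 1).
Hypothesis small : forall a, exists c, a = bd_FqA D c.

Definition trivial_on U := forall x y : E U, x = y.

Lemma locally_trivial U : locally U trivial_on -> trivial_on U.
Proof.
move=> h x y; apply: mod_ext; apply: locally_mono h => V _ hV hVU; exact: hV.
Qed.

Lemma coord_power_poly U (k : coords E d) (i : 'I_d) (J : nat) :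
  is_poly_on q (E' := Ga X) k (fun V s => const_mx (s : OX V) : 'cV_1)
    (fun V (e : E V) => k V e i 0 ^+ (q ^ J) : OX V) J
    (fun j => if j == J then delta_mx 0 i : 'M[OX U]_(1, d) else 0).
Proof.
move=> W h x; rewrite big_ord_recr /= eqxx big1 ?add0r => [|j _]; last first.
  by rewrite (ltn_eqF (ltn_ord j)) map_mx0 mul0mx.
by rewrite map_delta_mx -rowE; apply/matrixP => a b; rewrite !mxE !ord1.
Qed.

Lemma coord_power_dual U (k : coords E d) (i : 'I_d) (J : nat) : is_coords U k ->
  is_dual d U (fun V (e : E V) => k V e i 0 ^+ (q ^ J) : OX V).
Proof.
move=> kU; split=> [V W h VU x|].
  by rewrite (coords_res kU VU) mxE /= rmorphXn.
have [F [cF FP]] := affinoid_basis U; exists F; split=> // V FV; split; first exact: FP.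
have VU := cov_sub cF FV.
do 4!eexists; split; [exact: coordsS kU | exact: Ga_coords | exact: coord_power_poly].
Qed.

(* For J larger than the sigma-degrees of generators of M(E), the J-th Frobenius
   power of a coordinate cannot lie in M(E), as A = Fq preserves these degrees. *)
Lemma small_trivial U : trivial_on U.
Proof.
apply: locally_trivial.
have [F [cF FP]] := am_fingen E.
have UX : U `<=` whole X by apply: subsetT.
pose kG : coords (Ga X) 1 := fun V s => const_mx (s : OX V).
have loc : locally (whole X) (fun U => exists (n : nat) (g : 'I_n -> smap E (Ga X)),
      (forall i, is_dual d U (g i)) /\
      forall V (f : smap E (Ga X)), V `<=` U -> is_dual d V f ->
        locally V (fun W => exists (l : nat) (b : 'I_n -> 'I_l -> OX W) (a : 'I_n -> 'I_l -> bd_A D),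
            forall T (h : T `<=` W) (e : E T),
              f T e = \sum_i \sum_j res h (b i j) * dual_act (@am_phi _ _ _ _ _ E) (a i j) (g i) e)).
  by exists F.
apply: locally_comp; apply: locally_mono (locally_pull UX loc) => W0 _ [U0 [n [g [gd gen]]] W0U0].
apply: locally_comp.
apply: locally_mono (locally_coords W0 (am_vector_bundle E)) => W1 W1W0 [aW1 [k kW1]].
have W1U0 := subset_trans W1W0 W0U0.
have gl i := vec_hom_polyE q1 HF (gd i) W1U0 kW1 (Ga_coords W1).
have her i : hereditary (fun W => exists (P : nat -> 'M[OX W]_(1, d)) N, polyE q k kG (g i) P N).
  by move=> V W h [P [N hP]]; exists (fun j => map_mx (res h) (P j)), N; apply: polyE_res.
apply: locally_comp; apply: locally_mono (locally_forall her gl) => W2 W2W1 hg.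
have kW2 := coordsS W2W1 kW1; have W2U0 := subset_trans W2W1 W1U0.
have dl (ic : 'I_n * bd_Fq D) : exists PN : (nat -> 'M[OX W2]_(1, d)) * nat,
    polyE q k kG (dual_act (@am_phi _ _ _ _ _ E) (bd_FqA D ic.2) (g ic.1)) PN.1 PN.2.
  have [P [N hP]] := am_polyE w0 w1 aW1 kW1 (bd_FqA D ic.2).
  have [Q [M hQ]] := hg ic.1.
  by exists (tconv q Q (fun j => map_mx (res W2W1) (P j)), (M + N)%N);
     apply: (polyE_comp q1 HF hQ (polyE_res W2W1 hP)).
(* Finiteness of [Fq] bounds the degrees of the [g_i] composed with all [phi_c] at once. *)
have /choice[PN hPN] := dl; pose N := (\max_ic (PN ic).2)%N.
have dN i a : exists P : nat -> 'M[OX W2]_(1, d),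
    polyE q k kG (dual_act (@am_phi _ _ _ _ _ E) a (g i)) P N.
  have [c ->] := small a; exists (PN (i, c)).1.
  exact: (polyE_weaken (leq_bigmax (i, c)) (hPN (i, c))).
have [d0|d0] := posnP d.
  apply: locally_id => x y; apply: (coords_inj kW2 (fun x y => y)).
  by apply/matrixP => -[i hi]; exfalso; move: hi; rewrite d0.
pose i0 := Ordinal d0; pose J := N.+1.
apply: locally_mono (gen W2 _ W2U0 (coord_power_dual i0 J kW2)) => W3 W3W2 [l [b [a hf]]].
have /choice[P hP] (ij : 'I_n * 'I_l) := dN ij.1 (a ij.1 ij.2).
pose Q m : 'M[OX W3]_(1, d) := \sum_i \sum_j b i j *: map_mx (res W3W2) (P (i, j) m).
have hQ : polyE q k kG (fun V (e : E V) => k V e i0 0 ^+ (q ^ J) : OX V) Q N.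
  split=> [m Nm|V h x].
    by rewrite /Q big1 // => i _; rewrite big1 // => j _; have [-> // _] := hP (i, j);
       rewrite map_mx0 scaler0.
  rewrite hf /kG; apply/matrixP => x1 x2; rewrite mxE.
  have -> : evalS q (fun m => map_mx (res h) (Q m)) (k V x) N.+1 =
      \sum_i \sum_j res h (b i j) *: kG V (dual_act (@am_phi _ _ _ _ _ E) (a i j) (g i) x).
    under [RHS]eq_bigr => i _ do under eq_bigr => j _ do
      rewrite ((hP (i, j)).2 V (subset_trans h W3W2) x) scaler_sumr.
    under [RHS]eq_bigr => i _ do rewrite exchange_big /=.
    rewrite [RHS]exchange_big /=; apply: eq_bigr => m _.
    rewrite (map_mx_sum (res h)) mulmx_suml; apply: eq_bigr => i _.
    rewrite (map_mx_sum (res h)) mulmx_suml; apply: eq_bigr => j _.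
    by rewrite map_mxZ -scalemxAl (map_res_comp W3W2 h (subset_trans h W3W2)).
  rewrite summxE; apply: eq_bigr => i _; rewrite summxE; apply: eq_bigr => j _.
  by rewrite !mxE.
(* The coefficient of [sigma^J] is a basis row on one side and 0 on the other, so [1 = 0] in [OX W3]
   and its modules vanish. *)
have /(_ J) := polyE_uniq q1 HF w0 w1 (coordsS W3W2 kW2)
  (polyE_poly_on (@coord_power_poly W3 k i0 J)) hQ.
rewrite leqnn eqxx (hQ.1 J (ltnSn N)) => /matrixP/(_ 0 i0); rewrite !mxE !eqxx /= => one0 x y.
rewrite -[x]scale1r -[y]scale1r (_ : 1 = 0 :> OX W3) ?scale0r //; exact: one0.
Qed.

Lemma small_exponential : exists! psi : smap (Lie E) E, is_exponential psi.
Proof.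
(* Coordinates carry the triviality of [E] over to [O^d], where any sequence then converges to any
   limit. *)
have tr U (k : coords E d) (z z' : 'cV[OX U]_d) : is_coords U k -> z = z'.
  move=> kU; have UU : U `<=` U by [].
  have [x <-] := coords_surj kU UU z; have [y <-] := coords_surj kU UU z'.
  by rewrite (small_trivial x y).
exists (fun U v => v); split; last first.
  move=> psi _; apply/functional_extensionality_dep => U; apply/funext => v.
  exact: small_trivial.
have cvg U V (k : coords E d) u l : is_coords U k -> V `<=` U -> @converges _ _ (OX V) d u l.
  move=> kU VU; apply: mlim_converges => nu H i j; apply: nu_lim_ext (nu_lim_cst H _) => n.
  by rewrite (tr _ _ (u n) l (coordsS VU kU)).
split.
- split=> //.
  have [F [cF FP]] := locally_coords (whole X) (am_vector_bundle E).
  exists F; split=> // U /FP [aU [k kU]]; split=> //.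
  exists k, k, (fun=> 0); split=> // [nu H rho e rho0 e0|V h aV x]; last exact: cvg kU h.
  exists 0%N => m _; suff -> : mxnorm nu (0 : 'cV[OX U]_d) = 0 by rewrite mul0r.
  apply/eqP; rewrite eq_le mxnorm_ge0 andbT.
  by apply: mxnorm_le => // i j; rewrite mxE (nu0 H).
- by move=> a U v; apply: small_trivial.
- move=> U k aU kU; exists (tcst 1%:M); split=> // [nu H|V h aV v]; last exact: cvg kU h.
  apply: (entire_lne q1) => s s0; exists 1%N => -[|j] //= _.
  apply: mxnorm_le => [|a b]; first by rewrite exprn_ge0 // ltW.
  by rewrite mxE (nu0 H) exprn_ge0 // ltW.
Qed.

End Trivial.

Theorem corollary8p8 (R : realType) (D : base_data R)
    (X : rigid_space (bd_L D)) (d r : nat) (E : abelian_module X d r) :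
  exists! psi : smap (Lie E) E, is_exponential psi.
Proof.
have [w w0 w1] := bd_small D.
have [[a a1]|/forallNP small] := pselect (exists a, 1 < cvf_abs (bd_iota D a)).
  exists (exp_map w0 w1 a1); split; first exact: exp_map_exponential.
  exact: exponential_uniq.
apply: (small_exponential E w0 w1); apply: bd_small_finite => a.
by rewrite leNgt; apply/negP/small.
Qed.
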